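(* Let $N^n\subset M^{n+1}\subset\mathbb{R}^{n+2}$ be a non-degenerate immersion and let $\xi$ be a nowhere-vanishing vector field along $N$ in the osculating Darboux direction. The affine normal plane $\sigma(\xi)$ coincides with the Transon plane of $TN$ with respect to $M$ (at each point of $N$) if and only if $\xi$ is parallel, i.e. $D_X\xi$ is tangent to $N$ for every $X$ tangent to $N$.
   Context: $D$ is the standard flat connection and $[\cdot,\dots,\cdot]$ the determinant in $\mathbb{R}^{n+2}$. $M$ is a smooth hypersurface, $N$ a codimension $1$ immersed submanifold of $M$. For $\eta$ along $N$ transversal to $M$ and $\xi$ along $N$ tangent to $M$ and transversal to $N$, and $X,Y$ tangent to $N$, write $D_XY=\nabla_XY+h^1(X,Y)\xi+h^2(X,Y)\eta$ with $\nabla_XY$ tangent to $N$. $N\subset M$ is non-degenerate if $h^2$ is non-degenerate at each point (independent of choices). Then there is a unique direction along $N$ tangent to $M$ and transversal to $N$, spanned by $\xi$ with $D_X\xi$ tangent to $M$ for all $X\in TN$: the osculating Darboux direction. Affine metric: for $\xi$ in this direction and a local frame $\{X_1,\dots,X_n\}$ of $TN$ let $G_\xi(X,Y)=[X_1,\dots,X_n,D_XY,\xi]$ and $g_\xi(X,Y)=G_\xi(X,Y)/|\det(G_\xi(X_i,X_j))|^{1/(n+2)}$. With frames positively oriented for a fixed local orientation of $N$, this non-degenerate metric does not depend on the frame. Affine normal plane bundle: there is a vector field $\eta$ along $N$, transversal to $M$, such that $[X_1,\dots,X_n,\eta,\xi]=1$ for every (positively oriented) $g_\xi$-orthonormal frame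 of $TN$ (orthonormal meaning $g_\xi(X_i,X_j)=\delta_{ij}$, or $\pm\delta_{ij}$ if $g_\xi$ is indefinite) and $D_X\eta$ is tangent to $M$ for all $X\in TN$; it is unique up to $\eta\mapsto\eta+\lambda\xi$, $\lambda$ a function. The affine normal plane bundle $\sigma(\xi)$ is spanned by $\{\xi,\eta\}$. Transon plane: for $p\in N$ consider hyperplanes $H\neq T_pM$ through $p$ containing $T_pN$. Near $p$, $M\cap H$ is a non-degenerate hypersurface of $H$; let $\eta(H)$ be its affine Blaschke normal vector at $p$ (with respect to a parallel volume form on $H$; its direction does not depend on this form). When $H$ varies, all the vectors $\eta(H)$ belong to a single $2$-dimensional linear subspace, which they span: the Transon plane of $T_pN$ with respect to $M$. *)

(* Defs.v *)
From HB Require Import structures.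
From mathcomp Require Import all_boot all_order all_algebra.
From mathcomp Require Import all_classical all_reals all_analysis.

Set Implicit Arguments.
Unset Strict Implicit.
Unset Printing Implicit Defensive.

Import Order.TTheory GRing.Theory Num.Theory.
Import numFieldNormedType.Exports.

Local Open Scope classical_set_scope.
Local Open Scope ring_scope.

(** Vectors are row vectors; a family of [k] vectors is a matrix with [k]
    rows, and its span is the row space of that matrix. *)

(** ** Smoothness *)

Definition iter_derive (R : realType) (V W : normedModType R)
    (s : seq V) (F : V -> W) : V -> W :=
  foldr (fun v G => 'D_v G) F s.

(* [F] is C^oo on the open set [U]: every iterated directional derivative is
   (Frechet) differentiable, hence continuous, on [U]. *)
Definition smooth_on (R : realType) (V W : normedModType R)
    (U : set V) (F : V -> W) : Prop :=
  forall (s : seq V) (x : V), U x -> differentiable (iter_derive s F) x.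

(** ** Smooth manifolds *)

(* The atlas contains one chart around each point, [chart p] on [dom p], with
   inverse [param p]. The functions are total, but their values are relevant
   only on [dom p] and on its image by [chart p]. *)
Record manifold (R : realType) (n : nat) := Manifold {
  carrier :> topologicalType;
  dom : carrier -> set carrier;
  chart : carrier -> carrier -> 'rV[R]_n;
  param : carrier -> 'rV[R]_n -> carrier;
  carrier_hausdorff : hausdorff_space carrier;
  carrier_second_countable : @second_countable carrier;
  dom_open : forall p, open (dom p);
  mem_dom : forall p, dom p p;
  chartK : forall p q, dom p q -> param p (chart p q) = q;
  chart_open : forall p, open (chart p @` dom p);
  chart_continuous : forall p q, dom p q -> {for q, continuous (chart p)};
  param_continuous : forall p q, dom p q ->
    {for chart p q, continuous (param p)};
  transition_smooth : forall p q,
    smooth_on (chart p @` (dom p `&` dom q)) (chart q \o param p)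
}.

Section Immersions.
Context (R : realType) (n : nat) (N : manifold R n).

Definition msmooth_on (W : normedModType R) (U : set N) (Z : N -> W) : Prop :=
  forall p : N, smooth_on (chart p @` (dom p `&` U)) (Z \o param p).

Context (m : nat) (f : N -> 'rV[R]_m).

(* The row space of [TN p] is the tangent space of [N] at [p], viewed in R^m
   through [f]. *)
Definition TN (p : N) : 'M[R]_(n, m) := 'J (f \o param p) (chart p p).

Definition immersion : Prop :=
  msmooth_on setT f /\ forall p, row_free (TN p).

(* D_X Z at [p], for [X] in the tangent space of [N] at [p]. The vector
   [X *m pinvmx (TN p)] is the coordinate vector of [X] in the chart at [p]. *)
Definition flatD (W : normedModType R) (Z : N -> W) (p : N) (X : 'rV[R]_m) :
    W :=
  'D_(X *m pinvmx (TN p)) (Z \o param p) (chart p p).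

Definition tangent_field (U : set N) (Y : N -> 'rV[R]_m) : Prop :=
  msmooth_on U Y /\ forall q, U q -> (Y q <= TN q)%MS.

Definition local_frame (U : set N) (E : N -> 'M[R]_(n, m)) : Prop :=
  msmooth_on U E /\ forall q, U q -> row_free (E q) && (E q <= TN q)%MS.

End Immersions.

(** ** Hypersurfaces of R^d *)

Section Hypersurfaces.
Context (R : realType) (d : nat).
Implicit Types (M W : set 'rV[R]_d) (F : 'rV[R]_d -> R^o) (q v : 'rV[R]_d).

Definition defining_function M W F : Prop :=
  [/\ open W, smooth_on W F, M `&` W = [set x | W x /\ F x = 0] &
      forall x, W x -> M x -> exists v, 'D_v F x != 0].

Definition hypersurface M : Prop :=
  forall q, M q -> exists W F, W q /\ defining_function M W F.

(* [v] is tangent to [M] at [q] *)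
Definition TM M q v : Prop :=
  exists W F, [/\ W q, defining_function M W F & 'D_v F q = 0].

End Hypersurfaces.

(* Coordinates of [w] along the rows of [T], in the basis of R^(n+k) made of
   the rows of [F] followed by those of [T]. *)
Definition transversal_part (R : realType) (n k : nat)
    (F : 'M[R]_(n, n + k)) (T : 'M[R]_(k, n + k)) (w : 'rV[R]_(n + k)) :
    'rV[R]_k :=
  rsubmx (w *m invmx (col_mx F T)).

(** ** Blaschke normal of a hypersurface of R^(n+1) *)

Section Blaschke.
Context (R : realType) (n : nat).
Implicit Types (psi zeta : 'rV[R]_n -> 'rV[R]_(n + 1)) (u : 'rV[R]_n).

(* h(d_i, d_j), where D_X Y = nabla_X Y + h(X, Y) zeta *)
Definition blaschke_form psi zeta u : 'M[R]_n :=
  \matrix_(i, j) transversal_part ('J psi u) (zeta u)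
    ('D_(delta_mx 0 i) ('D_(delta_mx 0 j) psi) u) 0 0.

(* The last two clauses say that [zeta] is equiaffine and that the volume
   form it induces is the volume form of [h]. *)
Definition blaschke_field (O : set 'rV[R]_n) psi zeta : Prop :=
  smooth_on O zeta /\
  forall u, O u ->
    [/\ col_mx ('J psi u) (zeta u) \in unitmx,
        \det (blaschke_form psi zeta u) != 0,
        forall a : 'rV[R]_n, ('D_a zeta u <= 'J psi u)%MS &
        `|\det (col_mx ('J psi u) (zeta u))| =
          Num.sqrt `|\det (blaschke_form psi zeta u)| ].

Definition blaschke_normal (S : set 'rV[R]_(n + 1)) (q z : 'rV[R]_(n + 1)) :
    Prop :=
  exists O psi zeta u0,
    [/\ [/\ open O, O u0 & psi u0 = q],
        smooth_on O psi,
        forall u, O u -> row_free ('J psi u) /\ S (psi u),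
        blaschke_field O psi zeta &
        zeta u0 = z].

End Blaschke.

(** ** Immersions of codimension 1 in a hypersurface of R^(n+2) *)

Section CodimensionTwo.
Context (R : realType) (n : nat) (M : set 'rV[R]_(n + 2)).
Context (N : manifold R n) (f : N -> 'rV[R]_(n + 2)).
Implicit Types (p q : N) (U : set N) (X Y xi eta : N -> 'rV[R]_(n + 2)).
Implicit Types (E : N -> 'M[R]_(n, n + 2)).

(* [X_1, ..., X_n, v, w], the rows of [A] being X_1, ..., X_n *)
Definition bracket (A : 'M[R]_(n, n + 2)) (v w : 'rV[R]_(n + 2)) : R :=
  \det (col_mx A (col_mx v w)).

(* h^2(X, Y) at [p], where D_X Y = nabla_X Y + h^1(X, Y) a + h^2(X, Y) b *)
Definition h2 (a b : 'rV[R]_(n + 2)) p (X : 'rV[R]_(n + 2)) Y : R :=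
  transversal_part (k := 2) (TN f p) (col_mx a b) (flatD f Y p X) 0 ord_max.

(* Non-degeneracy does not depend on the transversal vectors [a] and [b]. *)
Definition nondegenerate_immersion : Prop :=
  forall p, exists a b,
    [/\ TM M (f p) a, ~~ (a <= TN f p)%MS, ~ TM M (f p) b &
        forall X : 'rV[R]_(n + 2), (X <= TN f p)%MS ->
          (forall U Y, open U -> U p -> tangent_field f U Y ->
             h2 a b p X Y = 0) ->
          X = 0].

Definition darboux_field xi : Prop :=
  msmooth_on setT xi /\
  forall p,
    [/\ xi p != 0, TM M (f p) (xi p), ~~ (xi p <= TN f p)%MS &
        forall X : 'rV[R]_(n + 2), (X <= TN f p)%MS ->
          TM M (f p) (flatD f xi p X)].

Definition Gform E xi X Y q : R := bracket (E q) (flatD f Y q (X q)) (xi q).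

Definition field_of (E : N -> 'M[R]_(n, n + 2)) (i : 'I_n) :
    N -> 'rV[R]_(n + 2) :=
  fun q => row i (E q).

Definition affine_metric E xi X Y q : R :=
  Gform E xi X Y q /
  `|\det (\matrix_(i, j) Gform E xi (field_of E i) (field_of E j) q)|
    `^ (n.+2%:R)^-1.

(* [X] has the orientation of [E] at [q]. *)
Definition same_orientation E (X : N -> 'M[R]_(n, n + 2)) q : Prop :=
  exists A : 'M[R]_n, X q = A *m E q /\ 0 < \det A.

(* Entries +-1 on the diagonal cover all signatures. *)
Definition orthonormal_frame E xi (X : N -> 'M[R]_(n, n + 2)) q : Prop :=
  forall i j,
    `|affine_metric E xi (field_of X i) (field_of X j) q| = (i == j)%:R.

(* The local orientation of [N] is that of the frame [E] on [U]. *)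
Definition affine_normal_field xi U E eta : Prop :=
  [/\ msmooth_on U eta,
      forall q, U q -> ~ TM M (f q) (eta q),
      forall q (X : 'rV[R]_(n + 2)), U q -> (X <= TN f q)%MS ->
        TM M (f q) (flatD f eta q X) &
      forall q U' (X : N -> 'M[R]_(n, n + 2)), U q ->
        open U' -> U' q -> local_frame f U' X ->
        same_orientation E X q -> orthonormal_frame E xi X q ->
        bracket (X q) (eta q) (xi q) = 1].

Definition affine_normal_plane xi p : set 'rV[R]_(n + 2) :=
  [set v | exists U E eta,
     [/\ open U, U p, local_frame f U E, affine_normal_field xi U E eta &
         (v <= col_mx (xi p) (eta p))%MS]].

(* [eta] is a Blaschke normal vector at [f p] of the section of [M] by a
   hyperplane H through [f p]. The matrix [B] is a basis of the direction of
   H, which identifies H with R^(n+1); the parallel volume form on H is the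
   one for which this basis has volume 1. *)
Definition section_normal p (eta : 'rV[R]_(n + 2)) : Prop :=
  exists (B : 'M[R]_(n + 1, n + 2)) (z : 'rV[R]_(n + 1)),
    [/\ row_free B, (TN f p <= B)%MS,
        ~ (forall v : 'rV[R]_(n + 2), (v <= B)%MS <-> TM M (f p) v),
        blaschke_normal [set y | M (f p + y *m B)] 0 z &
        eta = z *m B].

Definition transon_plane p : set 'rV[R]_(n + 2) :=
  [set v | exists (k : nat) (C : 'M[R]_(k, n + 2)),
     (forall i, section_normal p (row i C)) /\ (v <= C)%MS].

Definition parallel_field xi : Prop :=
  forall p (X : 'rV[R]_(n + 2)), (X <= TN f p)%MS ->
    (flatD f xi p X <= TN f p)%MS.

End CodimensionTwo.

(* Main.v *)
(* Let F be a local defining function of M, T a frame of TN, h = d^2F(T, T), and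
   tau(X) the xi-component of D_X xi. Differentiating logarithmically the volume
   normalization of the affine normal field and using that D_X eta is tangent to M,
   one finds that v = eta satisfies
     (n + 2) d^2F(X, v) = (tr(h^-1 d^3F(X, T, T)) - 2 tau(X)) dF(v),  X in TN.
   The Blaschke normal of a section of M by a hyperplane satisfies the same
   equation with tau = 0, the role of xi being played by a constant vector. The
   vector xi lies in the plane defined by either family of equations, since it
   is d^2F-orthogonal to TN and dF(xi) = 0; as dF(eta) <> 0, the two planes
   coincide if and only if tau = 0. *)

Require Import Defs.
From mathcomp Require Import all_boot all_order all_algebra.
From mathcomp Require Import all_classical all_reals all_analysis.
From mathcomp Require Import zify ring lra.

Set Implicit Arguments.
Unset Strict Implicit.
Unset Printing Implicit Defensive.

Import Order.TTheory GRing.Theory Num.Theory.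
Import numFieldNormedType.Exports.

Local Open Scope classical_set_scope.
Local Open Scope ring_scope.

(** * Smooth maps *)

(** Only two facts about a normal field eta are used. The scalar g = dF(eta) determines eta modulo
    TM, and D_X eta is tangent to M exactly when dg(X) = d^2F(X, eta). The volume normalization is
    then a condition on g alone, because a bracket containing eta is dF(eta)/dF(nu) times the
    bracket containing a constant vector nu. With nu constant, the second derivatives of the
    parametrization enter the logarithmic derivatives of [T, nu, xi] and of det h through the same
    trace; in the relation between the fourth power of the former and the square of the latter this
    trace cancels. Even powers also remove roots, absolute values and signs. Read backwards, the
    same two facts construct normals: the volume condition is solved for g, and eta then comes from
    a linear system with right-hand side (dg, g). Existence has to be proved, because both planes
    are sets of vectors obtained from some normal and could otherwise be too small; this requires
    parametrizing the sections of M, hence an implicit function theorem. *)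

Section SmoothBasics.
Context (R : realType) (V W : normedModType R).
Implicit Types (U : set V) (F G : V -> W).

Lemma smooth_diff U F x : smooth_on U F -> U x -> differentiable F x.
Proof. by move=> sF; exact: (sF [::]). Qed.

Lemma smooth_derive U F v : smooth_on U F -> smooth_on U ('D_v F).
Proof.
by move=> sF s x Ux; have := sF (rcons s v) x Ux; rewrite /iter_derive foldr_rcons.
Qed.

Lemma smooth_subset U U' F : U' `<=` U -> smooth_on U F -> smooth_on U' F.
Proof. by move=> UU' sF s x /UU' Ux; exact: sF. Qed.

Lemma near_open_eq U F G x : open U -> (forall y, U y -> F y = G y) -> U x ->
  \near x, F x = G x.
Proof.
by move=> oU FG Ux; apply: (filterS FG); exact: open_nbhs_nbhs.
Qed.

(** The first-order expansion at [x] sees only the germ of the function, so the differential of [F]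
    serves for [G]. *)
Lemma near_eq_differentiable F G x : (\near x, F x = G x) ->
  differentiable F x -> differentiable G x.
Proof.
move=> FG dF.
have Fx : F x = G x := nbhs_singleton FG.
have FG' : \forall y \near (0 : V), F (y + x) = G (y + x).
  by move: FG; rewrite (near_shift 0)/=; apply: filterS => y; rewrite subr0.
have /diff_locallyP[cF eF] := dF.
apply/diff_locallyP.
suff eG : G \o shift x = cst (G x) + 'd F x +o_ 0 id.
  by rewrite (diff_unique cF eG).
apply/eqaddoP => e e0; move: eF => /eqaddoP/(_ e e0) he.
near=> y.
rewrite -[(_ - _) y]/(G (y + x) - (G x + 'd F x y)) -Fx.
have <- : F (y + x) = G (y + x) by near: y.
by near: y; exact: he.
Unshelve. all: by end_near. Qed.

Lemma iter_derive_eq U F G s x : open U -> (forall y, U y -> F y = G y) ->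
  U x -> iter_derive s F x = iter_derive s G x.
Proof.
move=> oU FG; elim: s x => [|v s IH] x Ux /=; first exact: FG.
by apply: near_eq_derive; exact: near_open_eq oU IH Ux.
Qed.

Lemma smooth_eq U F G : open U -> (forall y, U y -> F y = G y) ->
  smooth_on U F -> smooth_on U G.
Proof.
move=> oU FG sF s x Ux; apply: near_eq_differentiable (sF s x Ux).
by apply: (near_open_eq oU _ Ux) => y Uy; exact: iter_derive_eq oU FG Uy.
Qed.

(** Exhibiting a class closed under directional derivatives avoids any formula for iterated
    derivatives of products, quotients or composites. A derivative need only agree on [U] with a
    member of the class; openness lets this equality be differentiated again. *)
Lemma smooth_coind U (P : (V -> W) -> Prop) : open U ->
  (forall F x, P F -> U x -> differentiable F x) ->
  (forall F v, P F -> exists2 G, P G & forall x, U x -> 'D_v F x = G x) ->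
  forall F, P F -> smooth_on U F.
Proof.
move=> oU Pd PD F PF s x Ux.
suff [G PG GE] : exists2 G, P G & forall x, U x -> iter_derive s F x = G x.
  apply: (@near_eq_differentiable G); last exact: Pd.
  by apply: (near_open_eq oU _ Ux) => y Uy; rewrite GE.
elim: s {x Ux} => [|v s [G PG GE]]; first by exists F.
have [G' PG' GE'] := PD G v PG; exists G' => // x Ux /=.
rewrite -GE' //; apply: near_eq_derive; exact: near_open_eq oU GE Ux.
Qed.

Lemma smooth_cst U (c : W) : smooth_on U (fun=> c).
Proof.
move=> s x _; suff [c' ->] : exists c' : W, iter_derive s (fun=> c) = fun=> c'.
  exact: differentiable_cst.
elim: s => [|v s [c' E]] /=; first by exists c.
by exists 0; rewrite E; apply/funext => y; exact: derive_cst.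
Qed.

End SmoothBasics.

Section MatrixCalculus.
Context (R : realType) (V : normedModType R).

Lemma differentiable_mx m n (F : V -> 'M[R]_(m, n)) x :
  (forall i j, differentiable (fun y => F y i j : R^o) x) -> differentiable F x.
Proof.
move=> dF.
have -> : F = \sum_(k < m) \sum_(l < n) (fun y => F y k l *: (delta_mx k l : 'M[R]_(m, n))).
  apply/funext => y; rewrite fct_sumE [LHS]matrix_sum_delta.
  by apply: eq_bigr => k _; rewrite fct_sumE.
apply: differentiable_sum => k; apply: differentiable_sum => l.
exact: differentiableZl.
Qed.

Lemma differentiable_entry m n (F : V -> 'M[R]_(m, n)) x i j :
  differentiable F x -> differentiable (fun y => F y i j : R^o) x.
Proof.
move=> dF.
apply: (@differentiable_comp _ _ _ _ F (fun M : 'M[R]_(m, n) => M i j : R^o)) => //.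
exact: differentiable_coord.
Qed.

Lemma derive_entry m n (F : V -> 'M[R]_(m, n)) x v i j :
  differentiable F x -> 'D_v F x i j = 'D_v (fun y => F y i j : R^o) x.
Proof. by move=> dF; rewrite derive_mx ?mxE//; exact: diff_derivable. Qed.

End MatrixCalculus.

Section DeriveLinear.
Context (R : realType) (V : normedModType R).

Lemma deriveDl (W : normedModType R) (F : V -> W) x a b :
  differentiable F x -> 'D_(a + b) F x = 'D_a F x + 'D_b F x.
Proof. by move=> dF; rewrite !deriveE// linearD. Qed.

Lemma deriveZl (W : normedModType R) (F : V -> W) x (k : R) a :
  differentiable F x -> 'D_(k *: a) F x = k *: 'D_a F x.
Proof. by move=> dF; rewrite !deriveE// linearZ. Qed.

Lemma deriveSl (W : normedModType R) (F : V -> W) x I (r : seq I) (a : I -> V) :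
  differentiable F x -> 'D_(\sum_(i <- r) a i) F x = \sum_(i <- r) 'D_(a i) F x.
Proof.
move=> dF; elim/big_rec2: _ => [|i y1 y2 _ <-]; first exact: derive0.
exact: deriveDl.
Qed.

End DeriveLinear.

Lemma derive_row (R : realType) (W : normedModType R) n (F : 'rV[R]_n -> W) x (a : 'rV[R]_n) :
  differentiable F x ->
  'D_a F x = \sum_j a 0 j *: 'D_(delta_mx 0 j) F x.
Proof.
move=> dF; rewrite [X in 'D_X F x]row_sum_delta.
have /= -> := deriveSl (index_enum 'I_n) (fun j => a 0 j *: delta_mx 0 j) dF.
by apply: eq_bigr => j _; rewrite deriveZl.
Qed.

Section Composition.
Context (R : realType) (V : normedModType R).

Lemma derive_comp (V' W : normedModType R) (F : V -> V') (G : V' -> W) x v :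
  differentiable F x -> differentiable G (F x) ->
  'D_v (G \o F) x = 'D_('D_v F x) G (F x).
Proof.
move=> dF dG; rewrite !deriveE//; last exact: differentiable_comp.
by rewrite diff_comp.
Qed.

(** A syntactic class to feed to [smooth_coind]: the rules of differentiation turn the derivative of
    an expression into an expression. In [SE_comp] the inner map is given coordinate by coordinate,
    so that the chain rule again yields a sum of products of expressions. *)
Inductive smooth_expr (U : set V) : (V -> R^o) -> Prop :=
| SE_base f : smooth_on U f -> smooth_expr U f
| SE_add f g : smooth_expr U f -> smooth_expr U g ->
    smooth_expr U (fun x => f x + g x)
| SE_mul f g : smooth_expr U f -> smooth_expr U g ->
    smooth_expr U (fun x => f x * g x)
| SE_inv f : (forall x, U x -> f x != 0) -> smooth_expr U f ->
    smooth_expr U (fun x => (f x)^-1)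
| SE_pow f a : (forall x, U x -> 0 < f x) -> smooth_expr U f ->
    smooth_expr U (fun x => f x `^ a)
| SE_comp m (B : set 'rV[R]_m) (G : 'rV[R]_m -> R^o) F :
    smooth_on B G -> (forall x, U x -> B (F x)) ->
    (forall j, smooth_expr U (fun x => F x 0 j)) ->
    smooth_expr U (fun x => G (F x)).

Lemma smooth_expr_diff U f x : smooth_expr U f -> U x -> differentiable f x.
Proof.
move=> sf Ux.
elim: sf => {f} [f sf|f g _ df _ dg|f g _ df _ dg|f f0 _ df|f a f0 _ df
  |m B G F sG FB _ dF].
- exact: smooth_diff sf Ux.
- exact: differentiableD.
- exact: differentiableM.
- by apply: differentiableV => //; exact: f0.
- apply: (@differentiable_comp _ _ _ _ f (fun y : R^o => y `^ a : R^o)) => //.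
  apply/derivable1_diffP; have := is_derive1_powR a (f0 x Ux).
  by move=> H; apply: ex_derive.
- apply: (@differentiable_comp _ _ _ _ F G).
    by apply: differentiable_mx => i j; rewrite (ord1 i).
  by apply: smooth_diff sG _; exact: FB.
Qed.

Lemma smooth_expr_sum U I (r : seq I) (f : I -> V -> R^o) :
  (forall i, smooth_expr U (f i)) ->
  smooth_expr U (fun x => \sum_(i <- r) f i x).
Proof.
move=> sf; elim: r => [|i r IH].
  under eq_fun do rewrite big_nil.
  exact/SE_base/smooth_cst.
under eq_fun do rewrite big_cons.
exact: SE_add.
Qed.

Lemma smooth_exprP U f : open U -> smooth_expr U f -> smooth_on U f.
Proof.
move=> oU; move: f; apply: smooth_coind oU _ _ => [f x|f v sf].
  exact: smooth_expr_diff.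
elim: sf => {f} [f sf|f g sf [f' sf' Df] sg [g' sg' Dg]
  |f g sf [f' sf' Df] sg [g' sg' Dg]|f f0 sf [f' sf' Df]|f a f0 sf [f' sf' Df]
  |m B G F sG FB sF DF].
- by exists ('D_v f) => //; apply/SE_base/smooth_derive.
- exists (fun x => f' x + g' x); first exact: SE_add.
  move=> x Ux; rewrite -Df// -Dg//.
  by apply: deriveD; apply: diff_derivable; apply: smooth_expr_diff; eassumption.
- exists (fun x => f x * g' x + g x * f' x).
    by apply: SE_add; apply: SE_mul.
  move=> x Ux; rewrite -Df// -Dg//.
  by apply: deriveM; apply: diff_derivable; apply: smooth_expr_diff; eassumption.
- exists (fun x => -1 * ((f x)^-1 * (f x)^-1) * f' x).
    apply: SE_mul => //; apply: SE_mul; first exact/SE_base/smooth_cst.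
    by apply: SE_mul; apply: SE_inv.
  move=> x Ux; rewrite -Df//.
  have := deriveV (f0 _ Ux) (diff_derivable (smooth_expr_diff sf Ux)) => ->.
  by rewrite -[in RHS]invfM -expr2 mulN1r.
- exists (fun x => a * f x `^ (a - 1) * f' x).
    apply: SE_mul => //; apply: SE_mul; first exact/SE_base/smooth_cst.
    exact: SE_pow.
  move=> x Ux; rewrite -Df//.
  have H := is_derive1_powR a (f0 x Ux).
  have dP : differentiable (fun y : R^o => y `^ a : R^o) (f x).
    by apply/derivable1_diffP; apply: ex_derive.
  have df := smooth_expr_diff sf Ux.
  rewrite [LHS](derive_comp v df dP).
  have {1}-> : 'D_v f x = 'D_v f x *: (1 : R^o) by rewrite /GRing.scale/= mulr1.
  by rewrite deriveZl// derive_val /GRing.scale/= mulrC.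
- have dF x : U x -> differentiable F x.
    move=> Ux; apply: differentiable_mx => i j; rewrite (ord1 i).
    exact: smooth_expr_diff (sF j) Ux.
  (* The induction hypothesis provides an expression for the derivative of each coordinate of [F];
     [g] selects one for each [j]. *)
  pose g j := sval (cid2 (DF j)).
  have sg j : smooth_expr U (g j) by rewrite /g; case: cid2.
  have gE j x : U x -> 'D_v (fun x => F x 0 j : R^o) x = g j x.
    by rewrite /g; case: cid2 => /= h _; apply.
  exists (fun x => \sum_j g j x * 'D_(delta_mx 0 j) G (F x)).
    apply: smooth_expr_sum => j; apply: SE_mul => //.
    apply: (@SE_comp U m B ('D_(delta_mx 0 j) G) F) => //.
    exact: smooth_derive.
  move=> x Ux; have dG : differentiable G (F x).
    by apply: smooth_diff sG _; exact: FB.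
  rewrite [LHS](derive_comp v (dF x Ux) dG).
  rewrite derive_row//; apply: eq_bigr => j _.
  by rewrite derive_entry ?gE//; exact: dF.
Qed.

End Composition.

Section SmoothMatrix.
Context (R : realType) (V : normedModType R) (U : set V) (oU : open U).

(** Taking an entry commutes with an iterated derivative only once the shorter iterated derivatives
    are known to be differentiable. This is why the converse direction is an induction on the length
    of the list of directions. *)
Lemma smooth_mxP m n (F : V -> 'M[R]_(m, n)) :
  smooth_on U F <-> forall i j, smooth_on U (fun x => F x i j : R^o).
Proof.
have E s : (forall t x, (size t < size s)%N -> U x -> differentiable (iter_derive t F) x) ->
    forall x i j, U x ->
    iter_derive s (fun x => F x i j : R^o) x = iter_derive s F x i j.
  elim: s => [|v s IH] dF x i j Ux //=.
  rewrite derive_entry; last by apply: dF => //=.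
  apply: near_eq_derive; apply: near_open_eq oU _ Ux => y Uy.
  by apply: IH => // t z ts Uz; apply: dF => //=; exact: ltnW.
split=> [sF i j s x Ux|sF s].
  have Es := E s (fun t x _ => sF t x).
  apply: near_eq_differentiable (differentiable_entry i j (sF s x Ux)).
  by apply: near_open_eq oU _ Ux => y Uy; rewrite Es.
have [k] := ubnP (size s); elim: k s => // k IH s sk x Ux.
apply: differentiable_mx => i j.
apply: near_eq_differentiable (sF i j s x Ux).
apply: near_open_eq oU _ Ux => y Uy; rewrite E// => t z ts Uz.
by apply: IH => //; exact: leq_trans ts _.
Qed.

Implicit Types f g : V -> R^o.

Lemma smoothD f g : smooth_on U f -> smooth_on U g ->
  smooth_on U (fun x => f x + g x : R^o).
Proof. by move=> sf sg; apply: smooth_exprP => //; apply: SE_add; exact: SE_base. Qed.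

Lemma smoothM f g : smooth_on U f -> smooth_on U g ->
  smooth_on U (fun x => f x * g x : R^o).
Proof. by move=> sf sg; apply: smooth_exprP => //; apply: SE_mul; exact: SE_base. Qed.

Lemma smoothV f : (forall x, U x -> f x != 0) -> smooth_on U f ->
  smooth_on U (fun x => (f x)^-1 : R^o).
Proof. by move=> f0 sf; apply: smooth_exprP => //; apply: SE_inv => //; exact: SE_base. Qed.

Lemma smooth_powR f a : (forall x, U x -> 0 < f x) -> smooth_on U f ->
  smooth_on U (fun x => f x `^ a : R^o).
Proof. by move=> f0 sf; apply: smooth_exprP => //; apply: SE_pow => //; exact: SE_base. Qed.

Lemma smoothN f : smooth_on U f -> smooth_on U (fun x => - f x : R^o).
Proof.
move=> sf; under eq_fun do rewrite -mulN1r.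
by apply: smoothM => //; exact: smooth_cst.
Qed.

Lemma smooth_sum I (r : seq I) (f : I -> V -> R^o) :
  (forall i, smooth_on U (f i)) ->
  smooth_on U (fun x => \sum_(i <- r) f i x : R^o).
Proof.
by move=> sf; apply/(smooth_exprP oU)/smooth_expr_sum => i; exact: SE_base.
Qed.

Lemma smooth_prod I (r : seq I) (f : I -> V -> R^o) :
  (forall i, smooth_on U (f i)) ->
  smooth_on U (fun x => \prod_(i <- r) f i x : R^o).
Proof.
move=> sf; elim: r => [|i r IH].
  under eq_fun do rewrite big_nil.
  exact: smooth_cst.
under eq_fun do rewrite big_cons.
exact: smoothM.
Qed.

Lemma smoothX f k : smooth_on U f -> smooth_on U (fun x => f x ^+ k : R^o).
Proof.
move=> sf; elim: k => [|k IH]; first by under eq_fun do rewrite expr0; exact: smooth_cst.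
by under eq_fun do rewrite exprS; exact: smoothM.
Qed.

End SmoothMatrix.

Section SmoothComp.
Context (R : realType) (V : normedModType R) (U : set V) (oU : open U).
Context (m : nat) (B : set 'rV[R]_m) (F : V -> 'rV[R]_m).
Hypotheses (oB : open B) (sF : smooth_on U F) (FB : forall x, U x -> B (F x)).

Lemma smooth_scomp (G : 'rV[R]_m -> R^o) :
  smooth_on B G -> smooth_on U (fun x => G (F x)).
Proof.
move=> sG; apply: smooth_exprP oU (SE_comp sG FB _) => k; apply/SE_base.
by move/(smooth_mxP oU) : sF => /(_ 0 k).
Qed.

Lemma smooth_comp a b (G : 'rV[R]_m -> 'M[R]_(a, b)) :
  smooth_on B G -> smooth_on U (fun x => G (F x)).
Proof.
move=> /(smooth_mxP oB) sG; apply/(smooth_mxP oU) => i j.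
exact: smooth_scomp (sG i j).
Qed.

End SmoothComp.

(** * Symmetry of second derivatives *)

Section Lines.
Context (R : realType) (V : normedModType R).

Lemma is_derive_line (F : V -> R^o) y v (s : R) :
  differentiable F (y + s *: v) ->
  is_derive s 1 (fun s : R^o => F (y + s *: v) : R^o) ('D_v F (y + s *: v)).
Proof.
move=> dF.
have dl : is_diff s (fun s : R^o => y + s *: v) (fun s => s *: v).
  have -> : (fun s => s *: v) = 0 + *:%R^~ v by rewrite add0r.
  exact: (is_diffD (is_diff_cst y s) (is_diff_scalel s v)).
have dc : differentiable ((F : V -> R^o) \o (fun s : R^o => y + s *: v)) s.
  by apply: differentiable_comp => //; exact: (@ex_diff _ _ _ _ _ _ _ dl).
apply: DeriveDef; first exact/derivable1_diffP.
by rewrite deriveE// diff_comp//= diff_val scale1r -deriveE.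
Qed.

Lemma line_mvt (F : V -> R^o) y v (h : R) : 0 < h ->
  (forall s, 0 <= s <= h -> differentiable F (y + s *: v)) ->
  exists2 s, 0 <= s <= h & F (y + h *: v) - F y = h * 'D_v F (y + s *: v).
Proof.
move=> h0 dF.
have [s||s sh E] := @MVT _ (fun s : R^o => F (y + s *: v))
  (fun s => 'D_v F (y + s *: v)) 0 h h0.
- by rewrite in_itv/= => /andP[s0 sh]; apply/is_derive_line/dF; rewrite !ltW.
- apply: continuous_in_subspaceT => s; rewrite inE/= in_itv/= => /dF/is_derive_line H.
  apply: differentiable_continuous; apply/derivable1_diffP.
  by apply: ex_derive.
- exists s; first by move: sh; rewrite in_itv/= => /andP[? ?]; rewrite !ltW.
  by move: E; rewrite scale0r addr0 subr0 mulrC.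
Qed.

Lemma nbhs_box (A : set V) x v w : nbhs x A -> exists2 h : R, 0 < h &
  forall s t, 0 <= s <= h -> 0 <= t <= h -> A (x + s *: v + t *: w).
Proof.
move=> /nbhs_ballP[e /= e0 eA].
have n0 : 0 < `|v| + `|w| + 1 by rewrite ltr_wpDl// addr_ge0.
exists (e / (`|v| + `|w| + 1) / 2); first by rewrite !divr_gt0.
set h := _ / 2 => s t /andP[s0 sh] /andP[t0 th]; apply: eA.
rewrite -ball_normE/= -addrA opprD addrA subrr add0r normrN.
apply: le_lt_trans (ler_normD _ _) _; rewrite !normrZ !ger0_norm//.
apply: (@le_lt_trans _ _ (h * (`|v| + `|w| + 1))).
  by rewrite !mulrDr mulr1 ler_wpDr ?(le_trans s0)// lerD// ler_wpM2r.
rewrite /h mulrAC divfK ?gt_eqF//; lra.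
Qed.

(** The mean value theorem is applied twice: along [v] to the increment F(y + h w) - F(y), then
    along [w] to the derivative of [F] in direction [v]. *)
Lemma second_difference (F : V -> R^o) (U : set V) x v w (h : R) :
  smooth_on U F -> 0 < h ->
  (forall s t, 0 <= s <= h -> 0 <= t <= h -> U (x + s *: v + t *: w)) ->
  exists s t, [/\ 0 <= s <= h, 0 <= t <= h &
    F (x + h *: v + h *: w) - F (x + h *: v) - F (x + h *: w) + F x =
      h * h * 'D_w ('D_v F) (x + s *: v + t *: w)].
Proof.
move=> sF h0 hU.
have hh : 0 <= h <= h by rewrite lexx ltW.
have h00 : 0 <= (0 : R) <= h by rewrite lexx ltW.
pose G y := F (y + h *: w) - F y : R^o.
have dsh y : differentiable F (y + h *: w) ->
    is_diff y (fun y => F (y + h *: w) : R^o) ('d F (y + h *: w)).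
  move=> dF.
  have ds : is_diff y (fun y => y + h *: w) id.
    have -> : id = id + 0 :> (V -> V) by rewrite addr0.
    exact: (is_diffD (is_diff_id y) (is_diff_cst (h *: w) y)).
  have dF' : is_diff (y + h *: w) F ('d F (y + h *: w)) by exact/differentiableP.
  by have := is_diff_comp ds dF'.
have Ud s : 0 <= s <= h -> differentiable F (x + s *: v) /\
    differentiable F (x + s *: v + h *: w).
  move=> sh; split; last by apply: smooth_diff sF _; exact: hU.
  by apply: smooth_diff sF _; have := hU s 0 sh h00; rewrite scale0r addr0.
have dG s : 0 <= s <= h -> differentiable G (x + s *: v).
  move=> /Ud[d1 d2]; apply: differentiableB => //.
  exact: (@ex_diff _ _ _ _ _ _ _ (dsh _ d2)).
have DG s : 0 <= s <= h -> 'D_v G (x + s *: v) =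
    'D_v F (x + s *: v + h *: w) - 'D_v F (x + s *: v).
  move=> sh; have [d1 d2] := Ud s sh; have d3 := dsh _ d2.
  have d4 := @ex_diff _ _ _ _ _ _ _ d3.
  have -> : 'D_v G (x + s *: v) = 'D_v (fun y => F (y + h *: w) : R^o) (x + s *: v)
      - 'D_v F (x + s *: v) by apply: deriveB; exact: diff_derivable.
  by rewrite [X in X - _]deriveE// (@diff_val _ _ _ _ _ _ _ d3) -deriveE.
have [s sh E] := line_mvt h0 dG.
have [|t th E'] := @line_mvt ('D_v F) (x + s *: v) w h h0.
  by move=> t th; apply: smooth_diff (smooth_derive v sF) _; exact: hU.
exists s, t; split=> //.
rewrite -mulrA -E' -DG// -E /G.
by rewrite [x + _ + _]addrAC opprB addrA addrAC; ring.
Qed.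

Lemma close_eq (a b : R) :
  (forall e, 0 < e -> exists2 c, `|a - c| < e & `|b - c| < e) -> a = b.
Proof.
move=> H; apply/eqP/negPn/negP => ab.
have [|c ac bc] := H (`|a - b| / 2); first by rewrite divr_gt0// normr_gt0 subr_eq0.
have : `|a - b| < `|a - b| / 2 + `|a - b| / 2.
  by apply: le_lt_trans (ltrD ac bc); rewrite (distrC b); exact: ler_distD.
by rewrite -splitr ltxx.
Qed.

(** The second difference is symmetric in [v] and [w], so after division by h^2 it is a value of
    each mixed derivative, taken at two points of the same small box. Continuity of both mixed
    derivatives at [x] makes their values there arbitrarily close. *)
Lemma smooth_schwarz (F : V -> R^o) (U : set V) x v w : open U ->
  smooth_on U F -> U x -> 'D_v ('D_w F) x = 'D_w ('D_v F) x.
Proof.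
move=> oU sF Ux.
have cvw : {for x, continuous ('D_v ('D_w F))}.
  exact/differentiable_continuous/(smooth_diff (smooth_derive v (smooth_derive w sF))).
have cwv : {for x, continuous ('D_w ('D_v F))}.
  exact/differentiable_continuous/(smooth_diff (smooth_derive w (smooth_derive v sF))).
apply: close_eq => e e0.
move/cvgrPdist_lt : cvw => /(_ _ e0) Hvw; move/cvgrPdist_lt : cwv => /(_ _ e0) Hwv.
have nU : nbhs x U by exact: open_nbhs_nbhs.
have [h h0 hA] := nbhs_box v w (filterI nU (filterI Hvw Hwv)).
have hU s t : 0 <= s <= h -> 0 <= t <= h -> U (x + s *: v + t *: w).
  by move=> sh th; have [] := hA s t sh th.
have hU' s t : 0 <= s <= h -> 0 <= t <= h -> U (x + s *: w + t *: v).
  by move=> sh th; rewrite addrAC; exact: hU.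
have [s [t [sh th E]]] := second_difference sF h0 hU.
have [t' [s' [th' sh' E']]] := second_difference sF h0 hU'.
have key A B C D p q : A - B - C + D = h * h * p -> A - C - B + D = h * h * q -> p = q.
  move=> Ep Eq; apply: (mulfI (lt0r_neq0 (mulr_gt0 h0 h0))).
  by rewrite -Ep -Eq [A - B - C]addrAC.
have [_ [_ H1]] := hA _ _ sh th.
have [_ [H2 _]] := hA _ _ sh' th'.
rewrite [x + h *: w + _]addrAC [x + t' *: w + _]addrAC in E'.
exists ('D_w ('D_v F) (x + s *: v + t *: w)); last exact: H1.
by rewrite (key _ _ _ _ _ _ E E').
Qed.

End Lines.

(** * Derivatives of matrix-valued maps *)

Section DeriveMatrix.
Context (R : realType) (V : normedModType R).
Implicit Types (x v : V).

Lemma differentiable_bigsum (W : normedModType R) I (r : seq I) (P : pred I)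
    (f : I -> V -> W) x : (forall i, differentiable (f i) x) ->
  differentiable (fun y => \sum_(i <- r | P i) f i y) x.
Proof.
move=> df; elim: r => [|i r IH].
  by under eq_fun do rewrite big_nil; exact: differentiable_cst.
under eq_fun do rewrite big_cons.
by case: (P i) => //; exact: differentiableD.
Qed.

Lemma derive_bigsum (W : normedModType R) I (r : seq I) (P : pred I)
    (f : I -> V -> W) x v : (forall i, differentiable (f i) x) ->
  'D_v (fun y => \sum_(i <- r | P i) f i y) x = \sum_(i <- r | P i) 'D_v (f i) x.
Proof.
move=> df; elim: r => [|i r IH].
  by under eq_fun do rewrite big_nil; rewrite big_nil; exact: derive_cst.
under eq_fun do rewrite big_cons.
rewrite big_cons -IH; case: (P i) => //.
by apply: deriveD; apply: diff_derivable => //; exact: differentiable_bigsum.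
Qed.

Lemma deriveMs (f g : V -> R^o) x v : differentiable f x -> differentiable g x ->
  'D_v (fun y => f y * g y : R^o) x = f x * 'D_v g x + g x * 'D_v f x.
Proof. by move=> df dg; apply: deriveM; exact: diff_derivable. Qed.

Lemma differentiable_mulmx m n p (A : V -> 'M[R]_(m, n)) (B : V -> 'M[R]_(n, p)) x :
  differentiable A x -> differentiable B x ->
  differentiable (fun y => A y *m B y) x.
Proof.
move=> dA dB; apply: differentiable_mx => i j.
under eq_fun do rewrite mxE.
apply: differentiable_bigsum => k; apply: differentiableM; exact: differentiable_entry.
Qed.

Lemma derive_mulmx m n p (A : V -> 'M[R]_(m, n)) (B : V -> 'M[R]_(n, p)) x v :
  differentiable A x -> differentiable B x ->
  'D_v (fun y => A y *m B y) x = 'D_v A x *m B x + A x *m 'D_v B x.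
Proof.
move=> dA dB; apply/matrixP => i j.
rewrite derive_entry; last exact: differentiable_mulmx.
under eq_fun do rewrite mxE.
have dAe k := differentiable_entry i k dA.
have dBe k := differentiable_entry k j dB.
rewrite derive_bigsum; last by move=> k; apply: differentiableM.
rewrite !mxE -big_split/=; apply: eq_bigr => k _.
rewrite deriveMs// (derive_entry v i k dA) (derive_entry v k j dB) [LHS]addrC.
by congr (_ + _); exact: mulrC.
Qed.

Lemma differentiable_trmx m n (A : V -> 'M[R]_(m, n)) x :
  differentiable A x -> differentiable (fun y => (A y)^T) x.
Proof.
move=> dA; apply: differentiable_mx => i j; under eq_fun do rewrite mxE.
exact: differentiable_entry.
Qed.

Lemma derive_trmx m n (A : V -> 'M[R]_(m, n)) x v :
  differentiable A x -> 'D_v (fun y => (A y)^T) x = ('D_v A x)^T.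
Proof.
move=> dA; apply/matrixP => i j.
rewrite derive_entry; last exact: differentiable_trmx.
under eq_fun do rewrite mxE.
by rewrite [RHS]mxE [RHS]derive_entry.
Qed.

Lemma differentiable_row m n (A : V -> 'M[R]_(m, n)) x i :
  differentiable A x -> differentiable (fun y => row i (A y)) x.
Proof.
move=> dA; apply: differentiable_mx => k j; under eq_fun do rewrite mxE.
exact: differentiable_entry.
Qed.

Lemma derive_rowE m n (A : V -> 'M[R]_(m, n)) x v i :
  differentiable A x -> 'D_v (fun y => row i (A y)) x = row i ('D_v A x).
Proof.
move=> dA; apply/matrixP => k j.
rewrite derive_entry; last exact: differentiable_row.
under eq_fun do rewrite mxE.
by rewrite [RHS]mxE [RHS]derive_entry.
Qed.

Lemma differentiable_col_mx m1 m2 n (A : V -> 'M[R]_(m1, n)) (B : V -> 'M[R]_(m2, n)) x :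
  differentiable A x -> differentiable B x ->
  differentiable (fun y => col_mx (A y) (B y)) x.
Proof.
move=> dA dB; apply: differentiable_mx => i j.
by case: (split_ordP i) => k ->; [under eq_fun do rewrite col_mxEu|under eq_fun do rewrite col_mxEd];
  exact: differentiable_entry.
Qed.

Lemma derive_col_mx m1 m2 n (A : V -> 'M[R]_(m1, n)) (B : V -> 'M[R]_(m2, n)) x v :
  differentiable A x -> differentiable B x ->
  'D_v (fun y => col_mx (A y) (B y)) x = col_mx ('D_v A x) ('D_v B x).
Proof.
move=> dA dB; apply/matrixP => i j.
rewrite derive_entry; last exact: differentiable_col_mx.
case: (split_ordP i) => k ->.
  by under eq_fun do rewrite col_mxEu; rewrite col_mxEu derive_entry.
by under eq_fun do rewrite col_mxEd; rewrite col_mxEd derive_entry.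
Qed.

Lemma differentiable_bigprod I (r : seq I) (f : I -> V -> R^o) x :
  (forall i, differentiable (f i) x) ->
  differentiable (fun y => \prod_(i <- r) f i y : R^o) x.
Proof.
move=> df; elim: r => [|i r IH].
  by under eq_fun do rewrite big_nil; exact: differentiable_cst.
by under eq_fun do rewrite big_cons; exact: differentiableM.
Qed.

Lemma derive_bigprod (I : eqType) (r : seq I) (f : I -> V -> R^o) x v :
  uniq r -> (forall i, differentiable (f i) x) ->
  'D_v (fun y => \prod_(i <- r) f i y : R^o) x =
  \sum_(i <- r) 'D_v (f i) x * \prod_(j <- r | j != i) f j x.
Proof.
move=> + df; elim: r => [_|i r IH /= /andP[ir ur]].
  under eq_fun do rewrite big_nil.
  by rewrite big_nil; exact: derive_cst.
under eq_fun do rewrite big_cons.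
rewrite deriveMs//; last exact: differentiable_bigprod.
rewrite IH// big_cons addrC mulrC; congr (_ + _).
  rewrite big_cons eqxx/= [in RHS]big_seq_cond [in LHS]big_seq; congr (_ * _).
  apply: eq_bigl => j; case jr : (j \in r) => //=.
  by apply/esym/eqP => ji; rewrite -ji jr in ir.
rewrite mulr_sumr [LHS]big_seq [RHS]big_seq; apply: eq_bigr => j jr.
rewrite big_cons ifT; last by apply: contraNneq ir => ->.
by rewrite mulrCA.
Qed.

Lemma differentiable_det n (A : V -> 'M[R]_n) x :
  differentiable A x -> differentiable (fun y => \det (A y) : R^o) x.
Proof.
move=> dA; apply: differentiable_bigsum => s; apply: differentiableM.
  exact: differentiable_cst.
by apply: differentiable_bigprod => i; exact: differentiable_entry.
Qed.

(** Jacobi's formula. The Leibniz expansion is differentiated one row at a time, and each resulting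
    determinant is expanded along the differentiated row. *)
Lemma derive_det n (A : V -> 'M[R]_n) x v : differentiable A x ->
  'D_v (fun y => \det (A y) : R^o) x = \tr ('D_v A x *m \adj (A x)).
Proof.
move=> dA; have dAe i j := differentiable_entry i j dA.
rewrite derive_bigsum; last first.
  move=> s; apply: differentiableM; first exact: differentiable_cst.
  exact: differentiable_bigprod.
(* [B i] is [A x] with row [i] replaced by its derivative. *)
pose B i : 'M[R]_n := \matrix_(k, j) if k == i then 'D_v A x k j else A x k j.
transitivity (\sum_i \det (B i)).
  rewrite exchange_big/=; apply: eq_bigr => s _.
  rewrite deriveMs; [|exact: differentiable_cst|exact: differentiable_bigprod].
  rewrite derive_cst mulr0 addr0 derive_bigprod ?index_enum_uniq// mulr_sumr.
  apply: eq_bigr => i _; congr (_ * _).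
  rewrite [RHS](bigD1 i)//= mxE eqxx derive_entry//; congr (_ * _).
  by apply: eq_bigr => j /negbTE ji; rewrite mxE ji.
apply: eq_bigr => i _; rewrite (expand_det_row _ i) mxE.
apply: eq_bigr => j _; rewrite !mxE eqxx; congr (_ * _).
congr (_ * \det _); apply/matrixP => k l; rewrite !mxE ifN//.
by rewrite eq_sym neq_lift.
Qed.

Lemma derive_det_mul n (A : V -> 'M[R]_n) x v (L : 'M[R]_n) : differentiable A x ->
  'D_v A x = L *m A x ->
  'D_v (fun y => \det (A y) : R^o) x = \tr L * \det (A x).
Proof.
by move=> dA E; rewrite derive_det// E -mulmxA mul_mx_adj mul_mx_scalar linearZ mulrC.
Qed.

Lemma derive_det_unit n (A : V -> 'M[R]_n) x v : differentiable A x ->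
  A x \in unitmx ->
  'D_v (fun y => \det (A y) : R^o) x = \tr ('D_v A x *m invmx (A x)) * \det (A x).
Proof. by move=> dA uA; apply: derive_det_mul; rewrite ?mulmxKV. Qed.

(* [logder v f x] is the derivative of [ln `|f|] wherever [f x != 0]. *)
Definition logder v (f : V -> R^o) x : R := 'D_v f x / f x.

Lemma logderM v (f g : V -> R^o) x : differentiable f x -> differentiable g x ->
  f x != 0 -> g x != 0 ->
  logder v (fun y => f y * g y : R^o) x = logder v f x + logder v g x.
Proof.
by move=> df dg f0 g0; rewrite /logder deriveMs//; field; rewrite f0 g0.
Qed.

Lemma differentiableXs (f : V -> R^o) k x : differentiable f x ->
  differentiable (fun y => f y ^+ k : R^o) x.
Proof.
move=> df; elim: k => [|k IH].
  by under eq_fun do rewrite expr0; exact: differentiable_cst.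
by under eq_fun do rewrite exprS; exact: differentiableM.
Qed.

Lemma logderX v (f : V -> R^o) k x : differentiable f x -> f x != 0 ->
  logder v (fun y => f y ^+ k : R^o) x = k%:R * logder v f x.
Proof.
move=> df f0; elim: k => [|k IH].
  under eq_fun do rewrite expr0.
  by rewrite /logder derive_cst !mul0r.
under eq_fun do rewrite exprS.
rewrite logderM//; last by rewrite expf_neq0.
  by rewrite IH -natr1 mulrDl mul1r addrC.
exact: differentiableXs.
Qed.

Lemma logder_cst v (c : R) x : logder v (fun=> c) x = 0.
Proof. by rewrite /logder derive_cst mul0r. Qed.

Lemma near_eq_logder v (f g : V -> R^o) x : (\near x, f x = g x) ->
  logder v f x = logder v g x.
Proof.
by move=> fg; rewrite /logder (near_eq_derive _ fg) (nbhs_singleton fg).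
Qed.

End DeriveMatrix.

(** * Gradient, Hessian and Jacobian in matrix form *)

Section Gradient.
Context (R : realType) (m : nat) (F : 'rV[R]_m -> R^o).

Definition grad x : 'cV[R]_m := \col_j 'D_(delta_mx 0 j) F x.

Definition hess x : 'M[R]_m :=
  \matrix_(i, j) 'D_(delta_mx 0 i) ('D_(delta_mx 0 j) F) x.

Lemma derive_gradE x v : differentiable F x -> 'D_v F x = (v *m grad x) 0 0.
Proof.
by move=> dF; rewrite derive_row// mxE; apply: eq_bigr => j _; rewrite mxE.
Qed.

Lemma derive_eq0 x v : differentiable F x -> ('D_v F x = 0) <-> (v *m grad x = 0).
Proof.
move=> dF; rewrite derive_gradE//; split=> [E|->]; last by rewrite mxE.
by apply/matrixP => i j; rewrite !ord1 E mxE.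
Qed.

Context (W : set 'rV[R]_m) (oW : open W) (sF : smooth_on W F).

Lemma smooth_grad : smooth_on W grad.
Proof.
apply/(smooth_mxP oW) => i j; under eq_fun do rewrite mxE.
exact: smooth_derive.
Qed.

Lemma smooth_hess : smooth_on W hess.
Proof.
apply/(smooth_mxP oW) => i j; under eq_fun do rewrite mxE.
exact/smooth_derive/smooth_derive.
Qed.

Lemma hess_sym x : W x -> (hess x)^T = hess x.
Proof.
by move=> Wx; apply/matrixP => i j; rewrite !mxE; exact: smooth_schwarz Wx.
Qed.

Lemma derive_grad x v : W x -> 'D_v grad x = hess x *m v^T.
Proof.
move=> Wx; apply/matrixP => j k; rewrite ord1.
rewrite derive_entry; last exact: smooth_diff smooth_grad Wx.
under eq_fun do rewrite mxE.
rewrite derive_row; last exact: smooth_diff (smooth_derive _ sF) Wx.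
rewrite mxE; apply: eq_bigr => i _.
rewrite (smooth_schwarz (delta_mx 0 i) (delta_mx 0 j) oW sF Wx).
by rewrite [hess x j i]mxE [v^T i 0]mxE mulrC.
Qed.

End Gradient.

Section Jacobian.
Context (R : realType) (n m : nat) (phi : 'rV[R]_n -> 'rV[R]_m).

Lemma mul_jacobian a u : differentiable phi u -> a *m 'J phi u = 'D_a phi u.
Proof. by move=> d; rewrite deriveEjacobian. Qed.

Lemma row_jacobian i u : differentiable phi u ->
  row i ('J phi u) = 'D_(delta_mx 0 i) phi u.
Proof. by move=> d; rewrite rowE mul_jacobian. Qed.

Context (O : set 'rV[R]_n) (oO : open O) (sphi : smooth_on O phi).

Lemma smooth_jacobian : smooth_on O (jacobian phi).
Proof.
apply/(smooth_mxP oO) => i j.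
apply: (@smooth_eq _ _ _ _ (fun u => 'D_(delta_mx 0 i) phi u 0 j)) => //.
  move=> u Ou; rewrite -row_jacobian ?mxE//; exact: smooth_diff sphi Ou.
by have /(smooth_mxP oO) := smooth_derive (delta_mx 0 i) sphi; apply.
Qed.

Lemma row_derive_jacobian j a u : O u ->
  row j ('D_a (jacobian phi) u) = 'D_a ('D_(delta_mx 0 j) phi) u.
Proof.
move=> Ou; rewrite -derive_rowE; last exact: smooth_diff smooth_jacobian Ou.
apply: near_eq_derive; apply: near_open_eq oO _ Ou => w Ow.
by rewrite row_jacobian//; exact: smooth_diff sphi Ow.
Qed.

End Jacobian.

(** * Level sets *)

Section LevelSet.
Context (R : realType) (n m : nat) (O : set 'rV[R]_n) (W : set 'rV[R]_m).
Context (phi : 'rV[R]_n -> 'rV[R]_m) (F : 'rV[R]_m -> R^o).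
Hypotheses (oO : open O) (sphi : smooth_on O phi).
Hypotheses (oW : open W) (sF : smooth_on W F).
Hypotheses (OW : forall u, O u -> W (phi u)).

Notation T := (jacobian phi).
Notation th := (fun u => grad F (phi u)).
Notation H := (fun u => hess F (phi u)).

Lemma smooth_grad_comp : smooth_on O th.
Proof. exact (smooth_comp oO oW sphi OW (smooth_grad oW sF)). Qed.

Lemma smooth_hess_comp : smooth_on O H.
Proof. exact (smooth_comp oO oW sphi OW (smooth_hess oW sF)). Qed.

Lemma derive_grad_comp a u : O u -> 'D_a th u = H u *m ('D_a phi u)^T.
Proof.
move=> Ou; have Wu := OW Ou.
have dphi := smooth_diff sphi Ou; have dg := smooth_diff (smooth_grad oW sF) Wu.
by rewrite [LHS](derive_comp a dphi dg) (derive_grad oW).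
Qed.

Lemma derive_hess_comp a u : O u -> 'D_a H u = 'D_('D_a phi u) (hess F) (phi u).
Proof.
move=> Ou; have Wu := OW Ou.
by have := derive_comp a (smooth_diff sphi Ou) (smooth_diff (smooth_hess oW sF) Wu).
Qed.

Lemma derive_mul_grad k (A : 'rV[R]_n -> 'M[R]_(k, m)) a u : O u ->
  differentiable A u ->
  'D_a (fun u => A u *m th u) u = 'D_a A u *m th u + A u *m H u *m ('D_a phi u)^T.
Proof.
move=> Ou dA; rewrite derive_mulmx//; last exact: smooth_diff smooth_grad_comp Ou.
by rewrite derive_grad_comp// mulmxA.
Qed.

(** Differentiating A dF = constant exchanges dF of a derivative for a value of d^2F. Applied to
    tangent vectors, this is how second fundamental forms are read off the Hessian. *)
Lemma derive_mul_grad_cst k (A : 'rV[R]_n -> 'M[R]_(k, m)) (B : 'cV[R]_k) a u : O u ->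
  differentiable A u -> (\near u, A u *m th u = B) ->
  'D_a A u *m th u = - (A u *m H u *m ('D_a phi u)^T).
Proof.
move=> Ou dA AB; apply/eqP; rewrite -subr_eq0 opprK -derive_mul_grad//.
by rewrite (near_eq_derive _ AB) derive_cst.
Qed.

Hypothesis Fphi : forall u, O u -> F (phi u) = 0.

Lemma jacobian_grad u : O u -> T u *m th u = 0.
Proof.
move=> Ou; have dphi := smooth_diff sphi Ou; have dF := smooth_diff sF (OW Ou).
apply/row_matrixP => i; rewrite row_mul row_jacobian// row0.
apply/derive_eq0 => //; rewrite -(derive_comp _ dphi dF).
have E : \near u, (F \o phi) u = 0 by apply: near_open_eq oO _ Ou.
by rewrite (near_eq_derive _ E) derive_cst.
Qed.

Lemma derive_jacobian_grad a u : O u ->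
  'D_a T u *m th u = - (T u *m H u *m ('D_a phi u)^T).
Proof.
move=> Ou; apply: derive_mul_grad_cst => //.
  exact: smooth_diff (smooth_jacobian oO sphi) Ou.
by apply: near_open_eq oO _ Ou => w Ow; exact: jacobian_grad.
Qed.

End LevelSet.

(** * Logarithmic derivative of the normalized volume *)

Section KeyIdentity.
Context (R : realType) (n : nat) (O : set 'rV[R]_n) (W : set 'rV[R]_(n + 2)).
Context (phi xi : 'rV[R]_n -> 'rV[R]_(n + 2)) (F : 'rV[R]_(n + 2) -> R^o).
Hypotheses (oO : open O) (sphi : smooth_on O phi) (sxi : smooth_on O xi).
Hypotheses (oW : open W) (sF : smooth_on W F).
Hypotheses (OW : forall u, O u -> W (phi u)) (Fphi : forall u, O u -> F (phi u) = 0).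

Notation T := (jacobian phi).
Notation th := (fun u => grad F (phi u)).
Notation H := (fun u => hess F (phi u)).
Notation h := (fun u => T u *m H u *m (T u)^T).

Context (u0 a : 'rV[R]_n) (Ou0 : O u0) (nu : 'rV[R]_(n + 2)).
Notation D := (fun u => bracket (T u) nu (xi u)).
Context (S : 'rV[R]_n) (tau : R) (g : 'rV[R]_n -> R^o) (C : R).

Let Q := T u0 *m 'D_('D_a phi u0) (hess F) (phi u0) *m (T u0)^T.

(* With [g] standing for [dF] of a normal field, the volume normalizations of both
   the affine normal plane and the Blaschke normal take the form of the last
   hypothesis, once raised to a power that clears roots and absolute values. *)
Lemma logder_transversal_volume : differentiable g u0 ->
  D u0 != 0 -> g u0 != 0 ->
  xi u0 *m th u0 = 0 -> xi u0 *m H u0 *m (T u0)^T = 0 ->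
  'D_a xi u0 = S *m T u0 + tau *: xi u0 ->
  (\near u0, D u0 ^+ 4 * g u0 ^+ (2 * n.+2) =
      C * (nu *m th u0) 0 0 ^+ 4 * \det (h u0) ^+ 2) ->
  n.+2%:R * logder a g u0 = \tr (Q *m invmx (h u0)) - 2 * tau.
Proof.
move=> dg D0 g0 xith xiH Dxi vol.
have dT := smooth_diff (smooth_jacobian oO sphi) Ou0.
have dH := smooth_diff (smooth_hess_comp oO sphi oW sF OW) Ou0.
have dth := smooth_diff (smooth_grad_comp oO sphi oW sF OW) Ou0.
have dxi := smooth_diff sxi Ou0.
have dphi := smooth_diff sphi Ou0.
have dnu : differentiable (fun _ : 'rV[R]_n => nu) u0 by exact: differentiable_cst.
have dh : differentiable h u0.
  by apply: differentiable_mulmx; [exact: differentiable_mulmx|exact: differentiable_trmx].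
have dnx : differentiable (fun u => col_mx nu (xi u)) u0 by exact: differentiable_col_mx.
have dA : differentiable (fun u => col_mx (T u) (col_mx nu (xi u))) u0.
  exact: differentiable_col_mx.
have dD : differentiable (D : _ -> R^o) u0 by exact: differentiable_det.
have dnth : differentiable (fun u => (nu *m th u) 0 0 : R^o) u0.
  by apply: differentiable_entry; exact: differentiable_mulmx.
have ddh : differentiable (fun u => \det (h u) : R^o) u0 by exact: differentiable_det.
have vol0 := nbhs_singleton vol.
have : D u0 ^+ 4 * g u0 ^+ (2 * n.+2) != 0 by rewrite mulf_neq0// expf_neq0.
rewrite vol0 => nz.
have C0 : C != 0 by apply: contraNneq nz => ->; rewrite !mul0r.
have n0 : (nu *m th u0) 0 0 != 0.
  by apply: contraNneq nz => ->; rewrite expr0n/= mulr0 mul0r.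
have h0 : \det (h u0) != 0 by apply: contraNneq nz => ->; rewrite expr0n/= mulr0.
have uA : col_mx (T u0) (col_mx nu (xi u0)) \in unitmx by rewrite unitmxE unitfE.
have uh : h u0 \in unitmx by rewrite unitmxE unitfE.
set A0 := col_mx _ _ in uA.
(* The coordinates of the derivative of the frame in the basis (T, nu, xi): [L] along T, [b] along
   nu and [c] along xi. *)
pose M := 'D_a T u0 *m invmx A0.
pose L := lsubmx M; pose b := lsubmx (rsubmx M : 'M[R]_(n, 1 + 1)).
pose c := rsubmx (rsubmx M : 'M[R]_(n, 1 + 1)).
have DT : 'D_a T u0 = L *m T u0 + (b *m nu + c *m xi u0).
  by rewrite -2!mul_row_col !hsubmxK mulmxKV.
(* The derivative of the whole basis in terms of itself: the row of nu is zero because nu is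
   constant, and the row of xi holds [S] and [tau]. Its trace tr L + tau is the logarithmic
   derivative of the volume. *)
pose Lm : 'M[R]_(n + (1 + 1)) := block_mx L (row_mx b c) (col_mx 0 S)
  (block_mx 0 0 0 tau%:M).
have DA : 'D_a (fun u => col_mx (T u) (col_mx nu (xi u))) u0 = Lm *m A0.
  rewrite derive_col_mx// derive_col_mx// derive_cst Dxi DT.
  rewrite mul_block_col mul_row_col mul_col_mx mul_block_col add_col_mx.
  by rewrite !mul0mx !add0r mul_scalar_mx.
have ldD : logder a (D : _ -> R^o) u0 = \tr L + tau.
  rewrite /logder [X in X / _](derive_det_mul dA DA) mulfK//.
  by rewrite /Lm !mxtrace_block mxtrace0 add0r mxtrace_scalar.
pose ka := (nu *m H u0 *m ('D_a phi u0)^T) 0 0.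
have ldn : logder a (fun u => (nu *m th u) 0 0 : R^o) u0 = ka / (nu *m th u0) 0 0.
  rewrite /logder -[X in X / _](@derive_entry _ _ _ _ (fun u => nu *m th u)); last first.
    exact: differentiable_mulmx.
  rewrite (derive_mul_grad oO sphi oW sF OW)// derive_cst mul0mx add0r.
  by [].
(* dF annihilates T and xi, so in dF(D_a T) only the nu-component remains; the same quantity is
   minus the Hessian on tangent vectors. *)
have bE : (nu *m th u0) 0 0 *: b = - (h u0 *m a^T).
  have := derive_jacobian_grad oO sphi oW sF OW Fphi a Ou0.
  rewrite DT !mulmxDl -!mulmxA xith mulmx0 addr0 (jacobian_grad oO sphi sF OW Fphi)//.
  rewrite mulmx0 add0r -(mul_jacobian _ dphi) trmx_mul !mulmxA => <-.
  by rewrite -mulmxA [nu *m _]mx11_scalar mul_mx_scalar mxE.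
have symH : (H u0)^T = H u0 by exact (hess_sym oW sF (OW Ou0)).
have symh : (h u0)^T = h u0 by rewrite !trmx_mul trmxK symH mulmxA.
(* The xi-component disappears because xi is Hessian-orthogonal to T. In the nu-component, [bE] and
   cyclicity of the trace cancel h against its inverse and leave the scalar [ka]. *)
have tr1 : \tr ('D_a T u0 *m H u0 *m (T u0)^T *m invmx (h u0)) =
    \tr L - ka / (nu *m th u0) 0 0.
  have -> : 'D_a T u0 *m H u0 *m (T u0)^T =
      L *m h u0 + b *m (nu *m H u0 *m (T u0)^T).
    rewrite DT !mulmxDl -!mulmxA [xi u0 *m (_ *m _)]mulmxA xiH mulmx0 addr0.
    by rewrite !mulmxA.
  rewrite mulmxDl mxtraceD mulmxK//; congr (_ + _).
  apply: (mulfI n0); rewrite mulrN [in RHS]mulrC divfK// -mxtraceZ !scalemxAl bE.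
  rewrite mulNmx mulNmx linearN/=; congr (- _).
  move: (T u0 *m H u0 *m (T u0)^T) uh => hh uh.
  rewrite mxtrace_mulC -!mulmxA mulKmx// mxtrace_mulC -!mulmxA -trmx_mul.
  by rewrite mul_jacobian// trace_mx11 /ka !mulmxA.
have ldh : logder a (fun u => \det (h u) : R^o) u0 =
   2 * (\tr L - ka / (nu *m th u0) 0 0) + \tr (Q *m invmx (h u0)).
  rewrite /logder derive_det_unit// mulfK// derive_mulmx//; last first.
  - exact: differentiable_trmx.
  - exact: differentiable_mulmx.
  rewrite derive_mulmx// derive_trmx// (derive_hess_comp sphi oW sF OW)//.
  rewrite !mulmxDl !mxtraceD tr1 -/Q.
  have -> : \tr (T u0 *m H u0 *m ('D_a T u0)^T *m invmx (h u0)) =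
     \tr L - ka / (nu *m th u0) 0 0.
    rewrite -tr1 -mxtrace_tr !trmx_mul trmxK trmx_inv symh symH mxtrace_mulC.
    by rewrite !mulmxA.
  by ring.
have dC : differentiable (fun _ : 'rV[R]_n => C : R^o) u0 by exact: differentiable_cst.
have := near_eq_logder a vol.
rewrite logderM ?expf_neq0//; try exact: differentiableXs.
rewrite logderX// logderX// ldD.
rewrite logderM ?mulf_neq0 ?expf_neq0//; try exact: differentiableXs; last first.
  by apply: differentiableM => //; exact: differentiableXs.
rewrite (logderX _ _ ddh h0) ldh.
rewrite logderM ?expf_neq0//; try exact: differentiableXs.
rewrite (logderX _ _ dnth n0) ldn logder_cst add0r natrM => E.
(* [E] amounts to 4 (tr L + tau) + 2 (n + 2) logder g = 4 ka / dF(nu) + 2 (2 (tr L - ka / dF(nu)) +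
   tr(Q h^-1)), where both the terms in tr L and those in [ka] cancel. *)
apply: (mulfI (x := 2)); first by rewrite pnatr_eq0.
rewrite mulrA -[LHS](addKr (4%:R * (\tr L + tau))) E.
by ring.
Qed.

End KeyIdentity.

(** * Tangent spaces of a hypersurface *)

Lemma diff_approx (R : realType) (V : normedModType R) (F : V -> R^o) q (e : R) :
  differentiable F q -> 0 < e ->
  \forall y \near (0 : V), `|F (y + q) - F q - 'D_y F q| <= e * `|y|.
Proof.
move=> dF e0; have /diff_locallyP[_] := dF => /eqaddoP/(_ e e0).
apply: filterS => y; rewrite -[(_ - _) y]/(F (y + q) - (F q + 'd F q y)).
by rewrite deriveE// opprD addrA.
Qed.

Section TangentSpace.
Context (R : realType) (d : nat).
Implicit Types (M W : set 'rV[R]_d) (F : 'rV[R]_d -> R^o) (q v : 'rV[R]_d).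

Lemma zero_between (f : R -> R^o) (s : R) : 0 <= s ->
  (forall t, `|t| <= s -> differentiable f t) ->
  Num.min (f (- s)) (f s) <= 0 <= Num.max (f (- s)) (f s) ->
  exists2 t, `|t| <= s & f t = 0.
Proof.
move=> s0 cf fs.
have [|||t] := @IVT R f (- s) s 0; first lra.
- apply: continuous_in_subspaceT => t; rewrite inE/= in_itv/= -ler_norml => ts.
  exact/differentiable_continuous/cf.
- exact: fs.
- by rewrite in_itv/= -ler_norml; exists t.
Qed.

(** The two bounds say that f(s) has weakly the sign of c and f(-s) weakly the opposite one. *)
Lemma sign_change_zero (f : R -> R^o) (s c : R) : 0 <= s ->
  (forall t, `|t| <= s -> differentiable f t) ->
  `|f s - c| <= `|c| -> `|f (- s) + c| <= `|c| ->
  exists2 t, `|t| <= s & f t = 0.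
Proof.
move=> s0 cf fs fNs; apply: zero_between => //.
move: fs fNs; rewrite !ler_norml ge_min le_max => /andP[a1 a2] /andP[b1 b2].
have [c0|c0] := leP 0 c.
  by move: a1 b2; rewrite !ger0_norm// => a1 b2; apply/andP; split; apply/orP; [left|right]; lra.
by move: a2 b1; rewrite !ltr0_norm// => a2 b1; apply/andP; split; apply/orP; [right|left]; lra.
Qed.

(** If D_v F' = A were nonzero, consider the points q + t v + s w with |s| at most e t, where D_w F
    is nonzero. As D_v F = 0, F changes sign in s on this short segment and vanishes somewhere on
    it; that point lies on M, so F' vanishes there too. But F' is t A up to errors smaller than t
    |A|, a contradiction. Only first-order expansions and the intermediate value theorem enter. *)
Lemma defining_tangent M W F W' F' q v :
  defining_function M W F -> defining_function M W' F' -> W q -> W' q -> M q ->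
  'D_v F q = 0 -> 'D_v F' q = 0.
Proof.
move=> [oW sF MW nF] [oW' sF' MW' _] Wq W'q Mq DF.
have [w Dw] := nF q Wq Mq.
have dF := smooth_diff sF Wq; have dF' := smooth_diff sF' W'q.
have Fq : F q = 0.
  have : (M `&` W) q by [].
  by rewrite MW => -[].
have F'q : F' q = 0.
  have : (M `&` W') q by [].
  by rewrite MW' => -[].
set A := 'D_v F' q; apply/eqP/negPn/negP => A0.
set k := 'D_w F q in Dw; pose B := 'D_w F' q.
have [N N0 NE] : exists2 N, 0 < N & N = `|v| + `|w| + 1.
  by exists (`|v| + `|w| + 1) => //; rewrite ltr_wpDl// addr_ge0.
have nA : 0 < `|A| by rewrite normr_gt0.
have nk : 0 < `|k| by rewrite normr_gt0.
(* The aperture e keeps the drift s D_w F' below t |A| / 2, and e <= 1 keeps the displacement below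
   t N. The expansion of F' is later made precise to t |A| / 4, so that 3/4 of t |A| would have to
   bound t |A|. *)
have [e [e0 e1 eB]] : exists e, [/\ 0 < e, e <= 1 & e * `|B| <= `|A| / 2].
  have B0 : 0 < `|B| + 1 by rewrite ltr_wpDl.
  exists (Num.min 1 (`|A| / (2 * (`|B| + 1)))).
  rewrite lt_min ltr01 divr_gt0 ?mulr_gt0// ge_min lexx; split=> //.
  apply: (@le_trans _ _ (`|A| / (2 * (`|B| + 1)) * (`|B| + 1))).
    apply: (@le_trans _ _ (`|A| / (2 * (`|B| + 1)) * `|B|)).
      by rewrite ler_wpM2r// ge_min lexx orbT.
    by rewrite ler_wpM2l ?lerDl// divr_ge0// mulr_ge0// ltW.
  by rewrite invfM mulrA divfK ?gt_eqF.
have a1 : 0 < e * `|k| / N by rewrite divr_gt0// mulr_gt0.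
have a2 : 0 < `|A| / 4 / N by rewrite !divr_gt0.
have /nbhs_ballP[r /= r0 rP] : nbhs (0 : 'rV[R]_d)
    ((fun y => `|F (y + q) - F q - 'D_y F q| <= e * `|k| / N * `|y|) `&`
     (fun y => `|F' (y + q) - F' q - 'D_y F' q| <= `|A| / 4 / N * `|y|)).
  by apply: filterI; [exact (diff_approx dF a1)|exact (diff_approx dF' a2)].
have /nbhs_ballP[r' /= r'0 r'P] : nbhs q (W `&` W').
  by apply: filterI; exact: open_nbhs_nbhs.
have [t t0 tN] : exists2 t, 0 < t & t * N < Num.min r r'.
  have m0 : 0 < Num.min r r' by rewrite lt_min r0.
  exists (Num.min r r' / N / 2); first by rewrite !divr_gt0.
  by rewrite mulrAC divfK ?gt_eqF//; lra.
have rN s : `|s| <= e * t -> `|t *: v + s *: w| <= t * N.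
  move=> st; apply: le_trans (ler_normD _ _) _; rewrite !normrZ (gtr0_norm t0).
  have st' : `|s| <= t by apply: le_trans st _; rewrite ler_piMl// ltW.
  rewrite NE !mulrDr mulr1; have := ler_wpM2r (normr_ge0 w) st'; lra.
have PF s : `|s| <= e * t ->
    `|F (t *: v + s *: w + q) - s * k| <= e * `|k| * t /\
    `|F' (t *: v + s *: w + q) - (t * A + s * B)| <= `|A| / 4 * t.
  move=> st; have := rN s st => ns.
  have [] := rP (t *: v + s *: w).
    rewrite -ball_normE/= add0r normrN; apply: le_lt_trans ns _.
    by apply: lt_le_trans tN _; rewrite ge_min lexx.
  rewrite Fq F'q !subr0 !deriveDl// !deriveZl// DF -/k -/A -/B scaler0 add0r.
  move=> H1 H2; split.
    apply: le_trans H1 _; apply: (@le_trans _ _ (e * `|k| / N * (t * N))).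
      by rewrite ler_wpM2l// ltW.
    by rewrite [t * N]mulrC mulrA divfK// gt_eqF.
  apply: le_trans H2 _; apply: (@le_trans _ _ (`|A| / 4 / N * (t * N))).
    by rewrite ler_wpM2l// ltW.
  by rewrite [t * N]mulrC mulrA divfK// gt_eqF.
have PW s : `|s| <= e * t -> W (t *: v + s *: w + q) /\ W' (t *: v + s *: w + q).
  move=> st; apply: r'P; rewrite -ball_normE/= opprD addrCA subrr addr0 normrN.
  apply: le_lt_trans (rN s st) _.
  by apply: lt_le_trans tN _; rewrite ge_min lexx orbT.
have et0 : 0 <= e * t by rewrite mulr_ge0// ltW.
(* The linear part of F at height e t is e t k, and the expansion error of F is at most its absolute
   value. *)
have [|s|||s st Fs] := @sign_change_zero (fun s => F (t *: v + s *: w + q)) (e * t) (e * t * k) => //.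
- move=> st; have [Ws _] := PW s st.
  have -> : (fun s : R^o => F (t *: v + s *: w + q)) = (fun s : R^o => F (t *: v + q + s *: w)).
    by apply/funext => s'; rewrite addrAC.
  apply/derivable1_diffP; apply: ex_derive; apply: is_derive_line.
  by apply: smooth_diff sF _; rewrite addrAC.
- have [] := PF (e * t); first by rewrite ger0_norm.
  by move=> H _; apply: le_trans H _; rewrite (normrM _ k) (ger0_norm et0) mulrAC.
- have [] := PF (- (e * t)); first by rewrite normrN ger0_norm.
  move=> H _; apply: le_trans _ (le_trans H _); first by rewrite mulNr opprK.
  by rewrite (normrM _ k) (ger0_norm et0) mulrAC.
have [Ws W's] := PW s st.
have F's : F' (t *: v + s *: w + q) = 0.
  have : (M `&` W) (t *: v + s *: w + q) by rewrite MW.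
  move=> [Ms _]; have : (M `&` W') (t *: v + s *: w + q) by [].
  by rewrite MW' => -[].
have [_] := PF s st; rewrite F's sub0r normrN => H.
have sB : `|s * B| <= t * (`|A| / 2).
  rewrite normrM; apply: (@le_trans _ _ (e * t * `|B|)); first by rewrite ler_wpM2r.
  by rewrite mulrAC mulrC ler_wpM2l// ltW.
have : `|t * A| <= `|t * A + s * B| + `|s * B|.
  by rewrite -[X in `|X| <= _](addrK (s * B)) -(normrN (s * B)) ler_normD.
rewrite normrM (gtr0_norm t0) => tA.
have : 0 < t * `|A| by rewrite mulr_gt0.
lra.
Qed.

Lemma TM_grad M W F q v : defining_function M W F -> W q -> M q ->
  TM M q v <-> v *m grad F q = 0.
Proof.
move=> dMF Wq Mq; have [_ sF _ _] := dMF; have dF := smooth_diff sF Wq.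
split=> [[W' [F' [W'q dMF' E]]]|E].
  by apply/derive_eq0 => //; exact: defining_tangent dMF' dMF W'q Wq Mq E.
by exists W, F; split=> //; apply/derive_eq0.
Qed.

Lemma grad_neq0 M W F q : defining_function M W F -> W q -> M q -> grad F q != 0.
Proof.
move=> [_ sF _ nF] Wq Mq; have [v Dv] := nF q Wq Mq.
by apply: contraNneq Dv => g0; apply/eqP/derive_eq0; rewrite ?g0 ?mulmx0//; exact: smooth_diff sF Wq.
Qed.

End TangentSpace.

(** * Charts and local coordinates *)

Section Charts.
Context (R : realType) (n : nat) (N : manifold R n).
Implicit Types (p q : N) (U : set N).

Lemma chart_image_open p U : open U -> open (chart p @` (dom p `&` U)).
Proof.
move=> oU.
have -> : chart p @` (dom p `&` U) = chart p @` dom p `&` param p @^-1` U.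
  apply/seteqP; split=> [x [q [dq Uq] <-]|x [[q dq <-]]].
    by split; [exists q|rewrite /preimage/= chartK].
  by rewrite /preimage/= chartK// => Uq; exists q.
rewrite openE => x [[q dq <-] Ux]; apply: filterI.
  by apply: open_nbhs_nbhs; split; [exact: chart_open|exists q].
apply: (param_continuous dq); rewrite /preimage/= in Ux.
exact: open_nbhs_nbhs.
Qed.

Lemma mem_chart_image p q U : dom p q -> U q -> (chart p @` (dom p `&` U)) (chart p q).
Proof. by move=> dq Uq; exists q. Qed.

Lemma msmooth_continuous (W : normedModType R) (Z : N -> W) q :
  msmooth_on setT Z -> {for q, continuous Z}.
Proof.
move=> sZ; have dq := mem_dom q.
have cZ : {for chart q q, continuous (Z \o param q)}.
  by apply/differentiable_continuous/(smooth_diff (sZ q)); exact: mem_chart_image.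
have c : {for q, continuous ((Z \o param q) \o chart q)}.
  by apply: continuous_comp; [exact: chart_continuous|exact: cZ].
have E : \forall x \near q, ((Z \o param q) \o chart q) x = Z x.
  have : nbhs q (dom q) by apply: open_nbhs_nbhs; split; [exact: dom_open|].
  by apply: filterS => x dx /=; rewrite chartK.
rewrite /prop_for /continuous_at -(nbhs_singleton E).
exact: cvg_trans (near_eq_cvg E) c.
Qed.

Lemma smooth_transition p q :
  smooth_on (chart q @` (dom q `&` dom p)) (chart p \o param q).
Proof. exact (@transition_smooth R n N q p). Qed.

Lemma near_transition (W : Type) (Z : N -> W) p q : dom p q ->
  \forall u \near chart q q, (Z \o param q) u = ((Z \o param p) \o (chart p \o param q)) u.
Proof.
move=> dq; have oqp := @chart_image_open q _ (@dom_open _ _ N p).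
have : nbhs (chart q q) (chart q @` (dom q `&` dom p)).
  by apply: open_nbhs_nbhs; split=> //; exact: mem_chart_image (mem_dom q) dq.
by apply: filterS => u [x [dx px] <-] /=; rewrite chartK// chartK.
Qed.

Lemma derive_transition (W : normedModType R) (Z : N -> W) p q b : dom p q ->
  differentiable (Z \o param p) (chart p q) ->
  'D_b (Z \o param q) (chart q q) =
  'D_('D_b (chart p \o param q) (chart q q)) (Z \o param p) (chart p q).
Proof.
move=> dq dZ; rewrite (near_eq_derive _ (near_transition Z dq)).
have E : (chart p \o param q) (chart q q) = chart p q by rewrite /= chartK//; exact: mem_dom.
have ds : differentiable (chart p \o param q) (chart q q).
  by apply: smooth_diff (@smooth_transition p q) _; exact: mem_chart_image (mem_dom q) dq.
by rewrite derive_comp// E.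
Qed.

Lemma msmooth_chart a b p U (Z : 'rV[R]_n -> 'M[R]_(a, b)) : open U ->
  U `<=` dom p -> smooth_on (chart p @` U) Z -> msmooth_on U (Z \o chart p).
Proof.
move=> oU Up sZ q.
have oqU := @chart_image_open q _ oU.
have opU : open (chart p @` U).
  by have := @chart_image_open p _ oU; rewrite setIidr.
have st : smooth_on (chart q @` (dom q `&` U)) (chart p \o param q).
  apply: smooth_subset (@smooth_transition p q) => _ [x [dx Ux] <-].
  by exists x => //; split=> //; exact: Up.
have tU x : (chart q @` (dom q `&` U)) x -> (chart p @` U) ((chart p \o param q) x).
  by move=> [y [dy Uy] <-]; exists y => //=; rewrite chartK.
exact (smooth_comp oqU opU st tU sZ).
Qed.

Context (m : nat) (f : N -> 'rV[R]_m) (f_imm : immersion f).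

Lemma differentiable_param p q : dom p q -> differentiable (f \o param p) (chart p q).
Proof.
by move=> dq; case: f_imm => sf _; apply: smooth_diff (sf p) _; exact: mem_chart_image.
Qed.

Lemma TN_transition p q : dom p q ->
  TN f q = 'J (chart p \o param q) (chart q q) *m 'J (f \o param p) (chart p q).
Proof.
move=> dq; apply/row_matrixP => i; rewrite row_mul /TN.
have ds : differentiable (chart p \o param q) (chart q q).
  by apply: smooth_diff (@smooth_transition p q) _; exact: mem_chart_image (mem_dom q) dq.
rewrite !row_jacobian//; last by apply: differentiable_param; exact: mem_dom.
rewrite mul_jacobian; last exact: differentiable_param.
exact (derive_transition (delta_mx 0 i) dq (differentiable_param dq)).
Qed.

Lemma row_free_chart p q : dom p q -> row_free ('J (f \o param p) (chart p q)).
Proof.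
move=> dq; have [_ /(_ q)] := f_imm; rewrite /row_free (TN_transition dq) => /eqP E.
by rewrite eqn_leq rank_leq_row -{1}E mxrankM_maxr.
Qed.

Lemma TN_chart p q : dom p q -> (TN f q :=: 'J (f \o param p) (chart p q))%MS.
Proof.
move=> dq.
have sub : (TN f q <= 'J (f \o param p) (chart p q))%MS.
  by rewrite (TN_transition dq) submxMl.
apply/eqmxP; rewrite -(geq_leqif (mxrank_leqif_eq sub)).
have [_ /(_ q) /eqP E] := f_imm.
exact: leq_trans (rank_leq_row _) (eq_leq (esym E)).
Qed.

(** [flatD] at [q] is defined in the chart at [q]. Expressing it in one fixed chart [p] lets
    derivatives at neighbouring points be compared; injectivity of the Jacobian identifies the two
    coordinate vectors of the same tangent vector. *)
Lemma flatD_chart (W : normedModType R) (Z : N -> W) p q a : dom p q ->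
  differentiable (Z \o param p) (chart p q) ->
  flatD f Z q (a *m 'J (f \o param p) (chart p q)) = 'D_a (Z \o param p) (chart p q).
Proof.
move=> dq dZ; rewrite /flatD; set X := a *m _; set b := X *m _.
have bX : b *m TN f q = X by rewrite mulmxKpV// (TN_chart dq) submxMl.
rewrite [LHS](derive_transition b dq dZ); congr (derive _ _ _).
apply: (row_free_inj (row_free_chart dq)).
rewrite -/X -{}bX (TN_transition dq) mulmxA; congr (_ *m _).
rewrite mul_jacobian//.
by apply: smooth_diff (@smooth_transition p q) _; exact: mem_chart_image (mem_dom q) dq.
Qed.

End Charts.

(** * Linear algebra: determinants, kernels, congruence of symmetric forms *)

Section MatrixAlgebra.
Context (R : realType).

(* The cofactors along row [i] only see the other rows, all of which
   annihilate [th], so both determinants are proportional to [th]. *)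
Lemma det_replace_row m (A A' : 'M[R]_m) (th : 'cV[R]_m) i : th != 0 ->
  (forall j, j != i -> row j A = row j A') ->
  (forall j, j != i -> row j A *m th = 0) ->
  \det A' * (row i A *m th) 0 0 = \det A * (row i A' *m th) 0 0.
Proof.
move=> th0 AA' Ath.
have E (B : 'M[R]_m) : (forall j, j != i -> row j A = row j B) ->
    forall k, \det B * th k 0 = cofactor A i k * (row i B *m th) 0 0.
  move=> AB k.
  have -> : cofactor A i k = cofactor B i k.
    rewrite /cofactor; congr (_ * \det _); apply/matrixP => a b; rewrite !mxE.
    have ia : lift i a != i by rewrite eq_sym neq_lift.
    by have := congr1 (fun v : 'rV_m => v 0 (lift k b)) (AB _ ia); rewrite !mxE.
  have : \adj B *m (B *m th) = \det B *: th by rewrite mulmxA mul_adj_mx mul_scalar_mx.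
  move/matrixP/(_ k 0); rewrite [RHS]mxE => <-.
  rewrite mxE (bigD1 i)//= big1 ?addr0 => [|j ji].
    by rewrite [\adj B k i]mxE -row_mul [row i _ _ _]mxE.
  have : row j (B *m th) 0 0 = 0 by rewrite row_mul -AB// Ath// mxE.
  by rewrite mxE => ->; rewrite mulr0.
have [k thk] : exists k, th k 0 != 0.
  apply/existsP; apply: contraNT th0; rewrite negb_exists => /forallP th0.
  by apply/eqP/matrixP => a b; rewrite ord1 mxE; apply/eqP; have := th0 a; rewrite negbK.
apply: (mulIf thk).
rewrite mulrAC (E A' AA') [RHS]mulrAC (E A (fun _ _ => erefl)).
by rewrite mulrAC.
Qed.

(** As functions of the last row, both the determinant and [th] are linear forms vanishing on the
    rows of [J], hence proportional. This allows one transversal vector to be exchanged for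
    another. *)
Lemma det_col_grad n (J : 'M[R]_(n, n + 1)) v w (th : 'cV[R]_(n + 1)) :
  J *m th = 0 ->
  \det (col_mx J v) * (w *m th) 0 0 = \det (col_mx J w) * (v *m th) 0 0.
Proof.
move=> Jth; have [->|th0] := eqVneq th 0; first by rewrite !mulmx0 mxE !mulr0.
pose i0 : 'I_(n + 1) := rshift n 0.
pose A y : 'M[R]_(n + 1) := col_mx J y.
have Ai y : row i0 (A y) = y by rewrite rowKd row_id.
have ji (j : 'I_(n + 1)) : j != i0 -> exists k, j = lshift 1 k.
  case: (split_ordP j) => {j}[j ->|j ->] ji; first by exists j.
  by rewrite (ord1 j) /i0 eqxx in ji.
have AA j : j != i0 -> row j (A w) = row j (A v) by move=> /ji[k ->]; rewrite !rowKu.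
have Ath j : j != i0 -> row j (A w) *m th = 0.
  by move=> /ji[k ->]; rewrite rowKu -row_mul Jth row0.
by have := det_replace_row th0 AA Ath; rewrite !Ai.
Qed.

Lemma col_mx_unit n (J : 'M[R]_(n, n + 1)) v (th : 'cV[R]_(n + 1)) :
  row_free J -> J *m th = 0 -> v *m th != 0 -> col_mx J v \in unitmx.
Proof.
move=> fJ Jth vth; rewrite -row_free_unit; apply: inj_row_free => z.
rewrite -[z]hsubmxK mul_row_col => e.
have s0 : rsubmx z = 0.
  have := congr1 (fun v => v *m th) e.
  rewrite mulmxDl -!mulmxA Jth mulmx0 mul0mx add0r.
  rewrite [rsubmx z]mx11_scalar mul_scalar_mx => /eqP.
  by rewrite scaler_eq0 (negbTE vth) orbF => /eqP->; rewrite raddf0.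
rewrite s0 mul0mx addr0 in e; rewrite s0.
have -> : lsubmx z = 0 by apply: (row_free_inj fJ); rewrite e mul0mx.
by rewrite row_mx0.
Qed.

Lemma row_free_col_mx n m (A : 'M[R]_(n, m)) (v : 'rV[R]_m) :
  row_free A -> ~~ (v <= A)%MS -> row_free (col_mx A v).
Proof.
move=> fA vA; apply: inj_row_free => w.
rewrite -[w]hsubmxK mul_row_col; set x := lsubmx w; set s := rsubmx w.
rewrite [s]mx11_scalar mul_scalar_mx => E.
have s0 : s 0 0 = 0.
  apply/eqP; apply: contraNT vA => s0; apply/submxP; exists (- (s 0 0)^-1 *: x).
  rewrite -scalemxAl (canRL (addrK _) E) sub0r scalerN scaleNr opprK.
  by rewrite scalerA mulVf// scale1r.
rewrite s0 scale0r addr0 in E; rewrite s0.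
have -> : x = 0 by apply: (row_free_inj fA); rewrite E mul0mx.
by rewrite raddf0 row_mx0.
Qed.

Lemma kernel_span n m (A : 'M[R]_(n, m)) (th : 'cV[R]_m) (w : 'rV[R]_m) :
  m = n.+1 -> row_free A -> A *m th = 0 -> th != 0 -> w *m th = 0 -> (w <= A)%MS.
Proof.
move=> mn fA Ath th0 /sub_kermxP wth; apply: submx_trans wth _.
have /sub_kermxP AK := Ath.
rewrite -(geq_leqif (mxrank_leqif_sup AK)) mxrank_ker (eqP fA).
have : (0 < \rank th)%N by rewrite lt0n mxrank_eq0.
by lia.
Qed.

Lemma same_row_space n m (A B : 'M[R]_(n, m)) : row_free A -> (A <= B)%MS ->
  exists2 P : 'M[R]_n, P \in unitmx & A = P *m B.
Proof.
move=> fA /submxP[P E]; exists P => //.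
rewrite -row_free_unit /row_free eqn_leq rank_leq_row/=.
by rewrite -{1}(eqP fA) E mxrankM_maxl.
Qed.

(** The large matrix is the block-diagonal matrix of [col_mx J v] and 1 times [col_mx B x]. The row
    counts n + 1 + 1 and n + (1 + 1) are not convertible, so both are identified with a variable [m]
    that can be eliminated. *)
Lemma det_lift n m (e : (n + 1 + 1)%N = m) (e' : (n + (1 + 1))%N = m)
    (B : 'M[R]_(n + 1, m)) (x : 'rV[R]_m) (J : 'M[R]_(n, n + 1)) v :
  \det (castmx (e', erefl) (col_mx (J *m B) (col_mx (v *m B) x))) =
  \det (col_mx J v) * \det (castmx (e, erefl) (col_mx B x)).
Proof.
rewrite col_mxA castmx_comp; case: m / e e' B x => e' B x.
rewrite !castmx_id -mul_col_mx.
have -> : col_mx (col_mx J v *m B) x = block_mx (col_mx J v) 0 0 1%:M *m col_mx B x.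
  by rewrite mul_block_col !mul0mx addr0 add0r mul1mx.
by rewrite det_mulmx det_ublock det1 mulr1.
Qed.

Lemma rank_basis n m (A : 'M[R]_(n, m)) r : \rank A = r ->
  exists2 K : 'M[R]_(r, m), row_free K & (K :=: A)%MS.
Proof.
by case: r /; exists (row_base A); [exact: row_base_free|exact: eq_row_base].
Qed.

Lemma symmetric_isotropic n (G : 'M[R]_n) : G^T = G ->
  (forall u : 'rV[R]_n, u *m G *m u^T = 0) -> G = 0.
Proof.
move=> sG iso; apply/matrixP => i j.
have e k l : (delta_mx 0 k *m G *m (delta_mx 0 l)^T : 'M[R]_1) 0 0 = G k l.
  by rewrite trmx_delta -rowE -colE !mxE.
have := iso (delta_mx 0 i + delta_mx 0 j).
rewrite linearD/= !mulmxDl !mulmxDr !iso addr0 add0r => /matrixP/(_ 0 0).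
rewrite mxE !e mxE -[in G j i]sG mxE -mulr2n => /eqP.
by rewrite mulrn_eq0/= => /eqP ->; rewrite mxE.
Qed.

(** Lagrange's diagonalization. Either every vector is isotropic and G vanishes by polarization, or
    a non-isotropic u splits the space into its line and the kernel of G u^T, on which the induction
    hypothesis applies. *)
Lemma symmetric_diag n (G : 'M[R]_n) : G^T = G ->
  exists2 P : 'M[R]_n, P \in unitmx & is_diag_mx (P *m G *m P^T).
Proof.
elim: n G => [|n IH] G sG.
  by exists 1%:M; rewrite ?unitmx1//; apply/is_diag_mxP => -[].
have [iso|] := pselect (forall u : 'rV[R]_n.+1, u *m G *m u^T = 0).
  exists 1%:M; first exact: unitmx1.
  by rewrite (symmetric_isotropic sG iso) mulmx0 mul0mx; apply/is_diag_mxP => i j _; rewrite mxE.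
move=> /existsNP[u /eqP uGu].
have rk : \rank (kermx (G *m u^T)) = n.
  rewrite mxrank_ker.
  have : (0 < \rank (G *m u^T))%N.
    by rewrite lt0n mxrank_eq0; apply: contraNneq uGu => E; rewrite -mulmxA E mulmx0.
  have : (\rank (G *m u^T) <= 1)%N by exact: rank_leq_col.
  by lia.
have [K fK KE] := rank_basis rk.
have KG : K *m (G *m u^T) = 0 by apply/sub_kermxP; rewrite KE.
have sK : (K *m G *m K^T)^T = K *m G *m K^T by rewrite !trmx_mul trmxK sG mulmxA.
have [P uP dP] := IH _ sK.
pose P0 : 'M[R]_(1 + n) := col_mx u K.
have uP0 : P0 \in unitmx.
  rewrite -row_free_unit; apply: inj_row_free => w.
  rewrite -[w]hsubmxK mul_row_col; set s := lsubmx w; set x := rsubmx w => E.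
  have : (s *m u + x *m K) *m (G *m u^T) = 0 by rewrite E mul0mx.
  rewrite mulmxDl -[x *m K *m _]mulmxA KG mulmx0 addr0 -mulmxA mulmxA => E'.
  have s0 : s = 0.
    move: E'; rewrite [s]mx11_scalar !mulmxA mul_scalar_mx -!scalemxAl => /eqP.
    rewrite scaler_eq0 (negbTE uGu) orbF => /eqP ->.
    by rewrite raddf0.
  rewrite s0 mul0mx add0r in E; rewrite s0.
  have -> : x = 0 by apply: (row_free_inj fK); rewrite E mul0mx.
  by rewrite row_mx0.
pose P1 : 'M[R]_(1 + n) := block_mx 1%:M 0 0 P.
have uP1 : P1 \in unitmx by rewrite unitmxE det_ublock det1 mul1r -unitmxE.
have uKG : u *m G *m K^T = 0.
  by apply: trmx_inj; rewrite !trmx_mul trmxK sG KG trmx0.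
have KGu : K *m G *m u^T = 0 by rewrite -mulmxA.
have E0 : P0 *m G *m P0^T = block_mx (u *m G *m u^T) 0 0 (K *m G *m K^T).
  by rewrite mul_col_mx tr_col_mx mul_col_row uKG KGu.
exists (P1 *m P0); first by rewrite unitmx_mul uP1.
have -> : P1 *m P0 *m G *m (P1 *m P0)^T =
    block_mx (u *m G *m u^T) 0 0 (P *m (K *m G *m K^T) *m P^T).
  rewrite trmx_mul -!mulmxA [P0 *m (G *m _)]mulmxA [P0 *m G *m (_ *m _)]mulmxA E0.
  rewrite tr_block_mx !trmx0 trmx1 !mulmx_block.
  by rewrite !(mulmx0, mul0mx) !addr0 !add0r !mul1mx mulmx1 !(mulmx0, mulmxA).
change (is_true (@is_diag_mx R (1 + n) (1 + n)
  (block_mx (u *m G *m u^T) 0 0 (P *m (K *m G *m K^T) *m P^T)))).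
by rewrite is_diag_block_mx ?eqxx//= dP andbT; exact: mx11_is_diag.
Qed.

(** The rows of a diagonalizing matrix are rescaled by the square roots of rho / |D_ii|, which
    adjusts the diagonal up to sign. Changing the sign of the row [i0] makes the determinant
    positive without affecting the absolute values. *)
Lemma orthonormal_congruence n (G : 'M[R]_n) (rho : R) : (0 < n)%N ->
  G^T = G -> G \in unitmx -> 0 < rho ->
  exists2 B : 'M[R]_n, 0 < \det B &
    forall i j, `|(B *m G *m B^T) i j| = rho * (i == j)%:R.
Proof.
move=> n0 sG uG rho0; have [P uP dP] := symmetric_diag sG.
set D := P *m G *m P^T in dP.
have uD : D \in unitmx by rewrite !unitmx_mul uP uG unitmx_tr.
have Dii i : D i i != 0.
  have := uD; rewrite unitmxE unitfE det_trig; last exact: is_diag_mx_is_trig.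
  by apply: contraNneq => Di; rewrite (bigD1 i)//= Di mul0r.
pose i0 : 'I_n := Ordinal n0.
have dP0 : \det P != 0 by rewrite -unitfE -unitmxE.
pose r i := Num.sqrt (rho / `|D i i|).
have r0 i : 0 < r i by rewrite sqrtr_gt0 divr_gt0// normr_gt0.
have rr i : r i * r i * `|D i i| = rho.
  rewrite -expr2 sqr_sqrtr; last by rewrite divr_ge0// ltW.
  by rewrite divfK// normr_eq0.
pose s : 'rV[R]_n := \row_i ((if i == i0 then Num.sg (\det P) else 1) * r i).
have ns i : `|s 0 i| = r i.
  rewrite mxE normrM (gtr0_norm (r0 i)); case: eqP => _; last by rewrite normr1 mul1r.
  by rewrite normr_sg dP0 mul1r.
exists (diag_mx s *m P).
  rewrite det_mulmx det_diag (bigD1 i0)//= mxE eqxx.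
  set p := \prod_(_ < _ | _) _.
  have -> : Num.sg (\det P) * r i0 * p * \det P = Num.sg (\det P) * \det P * (r i0 * p).
    by ring.
  apply: mulr_gt0; first by rewrite -normrEsg normr_gt0.
  apply: mulr_gt0 => //; rewrite prodr_gt0// => i /negbTE ii.
  by rewrite mxE ii mul1r; exact: r0.
move=> i j; rewrite trmx_mul tr_diag_mx !mulmxA -[diag_mx s *m P *m G]mulmxA.
rewrite -[diag_mx s *m _ *m P^T]mulmxA -/D mul_mx_diag mul_diag_mx.
rewrite [(\matrix_(_, _) _) i j]mxE [(\matrix_(_, _) _) i j]mxE.
have [<-|ij] := eqVneq i j; last first.
  by rewrite (is_diag_mxP dP)// mulr0 mul0r mulr0 normr0.
by rewrite mulr1 !normrM !ns -(rr i); ring.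
Qed.

End MatrixAlgebra.

(** * The Hessian and the third derivative on a tangent frame *)

Section CubicTrace.
Context (R : realType) (n m : nat) (F : 'rV[R]_m -> R^o) (x : 'rV[R]_m).
Implicit Types (T : 'M[R]_(n, m)) (X : 'rV[R]_m).

Definition second_form T : 'M[R]_n := T *m hess F x *m T^T.

Definition cubic_trace T X : R :=
  \tr (T *m 'D_X (hess F) x *m T^T *m invmx (second_form T)).

Lemma second_form_mul (P : 'M[R]_n) T :
  second_form (P *m T) = P *m second_form T *m P^T.
Proof. by rewrite /second_form trmx_mul !mulmxA. Qed.

(** Since P^T (P h P^T)^-1 P = h^-1, the trace depends only on the space spanned by the frame. This
    allows N and a hyperplane section of M to be compared at a point where they have the same
    tangent space. *)
Lemma cubic_trace_mul (P : 'M[R]_n) T X : P \in unitmx ->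
  second_form T \in unitmx -> cubic_trace (P *m T) X = cubic_trace T X.
Proof.
move=> uP uh; rewrite /cubic_trace second_form_mul trmx_mul.
move: (second_form T) uh ('D_X _ _) => h uh Q.
have uP' : P^T \in unitmx by rewrite unitmx_tr.
have uk : P *m h *m P^T \in unitmx by rewrite !unitmx_mul uP uh.
have E : P^T *m invmx (P *m h *m P^T) *m P = invmx h.
  apply: (can_inj (mulmxK uh)); rewrite mulVmx//.
  apply: (can_inj (mulmxK uP')).
  by rewrite mul1mx -[RHS]mulmx1 -(mulVmx uk) !mulmxA.
by rewrite -E !mulmxA [RHS]mxtrace_mulC !mulmxA.
Qed.

End CubicTrace.

(** * Defining functions of M in the charts of N *)

Section LocalCoordinates.
Context (R : realType) (n m : nat) (M : set 'rV[R]_m) (N : manifold R n).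
Context (f : N -> 'rV[R]_m) (f_imm : immersion f) (f_in_M : forall p, M (f p)).
Context (W : set 'rV[R]_m) (F : 'rV[R]_m -> R^o).
Context (dMF : defining_function M W F).
Implicit Types (p q : N) (U : set N).

Let oW : open W. Proof. by case: dMF. Qed.
Let sF : smooth_on W F. Proof. by case: dMF. Qed.

Lemma preimage_open : open (f @^-1` W).
Proof.
apply: open_comp => // q _; apply: msmooth_continuous.
by case: f_imm.
Qed.

Lemma defining_comp_eq0 q : W (f q) -> F (f q) = 0.
Proof.
case: dMF => _ _ MW _ Wq; have : (M `&` W) (f q) by split.
by rewrite MW => -[].
Qed.

Definition coord_dom p : set 'rV[R]_n := chart p @` (dom p `&` f @^-1` W).

Lemma coord_dom_open p : open (coord_dom p).
Proof. exact/chart_image_open/preimage_open. Qed.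

Lemma mem_coord_dom p q : dom p q -> W (f q) -> coord_dom p (chart p q).
Proof. by move=> dq Wq; exists q. Qed.

Lemma smooth_param p : smooth_on (coord_dom p) (f \o param p).
Proof.
case: f_imm => sf _; apply: smooth_subset (sf p) => _ [q [dq _] <-].
by exists q.
Qed.

Lemma coord_dom_sub p u : coord_dom p u -> W ((f \o param p) u).
Proof. by move=> [q [dq Wq] <-] /=; rewrite chartK. Qed.

Lemma coord_dom_eq0 p u : coord_dom p u -> F ((f \o param p) u) = 0.
Proof. by move=> [q [dq Wq] <-] /=; rewrite chartK//; exact: defining_comp_eq0. Qed.

Lemma chart_jacobian_grad p q : dom p q -> W (f q) ->
  'J (f \o param p) (chart p q) *m grad F (f q) = 0.
Proof.
move=> dq Wq; have Oq := mem_coord_dom dq Wq.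
have := jacobian_grad (@coord_dom_open p) (@smooth_param p) sF (@coord_dom_sub p)
  (@coord_dom_eq0 p) Oq.
by rewrite /= chartK.
Qed.

Lemma TN_grad q : W (f q) -> TN f q *m grad F (f q) = 0.
Proof. by move=> Wq; exact (chart_jacobian_grad (mem_dom q) Wq). Qed.

Lemma differentiable_chart (V : normedModType R) p q U (Y : N -> V) : dom p q -> U q ->
  msmooth_on U Y -> differentiable (Y \o param p) (chart p q).
Proof.
by move=> dq Uq sY; apply: smooth_diff (sY p) _; exact: mem_chart_image.
Qed.

Lemma flatD_grad p q a U (Y : N -> 'rV[R]_m) : dom p q -> U q -> W (f q) ->
  msmooth_on U Y ->
  let X := a *m 'J (f \o param p) (chart p q) in
  flatD f Y q X *m grad F (f q) + Y q *m hess F (f q) *m X^T =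
  'D_a (fun u => Y (param p u) *m grad F (f (param p u))) (chart p q).
Proof.
move=> dq Uq Wq sY X; have dY := differentiable_chart dq Uq sY.
rewrite /X (flatD_chart f_imm)// mul_jacobian; last exact: differentiable_param.
have Oq := mem_coord_dom dq Wq.
have := derive_mul_grad (@coord_dom_open p) (@smooth_param p) oW sF (@coord_dom_sub p) a Oq dY.
by rewrite /= chartK// => ->.
Qed.

(** Differentiating dF(Y) = 0 along X gives dF(D_X Y) = - d^2F(Y, X). Hence, for a transversal eta,
    the form h^2 is - d^2F / dF(eta) on TN. *)
Lemma flatD_tangent q U (Y : N -> 'rV[R]_m) (X : 'rV[R]_m) : open U -> U q -> W (f q) ->
  msmooth_on U Y -> (forall q', U q' -> W (f q') -> Y q' *m grad F (f q') = 0) ->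
  (X <= TN f q)%MS ->
  flatD f Y q X *m grad F (f q) = - (Y q *m hess F (f q) *m X^T).
Proof.
move=> oU Uq Wq sY Y0 /submxP[a ->]; apply/eqP; rewrite -subr_eq0 opprK.
have := flatD_grad a (mem_dom q) Uq Wq sY => /= ->.
have E : \forall u \near chart q q, Y (param q u) *m grad F (f (param q u)) = 0.
  have : nbhs (chart q q) (chart q @` (dom q `&` (U `&` f @^-1` W))).
    apply: open_nbhs_nbhs; split.
      by apply: chart_image_open; apply: openI => //; exact: preimage_open.
    by exists q => //; split; [exact: mem_dom|].
  by apply: filterS => u [x [dx [Ux Wx]] <-]; rewrite chartK//; exact: Y0.
by rewrite (near_eq_derive _ E) derive_cst.
Qed.

Lemma second_form_sym q (T : 'M[R]_(n, m)) : W (f q) ->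
  (second_form F (f q) T)^T = second_form F (f q) T.
Proof.
by move=> Wq; rewrite /second_form !trmx_mul trmxK (hess_sym oW sF Wq) mulmxA.
Qed.

End LocalCoordinates.

(** * The Darboux direction and non-degeneracy in terms of the Hessian *)

Section DarbouxFacts.
Context (R : realType) (n : nat) (M : set 'rV[R]_(n + 2)) (N : manifold R n).
Context (f xi : N -> 'rV[R]_(n + 2)).
Context (f_imm : immersion f) (f_in_M : forall p, M (f p)).
Context (f_nondeg : nondegenerate_immersion M f) (xi_darboux : darboux_field M f xi).
Context (W : set 'rV[R]_(n + 2)) (F : 'rV[R]_(n + 2) -> R^o).
Context (dMF : defining_function M W F).
Implicit Types (p q : N) (U : set N) (v w X : 'rV[R]_(n + 2)).

Lemma TM_iff q v : W (f q) -> TM M (f q) v <-> v *m grad F (f q) = 0.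
Proof. by move=> Wq; exact: TM_grad dMF Wq (f_in_M q). Qed.

Lemma grad_f_neq0 q : W (f q) -> grad F (f q) != 0.
Proof. by move=> Wq; exact: grad_neq0 dMF Wq (f_in_M q). Qed.

Lemma TN_free q : row_free (TN f q).
Proof. by case: f_imm. Qed.

Lemma xi_smooth : msmooth_on setT xi.
Proof. by case: xi_darboux. Qed.

Lemma xi_grad q : W (f q) -> xi q *m grad F (f q) = 0.
Proof. by move=> Wq; apply/(TM_iff _ Wq); have [_ /(_ q)[]] := xi_darboux. Qed.

Lemma flatD_xi_grad q X : W (f q) -> (X <= TN f q)%MS ->
  flatD f xi q X *m grad F (f q) = 0.
Proof.
move=> Wq XT; apply/(TM_iff _ Wq).
by have [_ /(_ q)[_ _ _]] := xi_darboux; apply.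
Qed.

(** Since xi is tangent to M, dF(D_X xi) = - d^2F(xi, X); the Darboux condition says that the left
    side is zero. *)
Lemma xi_hess q : W (f q) -> xi q *m hess F (f q) *m (TN f q)^T = 0.
Proof.
move=> Wq; apply: trmx_inj; rewrite trmx_mul trmxK trmx0.
apply/row_matrixP => i; rewrite row_mul row0; apply: trmx_inj.
rewrite trmx_mul trmxK trmx0 -[LHS]opprK.
have rT : (row i (TN f q) <= TN f q)%MS by exact: row_sub.
rewrite -(flatD_tangent f_imm dMF (U := setT)) ?flatD_xi_grad ?oppr0//.
- exact: openT.
- exact: xi_smooth.
- by move=> q' _; exact: xi_grad.
Qed.

Lemma TNxi_free q : row_free (col_mx (TN f q) (xi q)).
Proof.
apply: row_free_col_mx; first exact: TN_free.
by have [_ /(_ q)[]] := xi_darboux.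
Qed.

Lemma tangent_span (a : 'rV[R]_(n + 2)) q w : W (f q) -> ~~ (a <= TN f q)%MS ->
  a *m grad F (f q) = 0 -> w *m grad F (f q) = 0 -> (w <= col_mx (TN f q) a)%MS.
Proof.
move=> Wq aT ath; apply: kernel_span; first by rewrite addn1 addn2.
- by apply: row_free_col_mx; [exact: TN_free|].
- by rewrite mul_col_mx (TN_grad f_imm f_in_M dMF)// ath col_mx0.
- exact: grad_f_neq0.
Qed.

(** If x lies in the kernel of h and X = x TN, then dF(D_X Y) = 0 for every tangent field Y. So D_X
    Y lies in the span of TN and [a], its [b]-coordinate vanishes, and non-degeneracy gives X =
    0. *)
Lemma second_form_unit q : W (f q) -> second_form F (f q) (TN f q) \in unitmx.
Proof.
move=> Wq; rewrite -row_free_unit; apply: inj_row_free => x xh.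
have [a [b [/(TM_iff _ Wq) ath aT /(TM_iff _ Wq) bth nd]]] := f_nondeg q.
apply: (row_free_inj (TN_free q)); rewrite mul0mx.
apply: nd; first exact: submxMl.
move=> U Y oU Uq [sY YT]; rewrite /h2 /transversal_part.
have Yth q' : U q' -> W (f q') -> Y q' *m grad F (f q') = 0.
  move=> /YT /submxP[y ->] Wq'; by rewrite -mulmxA (TN_grad f_imm f_in_M dMF)// mulmx0.
have := flatD_tangent f_imm dMF oU Uq Wq sY Yth (submxMl x (TN f q)).
have [y ->] := submxP (YT q Uq).
have -> : y *m TN f q *m hess F (f q) *m (x *m TN f q)^T =
    y *m (x *m second_form F (f q) (TN f q))^T.
  by rewrite trmx_mul [in RHS]trmx_mul (second_form_sym dMF)// /second_form !mulmxA.
rewrite xh trmx0 mulmx0 oppr0.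
move=> /(tangent_span Wq aT ath)/submxP[c ->].
(* [h2] reads coordinates through [invmx], which is the true inverse only for a basis: [b] is
   outside TM while TN and [a] span TM. *)
have uA : col_mx (TN f q) (col_mx a b) \in unitmx.
  rewrite -row_free_unit; apply: inj_row_free => z; rewrite -[z]hsubmxK mul_row_col.
  set z1 := lsubmx z; set z2 : 'rV_(1 + 1) := rsubmx z.
  rewrite -[z2]hsubmxK mul_row_col => E.
  have s0 : rsubmx z2 = 0.
    have := congr1 (fun v => v *m grad F (f q)) E.
    rewrite !mulmxDl -!mulmxA (TN_grad f_imm f_in_M dMF)// ath !mulmx0 mul0mx !add0r.
    rewrite [rsubmx z2]mx11_scalar mul_scalar_mx => /eqP; rewrite scaler_eq0.
    by case/orP => [/eqP->|/eqP //]; rewrite raddf0.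
  rewrite s0 mul0mx addr0 in E; rewrite s0.
  have [-> ->] : z1 = 0 /\ lsubmx z2 = 0.
    have fa : row_free (col_mx (TN f q) a) by apply: row_free_col_mx; [exact: TN_free|].
    have E' : row_mx z1 (lsubmx z2) = 0.
      by apply: (row_free_inj fa); rewrite mul_row_col E mul0mx.
    by split; [have := congr1 lsubmx E'|have := congr1 rsubmx E']; rewrite ?row_mxKl ?row_mxKr !raddf0.
  by rewrite !row_mx0.
have -> : c *m col_mx (TN f q) a =
    row_mx (lsubmx c) (row_mx (rsubmx c) (0 : 'rV_1)) *m col_mx (TN f q) (col_mx a b).
  by rewrite !mul_row_col mul0mx addr0 -mul_row_col hsubmxK.
rewrite mulmxK// row_mxKr.
by rewrite mxE; case: splitP => j; rewrite ?mxE// [j]ord1.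
Qed.

(** TM is spanned by TN and xi. The TN-component of v is Hessian-orthogonal to TN, because v and xi
    are, so it vanishes by non-degeneracy. *)
Lemma xi_line q v : W (f q) -> v *m grad F (f q) = 0 ->
  v *m hess F (f q) *m (TN f q)^T = 0 -> (v <= xi q)%MS.
Proof.
move=> Wq vth; have aT : ~~ (xi q <= TN f q)%MS by have [_ /(_ q)[]] := xi_darboux.
have /submxP[c ->] := tangent_span Wq aT (xi_grad Wq) vth.
rewrite -[c]hsubmxK mul_row_col; set x := lsubmx c; set s := rsubmx c.
rewrite 2!mulmxDl -!mulmxA [xi q *m (_ *m _)]mulmxA xi_hess// mulmx0 addr0.
rewrite [TN f q *m (_ *m _)]mulmxA => xh.
have -> : x = 0.
  by rewrite -[x](mulmxK (second_form_unit Wq)) xh mul0mx.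
by rewrite mul0mx add0r submxMl.
Qed.

End DarbouxFacts.

(** * The affine metric *)

Section Bracket.
Context (R : realType) (n : nat).
Implicit Types (E : 'M[R]_(n, n + 2)) (v w x : 'rV[R]_(n + 2)) (th : 'cV[R]_(n + 2)).

(** With the rows of [E] and [x] in the kernel of [th], the bracket as a function of its middle
    vector is a multiple of [th]. A varying transversal can thus be replaced by a constant one. *)
Lemma bracket_grad E v w x th : th != 0 -> E *m th = 0 -> x *m th = 0 ->
  bracket E w x * (v *m th) 0 0 = bracket E v x * (w *m th) 0 0.
Proof.
move=> th0 Eth xth.
pose i0 : 'I_(n + (1 + 1)) := rshift n (lshift 1 (0 : 'I_1)).
pose A y : 'M[R]_(n + (1 + 1)) := col_mx E (col_mx y x).
have Ai y : row i0 (A y) = y by rewrite rowKd rowKu row_id.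
have Ath j y : j != i0 -> row j (A y) *m th = 0.
  case: (split_ordP j) => {j}[j ->|j ->] ji; first by rewrite rowKu -row_mul Eth row0.
  case: (split_ordP j) ji => {j}[j ->|j ->] ji; last by rewrite rowKd rowKd row_id.
  by rewrite (ord1 j) /i0 eqxx in ji.
have AA j : j != i0 -> row j (A v) = row j (A w).
  case: (split_ordP j) => {j}[j ->|j ->] ji; first by rewrite !rowKu.
  case: (split_ordP j) ji => {j}[j ->|j ->] ji; last by rewrite !rowKd.
  by rewrite (ord1 j) /i0 eqxx in ji.
have := @det_replace_row R (n + (1 + 1)) (A v) (A w) th i0 th0 AA (fun j => @Ath j v).
by rewrite !Ai.
Qed.

Lemma bracket_mul (B : 'M[R]_n) E v w : bracket (B *m E) v w = \det B * bracket E v w.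
Proof.
rewrite /bracket.
have -> : col_mx (B *m E) (col_mx v w) =
    block_mx B 0 0 (1%:M : 'M[R]_(1 + 1)) *m col_mx E (col_mx v w).
  by rewrite mul_block_col !mul0mx addr0 add0r mul1mx.
rewrite (@det_mulmx R (n + (1 + 1))).
by rewrite (@det_ublock R n (1 + 1)) det1 mulr1.
Qed.

Lemma bracket_neq0 E v x th : row_free (col_mx E x) -> E *m th = 0 ->
  x *m th = 0 -> v *m th != 0 -> bracket E v x != 0.
Proof.
move=> fEx Eth xth vth; rewrite /bracket -unitfE.
rewrite -[_ \is a GRing.unit](@unitmxE R (n + (1 + 1))) -row_free_unit.
apply: inj_row_free => z; rewrite -[z]hsubmxK mul_row_col.
set y := lsubmx z; set z2 : 'rV_(1 + 1) := rsubmx z.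
rewrite -[z2]hsubmxK mul_row_col => e.
have s0 : lsubmx z2 = 0.
  have := congr1 (fun v => v *m th) e.
  rewrite !mulmxDl -!mulmxA Eth xth !mulmx0 mul0mx addr0 add0r.
  rewrite [lsubmx z2]mx11_scalar mul_scalar_mx => /eqP.
  by rewrite scaler_eq0 (negbTE vth) orbF => /eqP->; rewrite raddf0.
rewrite s0 mul0mx add0r in e; rewrite s0.
have E' : row_mx y (rsubmx z2) = 0.
  by apply: (row_free_inj fEx); rewrite mul_row_col e mul0mx.
have -> : y = 0 by have := congr1 lsubmx E'; rewrite row_mxKl raddf0.
have -> : rsubmx z2 = 0 by have := congr1 rsubmx E'; rewrite row_mxKr raddf0.
by rewrite !row_mx0.
Qed.

Lemma norm_det_orthonormal (A : 'M[R]_n) (rho : R) : 0 <= rho ->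
  (forall i j, `|A i j| = rho * (i == j)%:R) -> `|\det A| = rho ^+ n.
Proof.
move=> rho0 Aij; rewrite det_trig; last first.
  apply/is_diag_mx_is_trig/is_diag_mxP => i j ij.
  by apply/eqP; rewrite -normr_eq0 Aij; rewrite -val_eqE in ij *; rewrite (negbTE ij) mulr0.
rewrite normr_prod (eq_bigr (fun=> rho)); last by move=> i _; rewrite Aij eqxx mulr1.
by rewrite prodr_const card_ord.
Qed.

Lemma powR_invn_exp (a : R) k : 0 <= a -> (a `^ (k.+1%:R)^-1) ^+ k.+1 = a.
Proof.
by move=> a0; rewrite -powR_mulrn ?powR_ge0// -powRrM mulVf ?pnatr_eq0// powRr1.
Qed.

End Bracket.

Section AffineMetric.
Context (R : realType) (n : nat) (M : set 'rV[R]_(n + 2)) (N : manifold R n).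
Context (f xi : N -> 'rV[R]_(n + 2)).
Context (f_imm : immersion f) (f_in_M : forall p, M (f p)).
Context (f_nondeg : nondegenerate_immersion M f) (xi_darboux : darboux_field M f xi).
Context (W : set 'rV[R]_(n + 2)) (F : 'rV[R]_(n + 2) -> R^o).
Context (dMF : defining_function M W F).
Implicit Types (p q : N) (U : set N) (X E : N -> 'M[R]_(n, n + 2)).

Lemma msmooth_field U X i : open U -> msmooth_on U X -> msmooth_on U (field_of X i).
Proof.
move=> oU sX p; have oO := @chart_image_open _ _ N p _ oU.
apply/(smooth_mxP oO) => k j; have /(smooth_mxP oO) := sX p.
move=> /(_ i j); rewrite /field_of.
by under [in X in _ -> X]eq_fun do rewrite /= mxE.
Qed.

Lemma frame_grad U X q : local_frame f U X -> U q -> W (f q) ->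
  X q *m grad F (f q) = 0.
Proof.
move=> [_ fX] Uq Wq; have /andP[_ /submxP[A ->]] := fX q Uq.
by rewrite -mulmxA (TN_grad f_imm f_in_M dMF)// mulmx0.
Qed.

Context (q : N) (Wq : W (f q)).
Context (U : set N) (oU : open U) (Uq : U q) (E : N -> 'M[R]_(n, n + 2)).
Context (fE : local_frame f U E) (e : 'rV[R]_(n + 2)).
Hypothesis eth : e *m grad F (f q) != 0.

Let g := (e *m grad F (f q)) 0 0.
Let c := - (bracket (E q) e (xi q) / g).

Lemma g_neq0 : g != 0.
Proof.
by apply: contraNneq eth => g0; apply/eqP/matrixP => i j; rewrite !ord1 [LHS]g0 mxE.
Qed.

Lemma frame_TN : exists2 A : 'M[R]_n, A \in unitmx & E q = A *m TN f q.
Proof. by case: fE => _ /(_ q Uq)/andP[fr sub]; exact: same_row_space. Qed.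

Lemma frame_bracket_neq0 : bracket (E q) e (xi q) != 0.
Proof.
have [A uA ->] := frame_TN; rewrite bracket_mul mulf_neq0//.
  by rewrite -unitfE -unitmxE.
apply: (@bracket_neq0 _ _ _ _ _ (grad F (f q))) => //.
- exact (TNxi_free f_imm xi_darboux q).
- exact (TN_grad f_imm f_in_M dMF Wq).
- exact (xi_grad f_in_M xi_darboux dMF Wq).
Qed.

(** The bracket sees the derivative of X_j along X_i only modulo TM, where it is - d^2F(X_i, X_j) /
    dF(e) times e. The factor [c] collects what does not depend on the fields. *)
Lemma Gform_second_form U' X i j : open U' -> U' q -> local_frame f U' X ->
  Gform f E xi (field_of X i) (field_of X j) q = c * second_form F (f q) (X q) i j.
Proof.
move=> oU' U'q fX; have [sX fX'] := fX.
have xith : xi q *m grad F (f q) = 0 by exact (xi_grad f_in_M xi_darboux dMF Wq).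
have rT : (field_of X i q <= TN f q)%MS.
  by have /andP[_] := fX' q U'q; apply: submx_trans; exact: row_sub.
have jth q' : U' q' -> W (f q') -> field_of X j q' *m grad F (f q') = 0.
  move=> U'q' Wq'; have /andP[_ /submxP[A XA]] := fX' q' U'q'.
  by rewrite /field_of -row_mul XA -mulmxA (TN_grad f_imm f_in_M dMF)// mulmx0 row0.
have := flatD_tangent f_imm dMF oU' U'q Wq (msmooth_field j oU' sX) jth rT.
rewrite /Gform; move: (flatD _ _ _ _) => w wth.
have := bracket_grad e w (grad_f_neq0 f_in_M dMF Wq) (frame_grad fE Uq Wq) xith.
rewrite wth -/g => Eg; apply: (mulIf g_neq0).
have -> : second_form F (f q) (X q) i j = (field_of X j q *m hess F (f q) *m (field_of X i q)^T) 0 0.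
  rewrite -(second_form_sym dMF)// [LHS]mxE /second_form /field_of -row_mul.
  by rewrite tr_row [col i _]colE mulmxA -row_mul -colE [RHS]mxE [RHS]mxE.
by rewrite Eg /c [X in _ * X]mxE; field; exact: g_neq0.
Qed.

Let k := second_form F (f q) (E q).
Let rho := `|\det (c *: k)| `^ (n.+2%:R)^-1.

Lemma gram_frame :
  \matrix_(i, j) Gform f E xi (field_of E i) (field_of E j) q = c *: k.
Proof. by apply/matrixP => i j; rewrite [LHS]mxE (Gform_second_form i j oU Uq fE) [RHS]mxE. Qed.

Lemma frame_second_form_unit : k \in unitmx.
Proof.
rewrite /k; have [A uA ->] := frame_TN; rewrite second_form_mul !unitmx_mul unitmx_tr uA.
by rewrite (second_form_unit f_imm f_in_M f_nondeg dMF Wq).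
Qed.

Lemma c_neq0 : c != 0.
Proof. by rewrite oppr_eq0 mulf_neq0 ?frame_bracket_neq0// invr_neq0// g_neq0. Qed.

Lemma gram_unit : c *: k \in unitmx.
Proof. by rewrite unitmxZ ?unitfE ?c_neq0//; exact: frame_second_form_unit. Qed.

Lemma gram_det_gt0 : 0 < `|\det (c *: k)|.
Proof. by rewrite normr_gt0 -unitfE -unitmxE gram_unit. Qed.

Lemma rho_gt0 : 0 < rho.
Proof. by rewrite powR_gt0// gram_det_gt0. Qed.

Lemma rho_exp : rho ^+ n.+2 = `|\det (c *: k)|.
Proof. by rewrite /rho powR_invn_exp. Qed.

Lemma affine_metricE U' X i j : open U' -> U' q -> local_frame f U' X ->
  affine_metric f E xi (field_of X i) (field_of X j) q =
  (c *: second_form F (f q) (X q)) i j / rho.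
Proof.
move=> oU' U'q fX; rewrite /affine_metric gram_frame (Gform_second_form i j oU' U'q fX).
by congr (_ / _); rewrite [RHS]mxE.
Qed.

(** Let A be the matrix of X in the frame E. Orthonormality says that the entries of c A k A^T are
    those of rho times the identity up to sign, so |det(c k)| (det A)^2 = rho^n. The exponent
    1/(n+2) in the metric makes |det(c k)| = rho^(n+2), whence (det A rho)^2 = 1, and the
    orientation selects det A rho = 1. *)
Lemma orthonormal_bracket U' X : open U' -> U' q -> local_frame f U' X ->
  same_orientation E X q -> orthonormal_frame f E xi X q ->
  bracket (X q) e (xi q) * rho = bracket (E q) e (xi q).
Proof.
move=> oU' U'q fX [A [XA A0]] oX.
have entry i j : `|(c *: second_form F (f q) (X q)) i j| = rho * (i == j)%:R.
  have := oX i j; rewrite (affine_metricE i j oU' U'q fX) normrM normfV (gtr0_norm rho_gt0).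
  by move=> <-; rewrite mulrC divfK// gt_eqF// rho_gt0.
have := norm_det_orthonormal (ltW rho_gt0) entry.
rewrite XA second_form_mul -/k bracket_mul scalemxAl scalemxAr !det_mulmx det_tr.
rewrite mulrAC normrM -rho_exp normrM (gtr0_norm A0) => Eq.
have r0 := rho_gt0.
have : (\det A * rho) ^+ 2 = 1.
  apply: (mulIf (x := rho ^+ n)); first by rewrite expf_neq0// gt_eqF.
  by rewrite mul1r -[RHS]Eq !exprS; ring.
move/eqP; rewrite sqrf_eq1 => /orP[/eqP Ar|/eqP Ar].
  by rewrite mulrAC Ar mul1r.
have : 0 < \det A * rho by rewrite mulr_gt0.
by rewrite Ar ltr0N1.
Qed.

(** Orthonormality is required at the single point q, so a constant matrix applied to the frame E is
    enough. *)
Lemma exists_orthonormal_frame : (0 < n)%N ->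
  exists X, [/\ local_frame f U X, same_orientation E X q & orthonormal_frame f E xi X q].
Proof.
move=> n0.
have sG : (c *: k)^T = c *: k by rewrite linearZ/= (second_form_sym dMF).
have [B B0 HB] := orthonormal_congruence n0 sG gram_unit rho_gt0.
have fX : local_frame f U (fun q => B *m E q).
  case: fE => sE fE'; split=> [p|q' Uq'].
    have oO := @chart_image_open _ _ N p _ oU.
    have sEp := sE p; apply/(smooth_mxP oO) => i j.
    under eq_fun do rewrite /= mxE.
    apply: smooth_sum => // l; apply: smoothM => //; first exact: smooth_cst.
    by move/(smooth_mxP oO) : sEp; apply.
  have /andP[fr sub] := fE' q' Uq'.
  rewrite (submx_trans (submxMl _ _) sub) andbT.
  rewrite /row_free mxrankMfree// -/(row_free B) row_free_unit unitmxE unitfE.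
  by rewrite gt_eqF.
exists (fun q => B *m E q); split=> //; first by exists B.
move=> i j; rewrite (affine_metricE i j oU Uq fX) second_form_mul -/k.
rewrite scalemxAl scalemxAr normrM HB normfV (gtr0_norm rho_gt0).
by rewrite mulrAC mulfV ?mul1r// gt_eqF// rho_gt0.
Qed.

(** An even power of the definition of rho: the exponent n + 2 clears the root, the square clears
    the absolute value and the sign in c g = - [E, e, xi]. *)
Lemma rho_volume : rho ^+ (2 * n.+2) * g ^+ (2 * n) =
  bracket (E q) e (xi q) ^+ (2 * n) * \det k ^+ 2.
Proof.
rewrite [(2 * n.+2)%N]mulnC exprM rho_exp detZ real_normK ?num_real// exprMn -exprM.
rewrite mulrAC [(n * 2)%N]mulnC -exprMn; congr (_ * _).
have -> : c * g = - bracket (E q) e (xi q) by rewrite /c mulNr divfK// g_neq0.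
by rewrite exprM sqrrN -exprM.
Qed.

Lemma normalized_volume : bracket (E q) e (xi q) = rho ->
  bracket (E q) e (xi q) ^+ 4 * g ^+ (2 * n) = \det k ^+ 2.
Proof.
move=> Er; have := rho_volume; rewrite -Er.
have d0 := frame_bracket_neq0; move: (bracket _ _ _) d0 => d d0 E'.
apply: (mulfI (x := d ^+ (2 * n))); first by rewrite expf_neq0.
by rewrite -E' mulrA -exprD; congr (_ ^+ _ * _); lia.
Qed.

(** The polynomial relation determines the bracket only up to sign; positivity allows the root of
    order 2 (n + 2) to be taken. *)
Lemma volume_normalized : 0 < bracket (E q) e (xi q) ->
  bracket (E q) e (xi q) ^+ 4 * g ^+ (2 * n) = \det k ^+ 2 ->
  bracket (E q) e (xi q) = rho.
Proof.
have := rho_volume; move: (bracket _ _ _) => d E' d0 vol.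
rewrite -vol mulrA -exprD in E'.
have {}E' := mulIf (expf_neq0 (2 * n) g_neq0) E'.
apply/eqP; rewrite -(@eqrXn2 _ (2 * n.+2)) ?(ltW rho_gt0) ?(ltW d0)//.
by rewrite E'; apply/eqP; congr (_ ^+ _); lia.
Qed.

End AffineMetric.

(** * The equation satisfied by an affine normal field *)

Section AffineNormalRelation.
Context (R : realType) (n : nat) (n_gt0 : (0 < n)%N).
Context (M : set 'rV[R]_(n + 2)) (N : manifold R n).
Context (f xi : N -> 'rV[R]_(n + 2)).
Context (f_imm : immersion f) (f_in_M : forall p, M (f p)).
Context (f_nondeg : nondegenerate_immersion M f) (xi_darboux : darboux_field M f xi).
Context (W : set 'rV[R]_(n + 2)) (F : 'rV[R]_(n + 2) -> R^o).
Context (dMF : defining_function M W F).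
Context (U : set N) (E : N -> 'M[R]_(n, n + 2)) (eta : N -> 'rV[R]_(n + 2)).
Hypotheses (oU : open U) (fE : local_frame f U E).
Hypothesis (nE : affine_normal_field M f xi U E eta).

Lemma affine_normal_transversal q : U q -> W (f q) -> eta q *m grad F (f q) != 0.
Proof.
move=> Uq Wq; have [_ /(_ q Uq) tr _ _] := nE.
by apply/eqP => eth; apply: tr; apply/(TM_iff f_in_M dMF (q := q)).
Qed.

(** The normalization clause speaks about orthonormal frames, so one must exist at q for it to give
    information; it yields [E, eta, xi] = rho, hence the polynomial relation for E. Passing to the
    coordinate frame multiplies both sides by the same fourth power of a determinant. *)
Lemma affine_normal_volume p q : dom p q -> U q -> W (f q) ->
  let T := 'J (f \o param p) (chart p q) in
  bracket T (eta q) (xi q) ^+ 4 * (eta q *m grad F (f q)) 0 0 ^+ (2 * n) =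
  \det (second_form F (f q) T) ^+ 2.
Proof.
move=> dq Uq Wq T; have eth := affine_normal_transversal Uq Wq.
have [_ _ _ norm] := nE.
have [X [fX oX nX]] := exists_orthonormal_frame f_imm f_in_M f_nondeg xi_darboux dMF
  Wq oU Uq fE eth n_gt0.
have := orthonormal_bracket f_imm f_in_M f_nondeg xi_darboux dMF Wq oU Uq fE eth oU Uq fX oX nX.
rewrite (norm q U X Uq oU Uq fX oX nX) mul1r => /esym Erho.
have := normalized_volume f_imm f_in_M xi_darboux dMF Wq Uq fE eth Erho.
have [A uA ->] : exists2 A : 'M[R]_n, A \in unitmx & E q = A *m T.
  have [_ /(_ q Uq)/andP[fr sub]] := fE.
  have /eqmxP/andP[sub' _] := TN_chart f_imm dq.
  exact: same_row_space fr (submx_trans sub sub').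
rewrite bracket_mul second_form_mul !det_mulmx det_tr => V.
have dA : \det A != 0 by rewrite -unitfE -unitmxE.
apply: (mulfI (x := \det A ^+ 4)); first by rewrite expf_neq0.
by rewrite mulrA -exprMn V !exprMn; ring.
Qed.

(** The volume identity is applied with g = dF(eta) and with nu frozen at the value eta(p), which
    makes C = 1. Tangency of D_X eta to M gives dg(X) = d^2F(X, eta), so the logarithmic derivative
    of g at p is d^2F(X, eta) / dF(eta). *)
Lemma affine_normal_relation p (a : 'rV[R]_n) S (tau : R) : U p -> W (f p) ->
  flatD f xi p (a *m TN f p) = S *m TN f p + tau *: xi p ->
  n.+2%:R * (a *m TN f p *m hess F (f p) *m (eta p)^T) 0 0 =
  (cubic_trace F (f p) (TN f p) (a *m TN f p) - 2 * tau) *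
  (eta p *m grad F (f p)) 0 0.
Proof.
move=> Up Wp Dxi; have [oW sF _ _] := dMF.
have [seta tr teta _] := nE.
have dp := mem_dom p; have E0 : param p (chart p p) = p by rewrite chartK.
set O := chart p @` (dom p `&` (U `&` f @^-1` W)).
have oO : open O.
  by apply: chart_image_open; apply: openI => //; exact (preimage_open f_imm dMF).
have Op : O (chart p p) by exists p.
have OO : O `<=` coord_dom f W p by move=> _ [q [dq [_ Wq]] <-]; exists q.
have OU : O `<=` chart p @` (dom p `&` U) by move=> _ [q [dq [Uq _]] <-]; exists q.
have sphi : smooth_on O (f \o param p) by exact (smooth_subset OO (smooth_param f_imm (p := p))).
have sxi : smooth_on O (xi \o param p).
  have OT : O `<=` chart p @` (dom p `&` setT) by move=> _ [q [dq _] <-]; exists q.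
  have sx := xi_smooth xi_darboux; exact (smooth_subset OT (sx p)).
have seta' : smooth_on O (eta \o param p) by exact (smooth_subset OU (seta p)).
have OW u : O u -> W ((f \o param p) u) by move=> /OO/coord_dom_sub.
have Fphi u : O u -> F ((f \o param p) u) = 0 by move=> /OO/(coord_dom_eq0 f_in_M dMF).
pose g (u : 'rV[R]_n) : R^o := (eta (param p u) *m grad F (f (param p u))) 0 0.
have dmul : differentiable (fun u => eta (param p u) *m grad F (f (param p u))) (chart p p).
  apply: differentiable_mulmx; first exact: smooth_diff seta' Op.
  exact (smooth_diff (smooth_grad_comp oO sphi oW sF OW) Op).
have dg : differentiable g (chart p p) by exact: differentiable_entry dmul.
have eth : eta p *m grad F (f p) != 0 by exact (affine_normal_transversal Up Wp).
have g0 : g (chart p p) != 0.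
  rewrite /g E0; apply: contraNneq eth => g0.
  by apply/eqP/matrixP => i j; rewrite !ord1 g0 mxE.
have xith q : W (f q) -> xi q *m grad F (f q) = 0 by exact (@xi_grad _ _ _ _ _ _ f_in_M xi_darboux _ _ dMF q).
have thp := grad_f_neq0 f_in_M dMF Wp.
have Dg : 'D_a g (chart p p) = (a *m TN f p *m hess F (f p) *m (eta p)^T) 0 0.
  rewrite -[LHS](derive_entry a 0 0 dmul).
  have := flatD_grad f_imm dMF a dp Up Wp seta => /= <-.
  have tang : flatD f eta p (a *m TN f p) *m grad F (f p) = 0.
    by apply/(TM_iff f_in_M dMF (q := p)) => //; apply: teta => //; exact: submxMl.
  rewrite -/(TN f p) tang add0r -[in RHS](hess_sym oW sF Wp).
  by rewrite -[in RHS](trmxK (a *m TN f p)) -trmx_mul -trmx_mul [RHS]mxE mulmxA.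
have Dphi : 'D_a (f \o param p) (chart p p) = a *m TN f p.
  by rewrite -mul_jacobian//; exact: differentiable_param.
have D0 : bracket (jacobian (f \o param p) (chart p p)) (eta p)
    ((xi \o param p) (chart p p)) != 0.
  rewrite /= E0; apply: (@bracket_neq0 _ _ _ _ _ (grad F (f p))) => //.
  - exact (TNxi_free f_imm xi_darboux p).
  - exact (TN_grad f_imm f_in_M dMF Wp).
  - exact: xith.
have xith0 : (xi \o param p) (chart p p) *m grad F ((f \o param p) (chart p p)) = 0.
  by rewrite /= E0; exact: xith.
have xiH0 : (xi \o param p) (chart p p) *m hess F ((f \o param p) (chart p p)) *m
    (jacobian (f \o param p) (chart p p))^T = 0.
  by rewrite /= E0; exact (xi_hess f_imm f_in_M xi_darboux dMF Wp).
have Dxi0 : 'D_a (xi \o param p) (chart p p) =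
    S *m jacobian (f \o param p) (chart p p) + tau *: (xi \o param p) (chart p p).
  rewrite /= E0 -/(TN f p) -Dxi.
  exact (esym (flatD_chart f_imm a dp (smooth_diff sxi Op))).
have vol : \forall u \near chart p p,
    bracket (jacobian (f \o param p) u) (eta p) ((xi \o param p) u) ^+ 4 *
      g u ^+ (2 * n.+2) =
    1 * (eta p *m grad F ((f \o param p) u)) 0 0 ^+ 4 *
      \det (jacobian (f \o param p) u *m hess F ((f \o param p) u) *m
        (jacobian (f \o param p) u)^T) ^+ 2.
  have nO : nbhs (chart p p) O by exact: open_nbhs_nbhs.
  apply: filterS nO => _ [q [dq [Uq Wq]] <-].
  have Wq' : W (f q) by [].
  rewrite /g /= chartK// mul1r.
  have := affine_normal_volume dq Uq Wq'; rewrite /= /second_form => <-.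
  have := bracket_grad (eta q) (eta p) (grad_f_neq0 f_in_M dMF Wq')
    (chart_jacobian_grad f_imm f_in_M dMF dq Wq') (xith q Wq').
  move: (bracket _ (eta q) _) (bracket _ (eta p) _) => d2 d1.
  move: ((eta p *m _) 0 0) ((eta q *m _) 0 0) => z y e12.
  have -> : (2 * n.+2 = 4 + 2 * n)%N by lia.
  have -> : z ^+ 4 * (d2 ^+ 4 * y ^+ (2 * n)) = (d2 * z) ^+ 4 * y ^+ (2 * n) by ring.
  by rewrite -e12 exprD; ring.
have := logder_transversal_volume oO sphi sxi oW sF OW Fphi Op dg D0 g0 xith0 xiH0 Dxi0 vol.
rewrite /logder Dg Dphi /g /= E0 -/(second_form F (f p) (TN f p)) => K.
rewrite /cubic_trace -[X in _ = X * _]K.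
have g0' : (eta p *m grad F (f p)) 0 0 != 0 by move: g0; rewrite /g E0.
by rewrite -mulrA divfK.
Qed.

End AffineNormalRelation.

Section SmoothMatrixOps.
Context (R : realType) (V : normedModType R) (U : set V) (oU : open U).

Lemma smooth_addmx m n (A B : V -> 'M[R]_(m, n)) :
  smooth_on U A -> smooth_on U B -> smooth_on U (fun x => A x + B x).
Proof.
move=> /(smooth_mxP oU) sA /(smooth_mxP oU) sB; apply/(smooth_mxP oU) => i j.
under eq_fun do rewrite mxE.
exact (smoothD oU (sA i j) (sB i j)).
Qed.

Lemma smooth_mulmx m n p (A : V -> 'M[R]_(m, n)) (B : V -> 'M[R]_(n, p)) :
  smooth_on U A -> smooth_on U B -> smooth_on U (fun x => A x *m B x).
Proof.
move=> /(smooth_mxP oU) sA /(smooth_mxP oU) sB; apply/(smooth_mxP oU) => i j.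
under eq_fun do rewrite mxE.
apply: smooth_sum => // k; exact (smoothM oU (sA i k) (sB k j)).
Qed.

End SmoothMatrixOps.

(** * The equation satisfied by the Blaschke normals of hyperplane sections *)

Section SectionNormal.
Context (R : realType) (n : nat).
Context (M : set 'rV[R]_(n + 2)) (N : manifold R n).
Context (f xi : N -> 'rV[R]_(n + 2)).
Context (f_imm : immersion f) (f_in_M : forall p, M (f p)).
Context (f_nondeg : nondegenerate_immersion M f) (xi_darboux : darboux_field M f xi).
Context (W : set 'rV[R]_(n + 2)) (F : 'rV[R]_(n + 2) -> R^o).
Context (dMF : defining_function M W F).
Context (p : N) (Wp : W (f p)) (B : 'M[R]_(n + 1, n + 2)).
Hypotheses (fB : row_free B) (TNB : (TN f p <= B)%MS).
Hypothesis (HB : ~ (forall v : 'rV[R]_(n + 2), (v <= B)%MS <-> TM M (f p) v)).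

Lemma section_grad_neq0 : B *m grad F (f p) != 0.
Proof.
apply/eqP => Bth; apply: HB => v; split=> [/submxP[c ->]|].
  by apply/(TM_iff f_in_M dMF _ Wp); rewrite -mulmxA Bth mulmx0.
move/(TM_iff f_in_M dMF _ Wp); apply: kernel_span => //; first by rewrite addn1 addn2.
exact (grad_f_neq0 f_in_M dMF Wp).
Qed.

Lemma section_xi : ~~ (xi p <= B)%MS.
Proof.
apply: contra section_grad_neq0 => xiB.
have sub : (col_mx (TN f p) (xi p) <= B)%MS by rewrite col_mx_sub TNB.
have /eqmxP eB : (col_mx (TN f p) (xi p) == B)%MS.
  rewrite -(geq_leqif (mxrank_leqif_eq sub)).
  by rewrite (eqP (TNxi_free f_imm xi_darboux p)) rank_leq_row.
have /submxP[A ->] : (B <= col_mx (TN f p) (xi p))%MS by rewrite eB.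
rewrite -mulmxA mul_col_mx (TN_grad f_imm f_in_M dMF)// (xi_grad f_in_M xi_darboux dMF)//.
by rewrite col_mx0 mulmx0.
Qed.

(** TM is spanned by TN and xi, and the hyperplane contains TN but not xi, so it meets TM in TN
    only. *)
Lemma section_tangent (w : 'rV[R]_(n + 2)) : (w <= B)%MS -> w *m grad F (f p) = 0 ->
  (w <= TN f p)%MS.
Proof.
move=> wB wth; have xT : ~~ (xi p <= TN f p)%MS by have [_ /(_ p)[]] := xi_darboux.
have xith := xi_grad f_in_M xi_darboux dMF Wp.
have /submxP[c cE] := tangent_span f_imm f_in_M dMF Wp xT xith wth.
move: cE; rewrite -[c]hsubmxK mul_row_col; set x := lsubmx c; set s := rsubmx c.
rewrite [s]mx11_scalar mul_scalar_mx => cE.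
suff s0 : s 0 0 = 0 by rewrite cE s0 scale0r addr0 submxMl.
apply/eqP; apply: contraNT section_xi => s0.
have -> : xi p = (s 0 0)^-1 *: (w - x *m TN f p).
  by rewrite cE addrAC subrr add0r scalerA mulVf// scale1r.
rewrite scalemx_sub// addmx_sub// eqmx_opp.
exact: submx_trans (submxMl _ _) TNB.
Qed.

Context (O : set 'rV[R]_n) (psi zeta : 'rV[R]_n -> 'rV[R]_(n + 1)) (u0 : 'rV[R]_n).
Hypotheses (oO : open O) (Ou0 : O u0) (psi0 : psi u0 = 0) (spsi : smooth_on O psi).
Hypothesis psiM : forall u, O u -> row_free ('J psi u) /\ M (f p + psi u *m B).
Let phi u := f p + psi u *m B.

Lemma smooth_section : smooth_on O phi.
Proof.
apply: smooth_addmx => //; first exact: smooth_cst.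
by apply: smooth_mulmx => //; exact: smooth_cst.
Qed.

Lemma section_jacobian u : O u -> 'J phi u = 'J psi u *m B.
Proof.
move=> Ou; have dpsi := smooth_diff spsi Ou; have dphi := smooth_diff smooth_section Ou.
apply/row_matrixP => i; rewrite row_mul !row_jacobian//.
have dc : differentiable (fun _ : 'rV[R]_n => B) u by exact: differentiable_cst.
have dm : differentiable (fun u => psi u *m B) u by exact: differentiable_mulmx.
have -> : 'D_(delta_mx 0 i) phi u = 'D_(delta_mx 0 i) (fun _ : 'rV[R]_n => f p) u +
    'D_(delta_mx 0 i) (fun u => psi u *m B) u.
  by apply: deriveD; apply: diff_derivable => //; exact: differentiable_cst.
by rewrite derive_cst add0r derive_mulmx// derive_cst mulmx0 addr0.
Qed.

Let O' := O `&` phi @^-1` W.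

Lemma section_open : open O'.
Proof.
have [oW _ _ _] := dMF.
rewrite openE => u [Ou Wu]; apply: filterI; first exact: open_nbhs_nbhs.
have c : {for u, continuous phi}.
  by apply: differentiable_continuous; exact: smooth_diff smooth_section Ou.
by apply: c; exact: open_nbhs_nbhs.
Qed.

Lemma section_mem : O' u0.
Proof. by split=> //; rewrite /phi /preimage/= psi0 mul0mx addr0. Qed.

Lemma section_smooth : smooth_on O' phi.
Proof. by apply: smooth_subset smooth_section => u []. Qed.

Lemma section_dom u : O' u -> W (phi u).
Proof. by case. Qed.

Lemma section_eq0 u : O' u -> F (phi u) = 0.
Proof.
move=> [Ou Wu]; have [_ _ MW _] := dMF.
have : (M `&` W) (phi u) by split=> //; have [] := psiM Ou.
by rewrite MW => -[].
Qed.

Lemma section_jacobian_grad u : O' u -> 'J phi u *m grad F (phi u) = 0.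
Proof.
have [oW sF _ _] := dMF => Ou.
exact (jacobian_grad section_open section_smooth sF section_dom section_eq0 Ou).
Qed.

(** In the decomposition of a second derivative of psi into a tangential part and a multiple of
    zeta, dF kills the tangential part, and its value on the second derivative is minus the Hessian
    on tangent vectors. *)
Lemma blaschke_form_grad u : O' u -> col_mx ('J psi u) (zeta u) \in unitmx ->
  (zeta u *m B *m grad F (phi u)) 0 0 *: blaschke_form psi zeta u =
  - (second_form F (phi u) ('J phi u))^T.
Proof.
move=> O'u uA; have [Ou Wu] := O'u; have [oW sF _ _] := dMF.
have dpsi w : O w -> differentiable psi w by exact: smooth_diff spsi.
apply/matrixP => i j; rewrite [LHS]mxE [blaschke_form _ _ _ _ _]mxE [RHS]mxE [X in - X]mxE.
rewrite /transversal_part.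
set w := 'D_(delta_mx 0 i) _ u.
have wE : w *m B *m grad F (phi u) =
    - ('D_(delta_mx 0 j) phi u *m hess F (phi u) *m ('D_(delta_mx 0 i) phi u)^T).
  have := derive_jacobian_grad section_open section_smooth oW sF section_dom section_eq0
    (delta_mx 0 i) O'u.
  move/(congr1 (row j)).
  rewrite row_mul (row_derive_jacobian section_open section_smooth j _ O'u).
  rewrite linearN/= !row_mul row_jacobian; last exact: smooth_diff section_smooth O'u.
  move=> <-; congr (_ *m _).
  have E : \near u, 'D_(delta_mx 0 j) phi u = 'D_(delta_mx 0 j) psi u *m B.
    apply: near_open_eq section_open _ O'u => y [Oy _].
    have dphiy := smooth_diff smooth_section Oy.
    by rewrite -!row_jacobian ?section_jacobian ?row_mul//; exact: dpsi.
  rewrite (near_eq_derive _ E) derive_mulmx ?derive_cst ?mulmx0 ?addr0//.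
  exact: smooth_diff (smooth_derive _ spsi) Ou.
have [c cE] : exists c, w = c *m col_mx ('J psi u) (zeta u).
  by exists (w *m invmx (col_mx ('J psi u) (zeta u))); rewrite mulmxKV.
rewrite cE mulmxK//.
have {}wE : (rsubmx c *m (zeta u *m B *m grad F (phi u))) 0 0 =
   - ('J phi u *m hess F (phi u) *m ('J phi u)^T) j i.
  have -> : rsubmx c *m (zeta u *m B *m grad F (phi u)) = w *m B *m grad F (phi u).
    rewrite cE -[in RHS](hsubmxK c) mul_row_col !mulmxDl -!mulmxA.
    rewrite ['J psi u *m (B *m _)]mulmxA -section_jacobian//.
    by rewrite section_jacobian_grad// mulmx0 add0r.
  rewrite wE [LHS]mxE; congr (- _).
  have dphi := smooth_diff section_smooth O'u.
  rewrite -!row_jacobian// tr_row colE mulmxA -!row_mul -colE.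
  by rewrite [LHS]mxE [LHS]mxE.
rewrite [rsubmx c]mx11_scalar mul_scalar_mx [LHS]mxE in wE.
by rewrite [LHS]mulrC wE /second_form.
Qed.

Hypothesis bf : blaschke_field O psi zeta.

Lemma section_grad_zeta : (zeta u0 *m B *m grad F (f p)) 0 0 != 0.
Proof.
apply: contraNneq section_grad_neq0 => z0.
have E0 : phi u0 = f p by rewrite /phi psi0 mul0mx addr0.
have [_ /(_ u0 Ou0)[uA _ _ _]] := bf.
apply/eqP; rewrite -[LHS](mulKmx uA) mul_col_mx mulmxA -section_jacobian//.
have := section_jacobian_grad section_mem; rewrite E0 => ->.
have -> : zeta u0 *m (B *m grad F (f p)) = 0.
  by rewrite mulmxA; apply/matrixP => i j; rewrite !ord1 [LHS]z0 mxE.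
by rewrite col_mx0 mulmx0.
Qed.

Let e : (n + 1 + 1 = n + 2)%N. Proof. by rewrite !addn1 addn2. Qed.
(** The constant ratio between brackets of R^(n+2) with last vector xi(p) and determinants inside
    the hyperplane. It puts the Blaschke volume into the codimension two form of the volume
    identity. *)
Let kappa := \det (castmx (e, erefl (n + 2)%N) (col_mx B (xi p))).

Lemma kappa_neq0 : kappa != 0.
Proof.
rewrite /kappa -unitfE -[_ \is a GRing.unit](@unitmxE R (n + 2)) -row_free_unit.
have := row_free_col_mx fB section_xi.
by move: (col_mx B (xi p)) => A; rewrite /row_free; move: e A => e'; case: _ / e' => A; rewrite castmx_id.
Qed.

Lemma section_bracket (J : 'M[R]_(n, n + 1)) v :
  bracket (J *m B) (v *m B) (xi p) = \det (col_mx J v) * kappa.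
Proof. exact (det_lift e (erefl _) B (xi p) J v). Qed.

(** The volume clause of the Blaschke field, raised to the fourth power, loses its root and absolute
    values. The determinant with zeta(u) is then exchanged for the one with the constant vector
    zeta(u0) at the cost of the ratio of their values under dF. *)
Lemma section_volume u : O' u ->
  let nu := zeta u0 *m B in
  bracket ('J phi u) nu (xi p) ^+ 4 *
    (zeta u *m B *m grad F (phi u)) 0 0 ^+ (2 * n.+2) =
  kappa ^+ 4 * (nu *m grad F (phi u)) 0 0 ^+ 4 *
    \det (second_form F (phi u) ('J phi u)) ^+ 2.
Proof.
move=> O'u nu; have [Ou Wu] := O'u.
rewrite section_jacobian// section_bracket -section_jacobian//.
have [_ /(_ u Ou)[uA _ _ dets]] := bf.
set g := (zeta u *m B *m grad F (phi u)) 0 0.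
set d := \det (col_mx ('J psi u) (zeta u)) in dets.
set b := blaschke_form psi zeta u in dets.
have d4 : d ^+ 4 = \det b ^+ 2.
  have := congr1 (fun x => x ^+ 4) dets.
  rewrite (exprM _ 2 2) real_normK ?num_real// -exprM => ->.
  by rewrite (exprM _ 2 2) sqr_sqrtr// real_normK ?num_real.
have bg : \det b ^+ 2 * g ^+ (2 * n) = \det (second_form F (phi u) ('J phi u)) ^+ 2.
  have := congr1 (fun A => \det A ^+ 2) (blaschke_form_grad O'u uA).
  rewrite -/g -/b detZ exprMn -exprM mulnC [LHS]mulrC => ->.
  rewrite -scaleN1r detZ det_tr exprMn -exprM mulnC exprM sqrrN expr1n expr1n.
  by rewrite mul1r.
have Jth : 'J psi u *m (B *m grad F (phi u)) = 0.
  have := section_jacobian_grad O'u; rewrite (section_jacobian Ou) => <-.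
  by rewrite mulmxA.
have dg : \det (col_mx ('J psi u) (zeta u0)) * g = (nu *m grad F (phi u)) 0 0 * d.
  by have := det_col_grad (zeta u0) (zeta u) Jth; rewrite !mulmxA -/g -/d => ->; rewrite mulrC.
have -> : (2 * n.+2 = 4 + 2 * n)%N by lia.
rewrite -bg -d4 exprD.
move: (\det (col_mx _ (zeta u0))) ((nu *m _) 0 0) dg => x y xy.
have -> : kappa ^+ 4 * y ^+ 4 * (d ^+ 4 * g ^+ (2 * n)) =
  kappa ^+ 4 * (y * d) ^+ 4 * g ^+ (2 * n) by ring.
by rewrite -xy; ring.
Qed.

(** The volume identity is applied to the section with the constant field xi(p), so S = 0 and tau =
    0, and with C = kappa^4. It requires xi(p) to be Hessian-orthogonal to the section only at u0,
    where the section is tangent to N. *)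
Lemma section_normal_relation_aux (a : 'rV[R]_n) :
  n.+2%:R * (a *m TN f p *m hess F (f p) *m (zeta u0 *m B)^T) 0 0 =
  cubic_trace F (f p) (TN f p) (a *m TN f p) * (zeta u0 *m B *m grad F (f p)) 0 0.
Proof.
have [oW sF _ _] := dMF; have E0 : phi u0 = f p by rewrite /phi psi0 mul0mx addr0.
have [szeta bz] := bf; have O'u0 := section_mem.
have sO' : O' `<=` O by move=> u [].
have szeta' : smooth_on O' zeta by exact (smooth_subset sO' szeta).
have dzeta : differentiable zeta u0 by exact: smooth_diff szeta Ou0.
pose g (u : 'rV[R]_n) : R^o := (zeta u *m B *m grad F (phi u)) 0 0.
have dzB : differentiable (fun u => zeta u *m B) u0.
  by apply: differentiable_mulmx => //; exact: differentiable_cst.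
have DzB b : 'D_b (fun u => zeta u *m B) u0 = 'D_b zeta u0 *m B.
  rewrite (derive_mulmx b dzeta (differentiable_cst B u0)).
  by rewrite [X in _ + _ *m X]derive_cst mulmx0 addr0.
have dth : differentiable (fun u => grad F (phi u)) u0.
  exact (smooth_diff (smooth_grad_comp section_open section_smooth oW sF section_dom) O'u0).
have dmul : differentiable (fun u => zeta u *m B *m grad F (phi u)) u0.
  exact: differentiable_mulmx.
have dg : differentiable g u0 by exact: differentiable_entry dmul.
have dphi := smooth_diff section_smooth O'u0.
have [P uP TE] : exists2 P : 'M[R]_n, P \in unitmx & 'J phi u0 = P *m TN f p.
  apply: same_row_space.
    by rewrite section_jacobian// /row_free mxrankMfree//; have [] := psiM Ou0.
  apply/row_subP => i; apply: section_tangent.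
    by rewrite section_jacobian// row_mul submxMl.
  by have := section_jacobian_grad O'u0; rewrite E0 -row_mul => ->; rewrite row0.
(* The section and N have the same tangent space at f(p) but different coordinates; [b] holds those
   of the vector a TN in the parametrization of the section. *)
set b := a *m invmx P.
have aE : a *m TN f p = b *m 'J phi u0 by rewrite TE mulmxA mulmxKV.
have Dphi := etrans (esym (mul_jacobian b dphi)) (esym aE).
have Dg : 'D_b g u0 = (a *m TN f p *m hess F (f p) *m (zeta u0 *m B)^T) 0 0.
  rewrite -[LHS](derive_entry b 0 0 dmul).
  rewrite (derive_mul_grad section_open section_smooth oW sF section_dom b O'u0 dzB).
  rewrite DzB.
  have tz : 'D_b zeta u0 *m B *m grad F (phi u0) = 0.
    have [_ _ /(_ b)/submxP[c cE] _] := bz u0 Ou0.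
    have := congr1 (mulmx c) (section_jacobian_grad O'u0).
    by rewrite (section_jacobian Ou0) mulmx0 !mulmxA -cE.
  rewrite tz add0r Dphi E0.
  rewrite -[in RHS](hess_sym oW sF Wp).
  by rewrite -[in RHS](trmxK (a *m TN f p)) -trmx_mul -trmx_mul [RHS]mxE mulmxA.
have xith := xi_grad f_in_M xi_darboux dMF Wp.
have D0 : bracket ('J phi u0) (zeta u0 *m B) (xi p) != 0.
  rewrite (section_jacobian Ou0) section_bracket; apply: mulf_neq0; last exact: kappa_neq0.
  have [uA _ _ _] := bz u0 Ou0; rewrite -unitfE -unitmxE; exact: uA.
have g0 : g u0 != 0 by rewrite /g E0 section_grad_zeta.
have xith0 : xi p *m grad F (phi u0) = 0 by rewrite E0.
have xiH0 : xi p *m hess F (phi u0) *m ('J phi u0)^T = 0.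
  by rewrite E0 TE trmx_mul mulmxA (xi_hess f_imm f_in_M xi_darboux dMF Wp) mul0mx.
have Dxi0 : 'D_b (fun _ : 'rV[R]_n => xi p) u0 = 0 *m 'J phi u0 + 0 *: xi p.
  by rewrite derive_cst mul0mx scale0r addr0.
have vol : \forall u \near u0, bracket ('J phi u) (zeta u0 *m B) (xi p) ^+ 4 *
    g u ^+ (2 * n.+2) =
    kappa ^+ 4 * (zeta u0 *m B *m grad F (phi u)) 0 0 ^+ 4 *
      \det ('J phi u *m hess F (phi u) *m ('J phi u)^T) ^+ 2.
  have nO := open_nbhs_nbhs (conj section_open O'u0).
  by apply: (filterS _ nO) => u O'u; exact (section_volume O'u).
have := logder_transversal_volume section_open section_smooth
  (smooth_cst (xi p)) oW sF section_dom section_eq0 O'u0 dg D0 g0 xith0 xiH0 Dxi0 vol.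
rewrite mulr0 subr0 /logder Dg Dphi /g E0.
rewrite -/(second_form F (f p) ('J phi u0)) -/(cubic_trace F (f p) ('J phi u0) _).
rewrite TE (cubic_trace_mul _ uP (second_form_unit f_imm f_in_M f_nondeg dMF Wp)) => <-.
by rewrite -mulrA (divfK section_grad_zeta).
Qed.

End SectionNormal.

Lemma section_normal_relation (R : realType) (n : nat)
    (M : set 'rV[R]_(n + 2)) (N : manifold R n) (f xi : N -> 'rV[R]_(n + 2))
    (W : set 'rV[R]_(n + 2)) (F : 'rV[R]_(n + 2) -> R^o) p v (a : 'rV[R]_n) :
  immersion f -> (forall p, M (f p)) -> nondegenerate_immersion M f ->
  darboux_field M f xi -> defining_function M W F -> W (f p) ->
  section_normal M f p v ->
  n.+2%:R * (a *m TN f p *m hess F (f p) *m v^T) 0 0 =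
  cubic_trace F (f p) (TN f p) (a *m TN f p) * (v *m grad F (f p)) 0 0.
Proof.
move=> f_imm f_in_M f_nondeg xi_darboux dMF Wp.
move=> [B [z [fB TNB BTM [V [psi [zeta [u0 [[oO Ou0 psi0] spsi psiM bf zE]]]]] vE]]].
rewrite vE -zE.
exact (section_normal_relation_aux f_imm f_in_M f_nondeg xi_darboux dMF Wp fB TNB BTM oO Ou0 psi0 spsi psiM bf a).
Qed.

(** * An implicit function theorem *)

Lemma smooth_id (R : realType) (V : normedModType R) (U : set V) : smooth_on U id.
Proof.
move=> s x _; case/lastP: s => [|s v].
  by have := is_diff_id x => -[].
rewrite /iter_derive foldr_rcons -/(iter_derive s _).
have -> : 'D_v id = (fun=> v) :> (V -> V) by apply/funext => y; exact: derive_id.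
exact (@smooth_cst R V V setT v s x I).
Qed.

(** At a zero of f the increment of f q is q(x) df(y) + o(y) even if q is only continuous. An
    implicit function will appear in this form, with q coming from a mean value point that need not
    depend smoothly on y. *)
Lemma differentiable_mul0 (R : realType) (V : normedModType R) (f q : V -> R^o) x :
  differentiable f x -> f x = 0 -> {for x, continuous q} ->
  differentiable (fun y => f y * q y : R^o) x.
Proof.
move=> df fx0 cq.
pose L : {linear V -> R^o} := q x \*: 'd f x.
have cL : continuous L.
  by move=> y; apply: continuousM; [exact: cst_continuous|exact: diff_continuous].
suff eL : (fun y => f y * q y : R^o) \o shift x = cst (f x * q x : R^o) + L +o_ 0 id.
  by apply/diff_locallyP; rewrite (diff_unique cL eL).
have [C C0 HC] := linear_lipschitz (diff_continuous df).
apply/eqaddoP => e e0.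
have q0 : 0 < `|q x| + 1 by rewrite ltr_wpDl.
have e1 : 0 < e / 2 / (`|q x| + 1) by rewrite !divr_gt0.
have e2 : 0 < Num.min 1 (e / 2 / C) by rewrite lt_min ltr01 !divr_gt0.
have H1 := diff_approx df e1.
have H2 : \forall y \near (0 : V), `|q x - q (y + x)| < Num.min 1 (e / 2 / C).
  have : \forall y \near x, `|q x - q y| < Num.min 1 (e / 2 / C).
    by move/cvgrPdist_lt : cq; apply.
  by rewrite (near_shift 0)/=; apply: filterS => y; rewrite subr0.
near=> y.
rewrite -[(_ - _) y]/(f (y + x) * q (y + x) - (f x * q x + q x * 'd f x y)).
have h1 : `|f (y + x) - f x - 'D_y f x| <= e / 2 / (`|q x| + 1) * `|y| by near: y.
have h2 : `|q x - q (y + x)| < Num.min 1 (e / 2 / C) by near: y.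
have h3 := HC y.
move: h1 h2; rewrite fx0 mul0r add0r subr0 deriveE// lt_min => h1 /andP[h2 h4].
have -> : f (y + x) * q (y + x) - q x * 'd f x y =
    (f (y + x) - 'd f x y) * q (y + x) + 'd f x y * (q (y + x) - q x) by ring.
apply: le_trans (ler_normD _ _) _; rewrite [leRHS](_ : _ = e / 2 * `|y| + e / 2 * `|y|); last first.
  by rewrite -mulrDl -splitr.
apply: lerD.
  rewrite normrM; apply: (@le_trans _ _ (e / 2 / (`|q x| + 1) * `|y| * (`|q x| + 1))).
    apply: ler_pM => //; rewrite -[X in `|X| <= _](subrK (q x)).
    apply: le_trans (ler_normD _ _) _; rewrite addrC lerD2l distrC; exact: ltW.
  by rewrite mulrAC divfK// gt_eqF.
rewrite normrM; apply: (@le_trans _ _ (C * `|y| * (e / 2 / C))).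
  by apply: ler_pM => //; rewrite distrC; exact: ltW.
by rewrite mulrC mulrA divfK// gt_eqF.
Unshelve. all: by end_near. Qed.

Lemma continuous_dist (R : realType) (V W : normedModType R) (h : V -> W) x :
  {for x, continuous h} <->
  (forall e, 0 < e -> \forall y \near x, `|h x - h y| < e).
Proof. by split=> [c e e0|H]; [move/cvgrPdist_lt : c; apply|apply/cvgrPdist_lt]. Qed.

Section ImplicitFunction.
Context (R : realType) (n : nat).
Implicit Types (y v : 'rV[R]_n) (z : 'rV[R]_(n + 1)).

Definition graph_point y (t : R) : 'rV[R]_(n + 1) := row_mx y t%:M.

Local Notation gp := graph_point.
Local Notation e := (row_mx 0 1%:M : 'rV[R]_(n + 1)).

Lemma graph_pointD y t s : gp y (t + s) = gp y t + s *: e.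
Proof.
by rewrite /gp scale_row_mx add_row_mx scaler0 addr0 scalemx1 -raddfD.
Qed.

Lemma norm_row_lt m (z : 'rV[R]_m) (r : R) : 0 < r ->
  `|z| < r <-> forall j, `|z 0 j| < r.
Proof.
move=> r0; rewrite [in X in X <-> _]/Num.Def.normr/= mx_normrE; split=> [zr j|zr].
  by apply: le_lt_trans zr; exact: (le_bigmax _ (fun i => `|z i.1 i.2|) (0, j)).
by apply: bigmax_lt => // -[i j] _ /=; rewrite (ord1 i).
Qed.

Lemma norm_graph_point y t r : 0 < r -> `|y| < r -> `|t| < r -> `|gp y t| < r.
Proof.
move=> r0 /(norm_row_lt _ r0) yr tr; apply/norm_row_lt => // j.
case: (split_ordP j) => k ->; rewrite ?row_mxEl ?row_mxEr//.
by rewrite mxE (ord1 k) eqxx.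
Qed.

Lemma graph_pointB y t y' t' : gp y t - gp y' t' = gp (y - y') (t - t').
Proof. by rewrite /gp opp_row_mx add_row_mx -raddfB. Qed.

Section Graph.
Context (O : set 'rV[R]_n) (oO : open O) (t : 'rV[R]_n -> R^o).

Lemma differentiable_graph y : differentiable t y ->
  differentiable (fun y => gp y (t y)) y.
Proof.
move=> dt; apply: differentiable_mx => i j; rewrite (ord1 i).
case: (split_ordP j) => k ->.
  by under eq_fun do rewrite row_mxEl; exact: differentiable_coord.
by under eq_fun do rewrite row_mxEr mxE (ord1 k) eqxx mulr1n.
Qed.

Lemma derive_graph y v : differentiable t y ->
  'D_v (fun y => gp y (t y)) y = gp v ('D_v t y).
Proof.
move=> dt; have dg := differentiable_graph dt.
apply/rowP => j; rewrite (derive_entry v 0 j dg).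
case: (split_ordP j) => k ->.
  under eq_fun do rewrite row_mxEl; rewrite row_mxEl.
  by rewrite -[LHS](derive_entry v 0 k (F := id))// derive_id.
under eq_fun do rewrite row_mxEr mxE (ord1 k) eqxx mulr1n.
by rewrite row_mxEr mxE (ord1 k) eqxx mulr1n.
Qed.

Lemma smooth_graph : smooth_on O t -> smooth_on O (fun y => gp y (t y)).
Proof.
move=> st; apply/(smooth_mxP oO) => i j; rewrite (ord1 i).
case: (split_ordP j) => k ->.
  under eq_fun do rewrite row_mxEl.
  by have /(smooth_mxP oO) := @smooth_id R _ O; apply.
by under eq_fun do rewrite row_mxEr mxE (ord1 k) eqxx mulr1n.
Qed.

End Graph.

Section ImplicitPositive.
Context (Z : set 'rV[R]_(n + 1)) (G : 'rV[R]_(n + 1) -> R^o).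
Hypothesis sG : smooth_on Z G.
Context (k r : R).
Hypotheses (k0 : 0 < k) (r0 : 0 < r).
Hypothesis rZ : forall z, `|z| < r -> Z z /\ k < 'D_e G z.

(** Besides the mean value formula, the point c is kept within |t2 - t1| of t1: it therefore tends
    to t1 together with t2, which gives continuity of the slope at the base point. *)
Lemma vertical_mvt y t1 t2 : `|y| < r -> `|t1| < r -> `|t2| < r ->
  exists c, [/\ `|c| < r, `|c - t1| <= `|t2 - t1| &
    G (gp y t2) - G (gp y t1) = (t2 - t1) * 'D_e G (gp y c)].
Proof.
move=> yr t1r t2r.
have main a b : a < b -> `|a| < r -> `|b| < r -> exists c, [/\ a <= c, c <= b, `|c| < r &
    G (gp y b) - G (gp y a) = (b - a) * 'D_e G (gp y c)].
  move=> ab ar br; have h0 : 0 < b - a by rewrite subr_gt0.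
  have bound s : 0 <= s <= b - a -> `|a + s| < r.
    move: ar br; rewrite !ltr_norml => /andP[a1 a2] /andP[b1 b2] /andP[s1 s2].
    by apply/andP; split; lra.
  have [s /bound sr|s sb E] := @line_mvt R _ G (gp y a) e (b - a) h0.
    rewrite -graph_pointD; apply: smooth_diff sG _.
    by have [] := rZ (norm_graph_point r0 yr sr).
  exists (a + s); rewrite graph_pointD -E -graph_pointD subrKC.
  by move: (sb) => /andP[s1 s2]; split; [lra|lra|exact: bound|].
have [t12|t21|E] := ltgtP t1 t2.
- have [c [c1 c2 cr E]] := main _ _ t12 t1r t2r; exists c; split=> //.
  rewrite !ger0_norm; lra.
- have [c [c1 c2 cr E]] := main _ _ t21 t2r t1r; exists c; split=> //.
    by rewrite (distrC c) (distrC t2) !ger0_norm; lra.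
  by rewrite -opprB E -mulNr opprB.
- by exists t1; rewrite E !subrr mul0r; split=> //; rewrite -E.
Qed.

Lemma vertical_bound y t1 t2 : `|y| < r -> `|t1| < r -> `|t2| < r ->
  k * `|t2 - t1| <= `|G (gp y t2) - G (gp y t1)|.
Proof.
move=> yr t1r t2r; have [c [cr _ ->]] := vertical_mvt yr t1r t2r.
have [_ kc] := rZ (norm_graph_point r0 yr cr).
rewrite normrM mulrC; apply: ler_wpM2l => //.
by rewrite gtr0_norm ?(lt_trans k0)// ltW.
Qed.

(** The functions y -> A(y, t(y)) with A smooth form a class closed under derivation, since the
    derivative of t is - D_(v,0) G / D_e G evaluated on the graph. The function t itself belongs to
    this class. *)
Lemma smooth_implicit (O : set 'rV[R]_n) (t : 'rV[R]_n -> R^o) : open O ->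
  (forall y, O y -> `|gp y (t y)| < r /\ G (gp y (t y)) = 0) ->
  (forall y, O y -> differentiable t y) -> smooth_on O t.
Proof.
move=> oO Gt dt; pose B := [set z : 'rV[R]_(n + 1) | `|z| < r].
have oB : open B.
  have -> : B = ball 0 r by apply/seteqP; split=> z; rewrite -ball_normE/= sub0r normrN.
  exact: ball_open.
have sGB : smooth_on B G by apply: smooth_subset sG => z /rZ[].
have DG z : B z -> 'D_e G z != 0 by move=> /rZ[_] /(lt_trans k0); exact: lt0r_neq0.
pose P (f : 'rV[R]_n -> R^o) := exists2 A : 'rV[R]_(n + 1) -> R^o,
  smooth_on B A & f = fun y => A (gp y (t y)).
have dg y : O y -> differentiable (fun y => gp y (t y)) y.
  by move=> Oy; exact: differentiable_graph (dt y Oy).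
have BO y : O y -> B (gp y (t y)) by move=> /Gt[].
have chain A y v : smooth_on B A -> O y -> 'D_v (fun y => A (gp y (t y)) : R^o) y =
    'D_(gp v 0) A (gp y (t y)) + 'D_v t y * 'D_e A (gp y (t y)).
  move=> sA Oy; have dA := smooth_diff sA (BO y Oy).
  rewrite [LHS](derive_comp v (dg y Oy) dA) derive_graph; last exact: dt.
  by rewrite -[X in gp v X]add0r graph_pointD deriveDl// deriveZl.
have Dt y v : O y -> 'D_v t y = - ('D_(gp v 0) G (gp y (t y)) * ('D_e G (gp y (t y)))^-1).
  move=> Oy; have nz := DG _ (BO y Oy).
  have E : \near y, G (gp y (t y)) = 0.
    by apply: near_open_eq oO _ Oy => w /Gt[].
  have := chain G y v sGB Oy.
  rewrite (near_eq_derive _ E) derive_cst.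
  move: ('D_e G _) nz ('D_(gp v 0) G _) ('D_v t y) => a a0 b c /esym/eqP.
  by rewrite addrC addr_eq0 => /eqP ca; apply: (mulIf a0); rewrite ca mulNr divfK.
apply: (@smooth_coind R _ _ O P oO).
- move=> f y [A sA ->] Oy.
  exact (differentiable_comp (dg y Oy) (smooth_diff sA (BO y Oy))).
- move=> f v [A sA ->].
  pose A' z : R^o := 'D_(gp v 0) A z - 'D_(gp v 0) G z * ('D_e G z)^-1 * 'D_e A z.
  exists (fun y => A' (gp y (t y))); last first.
    by move=> y Oy; rewrite /A' chain// Dt// mulNr.
  exists A' => //; apply: smoothD => //; first exact: smooth_derive.
  apply: smoothN => //; apply: smoothM => //; last exact: smooth_derive.
  apply: smoothM => //; first exact: smooth_derive.
  by apply: smoothV => //; exact: smooth_derive.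
- exists (fun z : 'rV[R]_(n + 1) => z 0 (rshift n 0) : R^o).
    by have /(smooth_mxP oB) := @smooth_id R _ B; apply.
  by apply/funext => y; rewrite row_mxEr mxE eqxx.
Qed.

(** The vertical mean value formula between t0 and t(y) gives t(y) = t0 - G(y, t0) / D_e G(y, c(y)).
    Here G(y, t0) is differentiable and zero at y0, and the other factor is continuous at y0, so
    [differentiable_mul0] applies. *)
Lemma differentiable_implicit (O : set 'rV[R]_n) (t : 'rV[R]_n -> R^o) : open O ->
  (forall y, O y -> [/\ `|y| < r, `|t y| < r & G (gp y (t y)) = 0]) ->
  forall y, O y -> differentiable t y.
Proof.
move=> oO Gt y0 Oy0; have [y0r t0r Gt0] := Gt y0 Oy0.
set t0 := t y0 in t0r Gt0.
have [c Hc] : {c : 'rV[R]_n -> R & forall y, O y -> [/\ `|c y| < r,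
    `|c y - t0| <= `|t y - t0| &
    G (gp y (t y)) - G (gp y t0) = (t y - t0) * 'D_e G (gp y (c y))]}.
  apply: (@choice _ _ (fun y c => O y -> [/\ `|c| < r, `|c - t0| <= `|t y - t0| &
    G (gp y (t y)) - G (gp y t0) = (t y - t0) * 'D_e G (gp y c)])) => y.
  have [Oy|nOy] := pselect (O y); last by exists 0.
  have [yr tr _] := Gt y Oy; have [c Hc] := vertical_mvt yr t0r tr.
  by exists c.
pose M y : R^o := G (gp y t0).
have dM : differentiable M y0.
  apply: (@differentiable_comp _ _ _ _ (fun y => gp y t0) G).
    by apply: (@differentiable_graph (fun=> t0)); exact: differentiable_cst.
  by apply: smooth_diff sG _; have [] := rZ (norm_graph_point r0 y0r t0r).
have nO : nbhs y0 O by exact: open_nbhs_nbhs.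
have ct : {for y0, continuous t}.
  apply/continuous_dist => e e0.
  have H : \forall y \near y0, `|M y0 - M y| < k * e.
    have cM : {for y0, continuous M} by exact: differentiable_continuous.
    by have /continuous_dist := cM; apply; exact: mulr_gt0.
  near=> y.
  have Oy : O y by near: y.
  have [yr tr Gy] := Gt y Oy.
  have := vertical_bound yr tr t0r; rewrite Gy subr0 => H1.
  have H2 : `|M y0 - M y| < k * e by near: y.
  move: H2; rewrite {1}/M Gt0 sub0r normrN => H2.
  by have := le_lt_trans H1 H2; rewrite ltr_pM2l.
have cq : {for y0, continuous (fun y => - ('D_e G (gp y (c y)))^-1 : R^o)}.
  have c0 : c y0 = t0.
    have [_ + _] := Hc y0 Oy0; rewrite -/t0 subrr normr0 normr_le0 subr_eq0.
    by move/eqP.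
  have z0r := norm_graph_point r0 y0r t0r.
  apply: continuousN; apply: continuousV.
    by rewrite c0; have [_] := rZ z0r => /(lt_trans k0)/lt0r_neq0.
  apply: (@continuous_comp _ _ _ (fun y => gp y (c y)) ('D_e G)); last first.
    rewrite c0; apply: differentiable_continuous.
    by apply: smooth_diff (smooth_derive _ sG) _; have [] := rZ z0r.
  apply/continuous_dist => e e0.
  have nb : \forall y \near y0, `|y0 - y| < e.
    by apply/nbhs_ballP; exists e => //= y; rewrite -ball_normE.
  near=> y; have Oy : O y by near: y.
  rewrite graph_pointB c0; apply: norm_graph_point => //.
  have [_ + _] := Hc y Oy; rewrite (distrC (c y)) (distrC (t y)) => H.
  apply: le_lt_trans H _; near: y.
  by have /continuous_dist := ct; apply.
suff E : \near y0, (t0 + M y0 * - ('D_e G (gp y0 (c y0)))^-1 : R^o) = t y0.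
  apply: near_eq_differentiable E _.
  apply: (@differentiableD _ _ _ (fun=> t0 : R^o)); first exact: differentiable_cst.
  by apply: (@differentiable_mul0 R _ M (fun y => - ('D_e G (gp y (c y)))^-1)).
apply: near_open_eq oO _ Oy0 => y Oy.
have [yr tr Gy] := Gt y Oy; have [cr _] := Hc y Oy.
rewrite Gy sub0r /M => E; have [_ kc] := rZ (norm_graph_point r0 yr cr).
have -> : G (gp y t0) = - ((t y - t0) * 'D_e G (gp y (c y))) by rewrite -E opprK.
by rewrite mulrNN (mulfK (lt0r_neq0 (lt_trans k0 kc))) addrC subrK.
Unshelve. all: by end_near. Qed.

(** At heights s and -s, with s = r / 2, G has opposite signs for small y, and t(y) is chosen
    between them by the intermediate value theorem. The choice is made pointwise; the lower bound on
    the vertical derivative is what makes it regular. *)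
Lemma implicit_positive : G (gp 0 0) = 0 ->
  exists O (t : 'rV[R]_n -> R^o), [/\ open O, O 0, t 0 = 0, smooth_on O t &
    forall y, O y -> `|gp y (t y)| < r /\ G (gp y (t y)) = 0].
Proof.
move=> G0; pose s := r / 2.
have s0 : 0 < s by rewrite divr_gt0.
have sr : s < r by rewrite ltr_pdivrMr// ltr_pMr// ltr1n.
have nr (c : R) : `|c| <= s -> `|c| < r by move=> ts; exact: le_lt_trans ts sr.
have z0r : `|0 : 'rV[R]_n| < r by rewrite normr0.
have c0r : `|0 : R| < r by rewrite normr0.
have sR : `|s| < r by rewrite gtr0_norm.
have NsR : `|- s| < r by rewrite normrN gtr0_norm.
have Gs : 0 < G (gp 0 s).
  have [c [cr _]] := vertical_mvt z0r c0r sR; rewrite G0 !subr0 => ->.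
  by have [_ kc] := rZ (norm_graph_point r0 z0r cr); rewrite mulr_gt0// (lt_trans k0).
have GNs : G (gp 0 (- s)) < 0.
  have [c [cr _]] := vertical_mvt z0r c0r NsR; rewrite G0 !subr0 => ->.
  have [_ kc] := rZ (norm_graph_point r0 z0r cr).
  by rewrite mulNr oppr_lt0 mulr_gt0// (lt_trans k0).
have cG c : `|c| < r -> {for 0, continuous (fun y => G (gp y c))}.
  move=> cr; apply: differentiable_continuous.
  apply: (@differentiable_comp _ _ _ _ (fun y => gp y c) G).
    by apply: (@differentiable_graph (fun=> c)); exact: differentiable_cst.
  by apply: smooth_diff sG _; have [] := rZ (norm_graph_point r0 z0r cr).
have nbr : nbhs (0 : 'rV[R]_n) [set y | `|y| < r].
  by apply/nbhs_ballP; exists r => //= y; rewrite -ball_normE/= sub0r normrN.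
have H1 : \forall y \near (0 : 'rV[R]_n), 0 < G (gp y s).
  have /continuous_dist/(_ _ Gs) := cG s sR; apply: filterS => y.
  by rewrite ltr_norml => /andP[_]; rewrite ltrBlDr ltrDl.
have H2 : \forall y \near (0 : 'rV[R]_n), G (gp y (- s)) < 0.
  have GNs' : 0 < - G (gp 0 (- s)) by rewrite oppr_gt0.
  have /continuous_dist/(_ _ GNs') := cG (- s) NsR; apply: filterS => y.
  by rewrite ltr_norml opprK => /andP[+ _]; rewrite ltrBrDr gtrDl.
have /nbhs_ballP[d /= d0 dP] : nbhs (0 : 'rV[R]_n) ([set y | `|y| < r] `&`
    ((fun y => 0 < G (gp y s)) `&` (fun y => G (gp y (- s)) < 0))).
  by apply: filterI => //; exact: filterI.
pose O : set 'rV[R]_n := ball 0 d.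
have oO : open O by exact: ball_open.
have [t tP] : {t : 'rV[R]_n -> R & forall y, O y -> `|t y| <= s /\ G (gp y (t y)) = 0}.
  apply: (@choice _ _ (fun y c => O y -> `|c| <= s /\ G (gp y c) = 0)) => y.
  have [Oy|nOy] := pselect (O y); last by exists 0.
  have [yr [G1 G2]] := dP y Oy.
  have [||c cs Gc] := @zero_between R (fun c => G (gp y c)) s (ltW s0).
  - move=> c cs; have -> : (fun c : R^o => G (gp y c)) = (fun c : R^o => G (gp y 0 + c *: e)).
      by apply/funext => x; rewrite -graph_pointD add0r.
    apply/derivable1_diffP; apply: ex_derive; apply: is_derive_line.
    rewrite -graph_pointD add0r; apply: smooth_diff sG _.
    by have [] := rZ (norm_graph_point r0 yr (nr c cs)).
  - by rewrite ge_min le_max (ltW G1) (ltW G2) orbT.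
  by exists c.
have O0 : O 0 by exact: ballxx.
have Ot y : O y -> [/\ `|y| < r, `|t y| < r & G (gp y (t y)) = 0].
  by move=> Oy; have [yr _] := dP y Oy; have [ts Gt] := tP y Oy; split=> //; exact: nr.
have Ot' y : O y -> `|gp y (t y)| < r /\ G (gp y (t y)) = 0.
  by move=> /Ot[yr tr Gy]; split=> //; exact: norm_graph_point.
exists O, t; split=> //.
  have [_ tr Gt] := Ot 0 O0.
  have := vertical_bound z0r tr c0r; rewrite G0 Gt subrr normr0 sub0r normrN.
  by rewrite pmulr_rle0// normr_le0 => /eqP.
apply: smooth_implicit => // y Oy; exact: differentiable_implicit oO Ot _ Oy.
Qed.

End ImplicitPositive.

Lemma implicit_function (Z : set 'rV[R]_(n + 1)) (G : 'rV[R]_(n + 1) -> R^o) :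
  open Z -> smooth_on Z G -> Z 0 -> G 0 = 0 -> 'D_e G 0 != 0 ->
  exists O (t : 'rV[R]_n -> R^o), [/\ open O, O 0, t 0 = 0, smooth_on O t &
    forall y, O y -> Z (gp y (t y)) /\ G (gp y (t y)) = 0].
Proof.
move=> oZ sG Z0 G0 DG.
have gp0 : gp 0 0 = 0 by rewrite /gp raddf0 row_mx0.
pose a := 'D_e G 0.
(* Multiplication by a = D_e G(0) makes the vertical derivative at 0 equal to a^2 > 0, which covers
   both signs of a. *)
pose G1 z : R^o := a * G z.
have sG1 : smooth_on Z G1 by apply: smoothM => //; exact: smooth_cst.
have DG1 : 'D_e G1 0 = a * a.
  have dG := smooth_diff sG Z0.
  rewrite [LHS](deriveMs e (differentiable_cst (a : R^o) 0) dG).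
  by rewrite derive_cst mulr0 addr0.
have aa : 0 < a * a by rewrite -expr2 exprn_even_gt0.
have k0 : 0 < a * a / 2 by rewrite divr_gt0.
have cD : {for 0, continuous ('D_e G1)}.
  by apply: differentiable_continuous; exact: smooth_diff (smooth_derive _ sG1) Z0.
have /nbhs_ballP[r /= r0 rP] : nbhs (0 : 'rV[R]_(n + 1))
    (Z `&` [set z | a * a / 2 < 'D_e G1 z]).
  apply: filterI; first exact: open_nbhs_nbhs.
  have /continuous_dist/(_ _ k0) := cD; apply: filterS => z /=.
  rewrite DG1 ltr_norml => /andP[_]; move: ('D_e G1 z) (a * a) => x b; lra.
have rZ z : `|z| < r -> Z z /\ a * a / 2 < 'D_e G1 z.
  by move=> zr; apply: rP; rewrite -ball_normE/= sub0r normrN.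
have G10 : G1 (gp 0 0) = 0 by rewrite /G1 gp0 G0 mulr0.
have [V [t [oV V0 t0 st Gt]]] := implicit_positive sG1 k0 r0 rZ G10.
exists V, t; split=> // y /Gt[yr /eqP]; have [Zy _] := rZ _ yr.
by rewrite mulf_eq0 (negbTE DG) => /eqP.
Qed.

End ImplicitFunction.

(** * Existence of normals *)

Section SmoothDeterminant.
Context (R : realType) (V : normedModType R) (U : set V) (oU : open U).

Lemma smooth_det n (A : V -> 'M[R]_n) : smooth_on U A ->
  smooth_on U (fun x => \det (A x) : R^o).
Proof.
move=> /(smooth_mxP oU) sA; apply: smooth_sum => // s.
apply: smoothM => //; first exact: smooth_cst.
by apply: smooth_prod => // i; exact: sA.
Qed.

Lemma smooth_invmx n (A : V -> 'M[R]_n) : (forall x, U x -> A x \in unitmx) ->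
  smooth_on U A -> smooth_on U (fun x => invmx (A x)).
Proof.
move=> uA sA; have sAe := (smooth_mxP oU A).1 sA.
apply: (@smooth_eq _ _ _ _ (fun x => (\det (A x))^-1 *: \adj (A x))) => //.
  by move=> x Ux; rewrite /invmx uA.
apply/(smooth_mxP oU) => i j; under eq_fun do rewrite 2!mxE.
apply: smoothM => //.
  apply: smoothV => //; last exact: smooth_det.
  by move=> x /uA; rewrite unitmxE unitfE.
apply: smoothM => //; first exact: smooth_cst.
apply: smooth_det; apply/(smooth_mxP oU) => k l; under eq_fun do rewrite 2!mxE.
exact: sAe.
Qed.

Lemma smooth_row_mx m n1 n2 (A : V -> 'M[R]_(m, n1)) (B : V -> 'M[R]_(m, n2)) :
  smooth_on U A -> smooth_on U B -> smooth_on U (fun x => row_mx (A x) (B x)).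
Proof.
move=> /(smooth_mxP oU) sA /(smooth_mxP oU) sB; apply/(smooth_mxP oU) => i j.
case: (split_ordP j) => k ->.
  by under eq_fun do rewrite row_mxEl; exact: sA.
by under eq_fun do rewrite row_mxEr; exact: sB.
Qed.

Lemma smooth_col_mx m1 m2 n (A : V -> 'M[R]_(m1, n)) (B : V -> 'M[R]_(m2, n)) :
  smooth_on U A -> smooth_on U B -> smooth_on U (fun x => col_mx (A x) (B x)).
Proof.
move=> /(smooth_mxP oU) sA /(smooth_mxP oU) sB; apply/(smooth_mxP oU) => i j.
case: (split_ordP i) => k ->.
  by under eq_fun do rewrite col_mxEu; exact: sA.
by under eq_fun do rewrite col_mxEd; exact: sB.
Qed.

Lemma smooth_trmx m n (A : V -> 'M[R]_(m, n)) :
  smooth_on U A -> smooth_on U (fun x => (A x)^T).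
Proof.
move=> /(smooth_mxP oU) sA; apply/(smooth_mxP oU) => i j.
by under eq_fun do rewrite mxE; exact: sA.
Qed.

Lemma smooth_scalar_mx (f : V -> R^o) :
  smooth_on U f -> smooth_on U (fun x => (f x)%:M : 'M[R]_1).
Proof.
move=> sf; apply/(smooth_mxP oU) => i j; rewrite !ord1.
by under eq_fun do rewrite mxE eqxx mulr1n.
Qed.

(* The exponent is chosen so that [c ^ 4 * beta ^ (2 n + 4) = delta ^ 2], and the
   prefactor [c] so that [c * beta] is positive whatever the sign of [c]. *)
Lemma normalizing_factor n (c delta : V -> R^o) :
  smooth_on U c -> smooth_on U delta ->
  (forall x, U x -> c x != 0) -> (forall x, U x -> delta x != 0) ->
  exists beta : V -> R^o, smooth_on U beta /\ forall x, U x ->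
    0 < c x * beta x /\ c x ^+ 4 * beta x ^+ (2 * n.+2) = delta x ^+ 2.
Proof.
move=> sc sd c0 d0.
(* The factor c occurs 4 times outside beta and 2 (n + 2) times inside it, in total 2 (n + 4), which
   is the power divided out here. *)
pose a x : R^o := delta x ^+ 2 / (c x ^+ 2) ^+ (n + 4).
have sq (y : R) : y != 0 -> 0 < y ^+ 2 by move=> y0; rewrite exprn_even_gt0.
have c2 x : U x -> 0 < c x ^+ 2 by move=> /c0; exact: sq.
have a0 x : U x -> 0 < a x.
  by move=> Ux; apply: divr_gt0; [exact/sq/d0|exact/exprn_gt0/c2].
have sa : smooth_on U a.
  apply: smoothM => //; first exact: smoothX.
  apply: smoothV => //; last by do 2 apply: smoothX => //.
  by move=> x Ux; rewrite expf_neq0// gt_eqF// c2.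
exists (fun x => c x * a x `^ ((2 * n.+2)%:R)^-1); split.
  by apply: smoothM => //; exact: smooth_powR.
move=> x Ux; split.
  by rewrite mulrA -expr2 mulr_gt0 ?c2// powR_gt0// a0.
have -> : (2 * n.+2)%N = (2 * n.+1).+1.+1 by lia.
rewrite exprMn powR_invn_exp ?ltW ?a0// mulrA -exprD /a.
rewrite -exprM (_ : (4 + (2 * n.+1).+2 = 2 * (n + 4))%N); last by lia.
by rewrite mulrC divfK// expf_neq0// c0.
Qed.

End SmoothDeterminant.

Section AffineNormalExistence.
Context (R : realType) (n : nat).
Context (M : set 'rV[R]_(n + 2)) (N : manifold R n).
Context (f xi : N -> 'rV[R]_(n + 2)).
Context (f_imm : immersion f) (f_in_M : forall p, M (f p)).
Context (f_nondeg : nondegenerate_immersion M f) (xi_darboux : darboux_field M f xi).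
Context (W : set 'rV[R]_(n + 2)) (F : 'rV[R]_(n + 2) -> R^o).
Context (dMF : defining_function M W F).
Context (nu : 'rV[R]_(n + 2)).
Hypothesis nuth : forall x, W x -> nu *m grad F x != 0.
Context (p : N).

Let U : set N := dom p `&` f @^-1` W.
Notation O := (coord_dom f W p).
Notation T := (jacobian (f \o param p)).
Notation th := (fun u => grad F (f (param p u))).
Notation H := (fun u => hess F (f (param p u))).

Lemma chart_frame q : dom p q ->
  exists2 P : 'M[R]_n, P \in unitmx & T (chart p q) = P *m TN f q.
Proof.
move=> dq; have /eqmxP/andP[_ sub] := TN_chart f_imm dq.
exact: same_row_space (row_free_chart f_imm dq) sub.
Qed.

Lemma chart_bracket_neq0 q e : dom p q -> W (f q) -> e *m grad F (f q) != 0 ->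
  bracket (T (chart p q)) e (xi q) != 0.
Proof.
move=> dq Wq eth; have [P uP ->] := chart_frame dq; rewrite bracket_mul.
apply: mulf_neq0; first by rewrite -unitfE -unitmxE.
apply: (@bracket_neq0 _ _ _ _ _ (grad F (f q))) => //.
- exact (TNxi_free f_imm xi_darboux q).
- exact (TN_grad f_imm f_in_M dMF Wq).
- exact (xi_grad f_in_M xi_darboux dMF Wq).
Qed.

Lemma chart_second_form_unit q : dom p q -> W (f q) ->
  second_form F (f q) (T (chart p q)) \in unitmx.
Proof.
move=> dq Wq; have [P uP ->] := chart_frame dq.
rewrite second_form_mul !unitmx_mul unitmx_tr uP.
by rewrite (second_form_unit f_imm f_in_M f_nondeg dMF Wq).
Qed.

(** Multiplying v by this matrix gives d^2F(v, T), dF(v) and the Euclidean product of v with xi. The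
    first two blocks are constrained for an affine normal; the last one fixes a representative
    modulo xi. *)
Definition conormal_mx u : 'M[R]_(n + (1 + 1)) :=
  row_mx (H u *m (T u)^T) (row_mx (th u) (xi (param p u))^T).

(** The first two blocks vanish only on the line of xi, and no nonzero multiple of xi is
    Euclidean-orthogonal to xi. *)
Lemma conormal_mx_unit u : O u -> conormal_mx u \in unitmx.
Proof.
move=> [q [dq Wq] <-]; have Wq' : W (f q) by [].
rewrite -row_free_unit; apply: inj_row_free => v; rewrite /conormal_mx chartK//.
rewrite !mul_mx_row => E.
have := congr1 lsubmx E; rewrite row_mxKl raddf0 mulmxA => vH.
have := congr1 rsubmx E; rewrite row_mxKr raddf0 => E2.
have := congr1 lsubmx E2; rewrite row_mxKl raddf0 => vth.
have := congr1 rsubmx E2; rewrite row_mxKr raddf0 => vxi.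
have /(xi_line f_imm f_in_M f_nondeg xi_darboux dMF Wq' vth)/sub_rVP[k vk] :
    v *m hess F (f q) *m (TN f q)^T = 0.
  have [P uP TP] := chart_frame dq; move: vH; rewrite TP trmx_mul mulmxA => vH.
  have uP' : P^T \in unitmx by rewrite unitmx_tr.
  by rewrite -[LHS](mulmxK uP') vH mul0mx.
have xi0 : xi q != 0 by have [_ /(_ q)[]] := xi_darboux.
move: vxi; rewrite vk -scalemxAl => /eqP; rewrite scaler_eq0 => /orP[/eqP->|].
  by rewrite scale0r.
move=> /eqP/matrixP/(_ 0 0); rewrite !mxE => S0.
suff x0 : xi q = 0 by rewrite x0 eqxx in xi0.
apply/rowP => j; rewrite mxE; apply/eqP.
have ge i : true -> 0 <= xi q 0 i * (xi q)^T i 0 by rewrite mxE -expr2 sqr_ge0.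
have /eqP := S0; rewrite psumr_eq0// => /allP/(_ j); rewrite mem_index_enum => /(_ isT).
by rewrite mxE mulf_eq0 orbb.
Qed.

(** The value beta of dF(eta) is dictated by the volume. Differentiating dF(eta) = beta shows that
    D_X eta is tangent to M exactly when d^2F(eta, X) = d beta(X). So eta is obtained from (d beta,
    beta, 0) by inverting [conormal_mx]. *)
Lemma affine_normal_field_exists :
  exists E eta, local_frame f U E /\ affine_normal_field M f xi U E eta.
Proof.
have [oW sF _ _] := dMF.
have oO : open O by exact (@coord_dom_open _ _ _ _ _ _ f_imm _ _ dMF p).
have sphi : smooth_on O (f \o param p) by exact (@smooth_param _ _ _ _ _ f_imm W p).
have OW u : O u -> W ((f \o param p) u) by move=> /coord_dom_sub.
have oU : open U by apply: openI; [exact: dom_open|exact (preimage_open f_imm dMF)].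
have sxi : smooth_on O (xi \o param p).
  have OT : O `<=` chart p @` (dom p `&` setT) by move=> _ [q [dq _] <-]; exists q.
  have sx := xi_smooth xi_darboux; exact (smooth_subset OT (sx p)).
have sT : smooth_on O T by exact (smooth_jacobian oO sphi).
have sth : smooth_on O th by exact (smooth_grad_comp oO sphi oW sF OW).
have sH : smooth_on O H by exact (smooth_hess_comp oO sphi oW sF OW).
have snu : smooth_on O (fun u => (nu *m th u) 0 0 : R^o).
  have := smooth_mulmx oO (smooth_cst nu) sth.
  by move/(smooth_mxP oO) => /(_ 0 0).
(* By proportionality of the bracket to dF, any vector with dF equal to beta has bracket c beta with
   T and xi. The positivity from [normalizing_factor] is thus positivity of the bracket, and its
   power relation is the volume condition. *)
pose c u : R^o := bracket (T u) nu (xi (param p u)) / (nu *m th u) 0 0.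
pose delta u : R^o := \det (T u *m H u *m (T u)^T).
have nz q : W (f q) -> (nu *m grad F (f q)) 0 0 != 0.
  move=> Wq; apply: contraNneq (nuth Wq) => E.
  by apply/eqP/matrixP => i j; rewrite !ord1 E mxE.
have sc : smooth_on O c.
  apply: smoothM => //.
    apply: smooth_det => //; apply: smooth_col_mx => //; apply: smooth_col_mx => //.
    exact: smooth_cst.
  apply: smoothV => // _ [q [dq Wq] <-]; rewrite chartK//; exact: nz.
have sTt : smooth_on O (fun u => (T u)^T) by exact: smooth_trmx.
have sdelta : smooth_on O delta.
  by apply: smooth_det => //; apply: smooth_mulmx => //; apply: smooth_mulmx.
have c0 u : O u -> c u != 0.
  move=> [q [dq Wq] <-]; rewrite /c chartK//; apply: mulf_neq0.
    by apply: chart_bracket_neq0 => //; exact: nuth.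
  by rewrite invr_neq0//; exact: nz.
have d0 u : O u -> delta u != 0.
  move=> [q [dq Wq] <-]; rewrite /delta chartK// -unitfE -unitmxE.
  exact: chart_second_form_unit.
have [beta [sbeta bP]] := normalizing_factor oO n sc sdelta c0 d0.
pose gb u : 'rV[R]_n := \row_j 'D_(delta_mx 0 j) beta u.
have sgb : smooth_on O gb.
  apply/(smooth_mxP oO) => i j; under eq_fun do rewrite mxE.
  exact: smooth_derive.
pose eh u : 'rV[R]_(n + 2) :=
  row_mx (gb u) (row_mx (beta u)%:M 0) *m invmx (conormal_mx u).
have sK : smooth_on O conormal_mx.
  apply: smooth_row_mx => //; first exact: smooth_mulmx.
  by apply: smooth_row_mx => //; exact: smooth_trmx.
have seh : smooth_on O eh.
  apply: smooth_mulmx => //; last by apply: smooth_invmx => //; exact: conormal_mx_unit.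
  apply: smooth_row_mx => //; apply: smooth_row_mx => //; last exact: smooth_cst.
  exact: smooth_scalar_mx.
have ehK u : O u -> eh u *m H u *m (T u)^T = gb u /\ eh u *m th u = (beta u)%:M.
  move=> Ou; have := mulmxKV (conormal_mx_unit Ou) (row_mx (gb u) (row_mx (beta u)%:M 0)).
  rewrite -/(eh u) /conormal_mx !mul_mx_row => E.
  have := congr1 lsubmx E; rewrite !row_mxKl mulmxA => E1.
  by have := congr1 (lsubmx \o rsubmx) E; rewrite /= !row_mxKr !row_mxKl => E2.
have mO q : dom p q -> W (f q) -> O (chart p q) by move=> dq Wq; exists q.
have UO : chart p @` U = O by [].
have Up : U `<=` dom p by move=> q [].
pose E q := T (chart p q); pose eta q := eh (chart p q).
have sE : msmooth_on U E by apply: msmooth_chart oU Up _; rewrite UO.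
have seta : msmooth_on U eta by apply: msmooth_chart oU Up _; rewrite UO.
have fE : local_frame f U E.
  split=> // q [dq Wq]; have /eqmxP/andP[_ sub] := TN_chart f_imm dq.
  by apply/andP; split; [exact (row_free_chart f_imm dq)|exact sub].
have etath q : dom p q -> W (f q) -> eta q *m grad F (f q) = (beta (chart p q))%:M.
  by move=> dq Wq; have [_] := ehK _ (mO q dq Wq); rewrite chartK.
have beta0 u : O u -> beta u != 0.
  by move=> /bP[cb _]; apply: contraTneq cb => ->; rewrite mulr0 ltxx.
have eta0 q : dom p q -> W (f q) -> eta q *m grad F (f q) != 0.
  move=> dq Wq; rewrite etath//; apply: contraNneq (beta0 _ (mO q dq Wq)).
  by move/matrixP/(_ 0 0); rewrite !mxE eqxx mulr1n => ->.
exists E, eta; split=> //; split=> //.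
- move=> q [dq Wq] /(TM_iff f_in_M dMF _ Wq) e0.
  by have := eta0 q dq Wq; rewrite e0 eqxx.
- move=> q X Uq XT; have [dq Wq] := Uq; apply/(TM_iff f_in_M dMF _ Wq).
  have Oq := mO q dq Wq.
  have /eqmxP/andP[sub _] := TN_chart f_imm dq.
  have /submxP[a ->] := submx_trans XT sub.
  (* The Hessian term is added and subtracted to produce the derivative of dF(eta) = beta; the
     equation for d^2F(eta, T) says that this derivative equals the added term. *)
  apply/eqP; rewrite -[X in X == 0](addrK (eta q *m hess F (f q) *m
    (a *m T (chart p q))^T)).
  rewrite (flatD_grad f_imm dMF a dq Uq Wq seta) subr_eq0; apply/eqP.
  have near_beta : \forall u \near chart p q,
      eta (param p u) *m grad F (f (param p u)) = (beta u)%:M.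
    have nO : nbhs (chart p q) O by exact: open_nbhs_nbhs.
    by apply: filterS nO => _ [x [dx Wx] <-]; rewrite chartK// etath.
  rewrite (near_eq_derive _ near_beta).
  have db := smooth_diff sbeta Oq.
  have [+ _] := ehK _ Oq; rewrite chartK// trmx_mul mulmxA => ->.
  apply/matrixP => i j; rewrite !ord1 derive_entry; last first.
    exact: smooth_diff (smooth_scalar_mx oO sbeta) Oq.
  under eq_fun do rewrite mxE eqxx mulr1n.
  rewrite derive_row// [RHS]mxE; apply: eq_bigr => k _.
  by rewrite [gb _ _ _]mxE [a^T _ _]mxE mulrC.
- move=> q U' X Uq oU' U'q fX oX nX; have [dq Wq] := Uq.
  have Oq := mO q dq Wq; have eth := eta0 q dq Wq.
  have Ed : delta (chart p q) = \det (second_form F (f q) (E q)).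
    by rewrite /delta (chartK dq).
  have eb : (eta q *m grad F (f q)) 0 0 = beta (chart p q).
    by rewrite (etath q dq Wq) mxE eqxx mulr1n.
  have Ec : bracket (E q) (eta q) (xi q) = c (chart p q) * beta (chart p q).
    have := bracket_grad (eta q) nu (grad_f_neq0 f_in_M dMF Wq)
      (chart_jacobian_grad f_imm f_in_M dMF dq Wq) (xi_grad f_in_M xi_darboux dMF Wq).
    rewrite eb => Eb; apply: (mulIf (nz q Wq)); rewrite -[LHS]Eb /c (chartK dq).
    by rewrite mulrAC (divfK (nz q Wq)).
  have [cb vol] := bP _ Oq.
  have pos : 0 < bracket (E q) (eta q) (xi q) by rewrite Ec; exact: cb.
  have := volume_normalized f_imm f_in_M f_nondeg xi_darboux dMF Wq Uq fE eth pos.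
  rewrite eb => /(_ _)E2.
  have := orthonormal_bracket f_imm f_in_M f_nondeg xi_darboux dMF Wq oU Uq fE eth
    oU' U'q fX oX nX.
  rewrite eb -E2 => [E1|]; last first.
    rewrite Ec exprMn -mulrA -exprD.
    have -> : (4 + 2 * n = 2 * n.+2)%N by lia.
    rewrite vol Ed; exact: erefl.
  by apply: (mulIf (lt0r_neq0 pos)); rewrite mul1r.
Qed.

End AffineNormalExistence.

Lemma open_smooth_neq0 (R : realType) (V : normedModType R) (U : set V) (g : V -> R^o) :
  open U -> smooth_on U g -> open (U `&` [set x | g x != 0]).
Proof.
move=> oU sg; rewrite openE => x [Ux gx]; apply: filterI; first exact: open_nbhs_nbhs.
have cg : {for x, continuous g} by exact/differentiable_continuous/(smooth_diff sg).
have g0 : 0 < `|g x| by rewrite normr_gt0.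
have /continuous_dist/(_ _ g0) := cg; apply: filterS => y.
by apply: contraTneq => ->; rewrite subr0 ltxx.
Qed.

(** * Hyperplane sections and the existence of their Blaschke normals *)

Section SectionNormalExistence.
Context (R : realType) (n : nat).
Context (M : set 'rV[R]_(n + 2)) (N : manifold R n).
Context (f xi : N -> 'rV[R]_(n + 2)).
Context (f_imm : immersion f) (f_in_M : forall p, M (f p)).
Context (f_nondeg : nondegenerate_immersion M f) (xi_darboux : darboux_field M f xi).
Context (W : set 'rV[R]_(n + 2)) (F : 'rV[R]_(n + 2) -> R^o).
Context (dMF : defining_function M W F).
Context (p : N) (Wp : W (f p)) (w : 'rV[R]_(n + 2)).
Hypothesis wth : w *m grad F (f p) != 0.

Let B : 'M[R]_(n + 1, n + 2) := col_mx (TN f p) w.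
Let e : 'rV[R]_(n + 1) := row_mx 0 1%:M.

Lemma section_base_free : row_free B.
Proof.
apply: row_free_col_mx; first by case: f_imm.
apply: contra wth => /submxP[a ->].
by rewrite -mulmxA (TN_grad f_imm f_in_M dMF Wp) mulmx0.
Qed.

Lemma section_base_TN : (TN f p <= B)%MS.
Proof. by apply/submxP; exists (row_mx 1%:M 0); rewrite mul_row_col mul1mx mul0mx addr0. Qed.

Lemma section_base_e : e *m B = w.
Proof. by rewrite mul_row_col mul0mx mul1mx add0r. Qed.

Lemma section_base_TM :
  ~ (forall v : 'rV[R]_(n + 2), (v <= B)%MS <-> TM M (f p) v).
Proof.
move=> H; have wB : (w <= B)%MS by rewrite -section_base_e submxMl.
by have := (TM_iff f_in_M dMF _ Wp).1 ((H w).1 wB); move/eqP; rewrite (negbTE wth).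
Qed.

(** In the basis (TN, w) of the hyperplane, the derivative of F in the last direction at the base
    point is dF(w), which is nonzero. The section is therefore locally a graph over TN, and the
    parametrization of a graph is an immersion. *)
Lemma section_param : exists (V : set 'rV[R]_n) (psi : 'rV[R]_n -> 'rV[R]_(n + 1)),
  [/\ open V, V 0, psi 0 = 0, smooth_on V psi & forall u, V u ->
    [/\ row_free ('J psi u), M (f p + psi u *m B) & W (f p + psi u *m B)]].
Proof.
have [oW sF MW _] := dMF.
pose rho (z : 'rV[R]_(n + 1)) := f p + z *m B.
have srho : smooth_on setT rho.
  apply: smooth_addmx; [exact: openT|exact: smooth_cst|].
  by apply: smooth_mulmx; [exact: openT|exact: smooth_id|exact: smooth_cst].
have drho z : differentiable rho z by exact: smooth_diff srho _.
pose Z := rho @^-1` W.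
have oZ : open Z.
  by apply: open_comp => // z _; exact: differentiable_continuous.
have rho0 : rho 0 = f p by rewrite /rho mul0mx addr0.
pose G z : R^o := F (rho z).
have sG : smooth_on Z G.
  have srhoZ : smooth_on Z rho by exact (smooth_subset (@subsetT _ Z) srho).
  exact (smooth_scomp oZ srhoZ (fun z Zz => Zz) sF).
have Z0 : Z 0 by rewrite /Z /preimage/= rho0.
have Feq0 : F (f p) = 0 by exact (defining_comp_eq0 f_in_M dMF Wp).
have G0 : G 0 = 0 by rewrite /G rho0.
have dF := smooth_diff sF Wp.
have Drho : 'D_e rho 0 = w.
  rewrite /rho; have -> : 'D_e (fun z : 'rV[R]_(n + 1) => f p + z *m B) 0 =
      'D_e (fun _ : 'rV[R]_(n + 1) => f p) 0 + 'D_e (fun z : 'rV[R]_(n + 1) => z *m B) 0.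
    apply: deriveD; apply: diff_derivable; first exact: differentiable_cst.
    by apply: differentiable_mulmx => //; exact: differentiable_cst.
  rewrite derive_cst add0r derive_mulmx; [|by []|exact: differentiable_cst].
  by rewrite derive_id derive_cst mulmx0 addr0 section_base_e.
have DG : 'D_e G 0 != 0.
  have dF0 : differentiable F (rho 0) by rewrite rho0.
  have := derive_comp e (drho 0) dF0; rewrite /= -/G Drho => ->.
  rewrite rho0; apply: contraNneq wth => /(derive_eq0 w dF) ->.
  by [].
have [V [t [oV V0 t0 st Vt]]] := implicit_function oZ sG Z0 G0 DG.
have spsi := smooth_graph oV st.
exists V, (fun y => graph_point y (t y)); split=> //.
  by rewrite /graph_point t0 raddf0 row_mx0.
move=> u Vu; have [Zu Gu] := Vt u Vu; split.
- apply: inj_row_free => v; have dt := smooth_diff st Vu.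
  rewrite (mul_jacobian v (smooth_diff spsi Vu)) derive_graph// /graph_point.
  by move/(congr1 lsubmx); rewrite row_mxKl raddf0.
- have : [set x | W x /\ F x = 0] (rho (graph_point u (t u))) by [].
  by rewrite -MW => -[].
- exact: Zu.
Qed.

Section BlaschkeField.
Context (V : set 'rV[R]_n) (psi : 'rV[R]_n -> 'rV[R]_(n + 1)).
Hypotheses (oV : open V) (spsi : smooth_on V psi).
Hypothesis psiV : forall u, V u ->
  [/\ row_free ('J psi u), M (f p + psi u *m B) & W (f p + psi u *m B)].

Let phi u := f p + psi u *m B.
Let ths u := B *m grad F (phi u).
Let delta u : R^o := \det (second_form F (phi u) ('J phi u)).
Let eth u : R^o := (e *m ths u) 0 0.
Hypothesis delta0 : forall u, V u -> delta u != 0.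
Hypothesis eth0 : forall u, V u -> eth u != 0.

Let psiM u : V u -> row_free ('J psi u) /\ M (f p + psi u *m B).
Proof. by move=> /psiV[]. Qed.

Let VW u : V u -> (V `&` phi @^-1` W) u.
Proof. by move=> Vu; split=> //; have [] := psiV Vu. Qed.

Lemma psi_ths u : V u -> 'J psi u *m ths u = 0.
Proof.
move=> Vu; have := section_jacobian_grad dMF oV spsi psiM (VW Vu).
by rewrite (section_jacobian f p B oV spsi Vu) -mulmxA.
Qed.

Lemma ths_neq0 u : V u -> ths u != 0.
Proof. by move=> /eth0; apply: contraNneq; rewrite /eth => ->; rewrite mulmx0 mxE. Qed.

(** The codimension one analogue of [conormal_mx]: the data d^2F(zeta, T) and dF(zeta) already
    determine zeta, the Blaschke normal having no freedom along a further direction. *)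
Definition section_conormal_mx u : 'M[R]_(n + 1) :=
  row_mx (B *m hess F (phi u) *m ('J phi u)^T) (ths u).

Lemma section_conormal_mx_unit u : V u -> section_conormal_mx u \in unitmx.
Proof.
move=> Vu; rewrite -row_free_unit; apply: inj_row_free => v.
rewrite /section_conormal_mx mul_mx_row => E.
have := congr1 lsubmx E; rewrite row_mxKl raddf0 => vH.
have := congr1 rsubmx E; rewrite row_mxKr raddf0 => vth.
have [fJ _ _] := psiV Vu.
have /submxP[x vx] := kernel_span (addn1 n) fJ (psi_ths Vu) (ths_neq0 Vu) vth.
have uh : second_form F (phi u) ('J phi u) \in unitmx.
  by rewrite unitmxE unitfE; exact: delta0.
move: vH; rewrite vx !mulmxA -[x *m _ *m B]mulmxA.
rewrite -(section_jacobian f p B oV spsi Vu) -!mulmxA [_ *m (hess _ _ *m _)]mulmxA => xh.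
have -> : x = 0 by rewrite -[x](mulmxK uh) xh mul0mx.
by rewrite mul0mx.
Qed.

(** As for the affine normal, the volume clause prescribes beta = dF(zeta), and zeta is equiaffine
    exactly when d^2F(zeta, T) = d beta. The constant vector [e], that is w in the ambient space,
    serves as reference transversal. *)
Lemma blaschke_field_exists : exists zeta, blaschke_field V psi zeta /\
  forall u, V u -> zeta u *m ths u != 0.
Proof.
have [oW sF _ _] := dMF.
have sphi : smooth_on V phi by exact (smooth_section f p B oV spsi).
have VW' u : V u -> W (phi u) by move=> /psiV[].
have sth : smooth_on V (fun u => grad F (phi u)).
  exact (smooth_grad_comp oV sphi oW sF VW').
have sH : smooth_on V (fun u => hess F (phi u)).
  exact (smooth_hess_comp oV sphi oW sF VW').
have sJ : smooth_on V (jacobian phi) by exact (smooth_jacobian oV sphi).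
have sJt : smooth_on V (fun u => (jacobian phi u)^T) by exact: smooth_trmx.
have sB : smooth_on V (fun _ : 'rV[R]_n => B) by exact: smooth_cst.
have sths : smooth_on V ths by exact: smooth_mulmx.
have sdelta : smooth_on V delta.
  by apply: smooth_det => //; apply: smooth_mulmx => //; exact: smooth_mulmx.
have se : smooth_on V (fun _ : 'rV[R]_n => e) by exact: smooth_cst.
have seth : smooth_on V eth.
  by have := smooth_mulmx oV se sths; move/(smooth_mxP oV) => /(_ 0 0).
have sJpsi : smooth_on V (jacobian psi) by exact (smooth_jacobian oV spsi).
pose c u : R^o := \det (col_mx ('J psi u) e) / eth u.
have sc : smooth_on V c.
  apply: smoothM => //; last by apply: smoothV.
  by apply: smooth_det => //; exact: smooth_col_mx.
have c0 u : V u -> c u != 0.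
  move=> Vu; have [fJ _ _] := psiV Vu.
  apply: mulf_neq0; last by rewrite invr_neq0//; exact: eth0.
  rewrite -unitfE -unitmxE; apply: col_mx_unit fJ (psi_ths Vu) _.
  by apply: contraNneq (eth0 Vu) => E; rewrite /eth E mxE.
have [beta [sbeta bP]] := normalizing_factor oV n sc sdelta c0 delta0.
have beta0 u : V u -> beta u != 0.
  by move=> /bP[cb _]; apply: contraTneq cb => ->; rewrite mulr0 ltxx.
pose gb u : 'rV[R]_n := \row_j 'D_(delta_mx 0 j) beta u.
have sgb : smooth_on V gb.
  apply/(smooth_mxP oV) => i j; under eq_fun do rewrite mxE.
  exact: smooth_derive.
pose zeta u : 'rV[R]_(n + 1) :=
  row_mx (gb u) (beta u)%:M *m invmx (section_conormal_mx u).
have sK : smooth_on V section_conormal_mx.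
  apply: smooth_row_mx => //; apply: smooth_mulmx => //; exact: smooth_mulmx.
have szeta : smooth_on V zeta.
  apply: smooth_mulmx => //; last by apply: smooth_invmx => //; exact: section_conormal_mx_unit.
  by apply: smooth_row_mx => //; exact: smooth_scalar_mx.
have zK u : V u -> zeta u *m B *m hess F (phi u) *m ('J phi u)^T = gb u /\
    zeta u *m ths u = (beta u)%:M.
  move=> Vu; have := mulmxKV (section_conormal_mx_unit Vu) (row_mx (gb u) (beta u)%:M).
  rewrite -/(zeta u) /section_conormal_mx mul_mx_row => E.
  have E1 := congr1 lsubmx E; rewrite !row_mxKl !mulmxA in E1.
  by have E2 := congr1 rsubmx E; rewrite !row_mxKr in E2.
have zth u : V u -> zeta u *m ths u != 0.
  move=> Vu; have [_ ->] := zK u Vu; apply: contraNneq (beta0 u Vu).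
  by move/matrixP/(_ 0 0); rewrite !mxE eqxx mulr1n => ->.
have uA u : V u -> col_mx ('J psi u) (zeta u) \in unitmx.
  by move=> Vu; have [fJ _ _] := psiV Vu; exact: col_mx_unit fJ (psi_ths Vu) (zth u Vu).
have dets u : V u -> \det (blaschke_form psi zeta u) ^+ 2 * beta u ^+ (2 * n) = delta u ^+ 2.
  move=> Vu; have [_ zb] := zK u Vu.
  have := blaschke_form_grad dMF oV spsi psiM (VW Vu) (uA u Vu).
  rewrite -[zeta u *m B *m _]mulmxA -/(phi u) -/(ths u) zb mxE eqxx mulr1n.
  move/(congr1 (fun A => \det A ^+ 2)); rewrite detZ -scaleN1r detZ det_tr.
  rewrite !exprMn -!exprM [(n * 2)%N]mulnC [(-1) ^+ _]exprM sqrrN !expr1n mul1r => E.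
  by rewrite mulrC E.
exists zeta; split=> //; split=> // u Vu; split.
- exact: uA.
- have := delta0 Vu; apply: contraNneq => E.
  by rewrite -sqrf_eq0 -(dets u Vu) E expr0n mul0r.
- move=> a; have [fJ _ _] := psiV Vu.
  have dphi := smooth_diff sphi Vu; have dz := smooth_diff szeta Vu.
  have dB : differentiable (fun _ : 'rV[R]_n => B) u by exact: differentiable_cst.
  have dzB : differentiable (fun u => zeta u *m B) u by exact: differentiable_mulmx.
  have db := smooth_diff sbeta Vu.
  apply: kernel_span (addn1 n) fJ (psi_ths Vu) (ths_neq0 Vu) _.
  have E : \near u, zeta u *m B *m grad F (phi u) = (beta u)%:M.
    apply: near_open_eq oV _ Vu => y Vy; have [_ <-] := zK y Vy.
    by rewrite mulmxA.
  have := derive_mul_grad oV sphi oW sF VW' a Vu dzB.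
  rewrite (near_eq_derive _ E) (derive_mulmx a dz dB) (derive_cst B) mulmx0 addr0.
  have [zH _] := zK u Vu.
  have -> : zeta u *m B *m hess F (phi u) *m ('D_a phi u)^T = ('D_a beta u)%:M.
    rewrite -(mul_jacobian a dphi) trmx_mul mulmxA zH.
    apply/matrixP => i j; rewrite !ord1 derive_row// mxE [RHS]mxE eqxx mulr1n.
    by apply: eq_bigr => k _; rewrite [gb _ _ _]mxE [a^T _ _]mxE mulrC.
  have -> : 'D_a (fun u => (beta u)%:M : 'M[R]_1) u = ('D_a beta u)%:M.
    apply/matrixP => i j; rewrite !ord1 derive_entry; last first.
      exact: smooth_diff (smooth_scalar_mx oV sbeta) Vu.
    under eq_fun do rewrite mxE eqxx mulr1n.
    by rewrite mxE eqxx mulr1n.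
  by move/eqP; rewrite -subr_eq subrr => /eqP E0; rewrite /ths mulmxA -E0.
- have [cb vol] := bP u Vu.
  have dE : \det (col_mx ('J psi u) (zeta u)) = c u * beta u.
    have := det_col_grad (zeta u) e (psi_ths Vu); have [_ ->] := zK u Vu.
    rewrite -/(eth u) [(beta u)%:M 0 0]mxE eqxx mulr1n => E.
    apply: (mulIf (eth0 Vu)); rewrite E /c; field; exact: eth0.
  have d4 : \det (col_mx ('J psi u) (zeta u)) ^+ 4 = \det (blaschke_form psi zeta u) ^+ 2.
    apply: (mulIf (x := beta u ^+ (2 * n))); first by rewrite expf_neq0// beta0.
    rewrite (dets u Vu) -vol dE exprMn -mulrA -exprD.
    by have -> : (4 + 2 * n = 2 * n.+2)%N by lia.
  set d := \det _ in dE d4 *; set b := \det _ in d4 *.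
  (* Both sides are nonnegative and [d4] equates their squares; the required square root is then
     that of d^2. *)
  have -> : `|b| = `|d| ^+ 2.
    apply/eqP; rewrite -(@eqrXn2 _ 2) ?normr_ge0 ?exprn_ge0//.
    by rewrite real_normK ?num_real// -exprM -d4 -normrX ger0_norm// exprn_even_ge0.
  by rewrite sqrtr_sqr normr_id.
Qed.

End BlaschkeField.

(** The quantities [delta] and [eth] are nonzero at the base point, by non-degeneracy of N and by
    the choice of w, and the parametrization is restricted to a neighbourhood where they stay so.
    Knowing that the normal lies in TN + w later identifies its direction. *)
Lemma section_normal_exists : exists v, [/\ section_normal M f p v,
  (v <= col_mx (TN f p) w)%MS & v *m grad F (f p) != 0].
Proof.
have [oW sF _ _] := dMF.
have [V [psi [oV V0 psi0 spsi psiV]]] := section_param.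
pose phi u := f p + psi u *m B.
pose delta u : R^o := \det (second_form F (phi u) ('J phi u)).
pose eth u : R^o := (e *m (B *m grad F (phi u))) 0 0.
have phi0 : phi 0 = f p by rewrite /phi psi0 mul0mx addr0.
have sphi : smooth_on V phi by exact (smooth_section f p B oV spsi).
have VW' u : V u -> W (phi u) by move=> /psiV[].
have sth : smooth_on V (fun u => grad F (phi u)).
  exact (smooth_grad_comp oV sphi oW sF VW').
have sH : smooth_on V (fun u => hess F (phi u)).
  exact (smooth_hess_comp oV sphi oW sF VW').
have sJ : smooth_on V (jacobian phi) by exact (smooth_jacobian oV sphi).
have sdelta : smooth_on V delta.
  apply: smooth_det => //; apply: smooth_mulmx => //; last exact: smooth_trmx.
  exact: smooth_mulmx.
have seth : smooth_on V eth.
  have := smooth_mulmx oV (smooth_cst e) (smooth_mulmx oV (smooth_cst B) sth).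
  by move/(smooth_mxP oV) => /(_ 0 0).
pose V1 := V `&` [set u | delta u != 0]; pose V2 := V1 `&` [set u | eth u != 0].
have oV1 : open V1 by exact: open_smooth_neq0.
have seth1 : smooth_on V1 eth by apply: smooth_subset seth => u [].
have oV2 : open V2 by exact: open_smooth_neq0.
have V2V : V2 `<=` V by move=> u [[]].
have psiM u : V u -> row_free ('J psi u) /\ M (f p + psi u *m B) by move=> /psiV[].
have VW : (V `&` phi @^-1` W) 0 by split=> //; exact: VW'.
have delta0 : delta 0 != 0.
  have [P uP TE] : exists2 P : 'M[R]_n, P \in unitmx & 'J phi 0 = P *m TN f p.
    apply: same_row_space.
      rewrite (section_jacobian f p B oV spsi V0) /row_free mxrankMfree.
        by have [] := psiM 0 V0.
      exact section_base_free.
    apply/row_subP => i.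
    apply: (section_tangent f_imm f_in_M xi_darboux dMF Wp section_base_free
      section_base_TN section_base_TM).
      by rewrite (section_jacobian f p B oV spsi V0) row_mul submxMl.
    have := section_jacobian_grad dMF oV spsi psiM VW.
    by rewrite -/(phi 0) phi0 -row_mul => ->; rewrite row0.
  rewrite /delta phi0 TE second_form_mul -unitfE -unitmxE !unitmx_mul unitmx_tr uP.
  by rewrite (second_form_unit f_imm f_in_M f_nondeg dMF Wp).
have eth0 : eth 0 != 0.
  rewrite /eth phi0 mulmxA section_base_e; apply: contraNneq wth => E.
  by apply/eqP/matrixP => i j; rewrite !ord1 E mxE.
have psiV2 u : V2 u ->
    [/\ row_free ('J psi u), M (f p + psi u *m B) & W (f p + psi u *m B)].
  by move=> /V2V; exact: psiV.
have spsi2 : smooth_on V2 psi by exact (smooth_subset V2V spsi).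
have d2 u : V2 u -> delta u != 0 by move=> [[]].
have e2 u : V2 u -> eth u != 0 by move=> [].
have [zeta [bf zth]] := blaschke_field_exists oV2 spsi2 psiV2 d2 e2.
have V20 : V2 0 by [].
exists (zeta 0 *m B); split; last 2 first.
- exact: submxMl.
- by have := zth 0 V20; rewrite -/(phi 0) phi0 mulmxA.
exists B, (zeta 0); split=> //.
- exact section_base_free.
- exact section_base_TN.
- exact section_base_TM.
exists V2, psi, zeta, 0; split=> //.
by move=> u /psiV2[].
Qed.

End SectionNormalExistence.

(** * The two planes *)

Section TransonPlane.
Context (R : realType) (n : nat) (n_gt0 : (0 < n)%N).
Context (M : set 'rV[R]_(n + 2)) (N : manifold R n).
Context (f xi : N -> 'rV[R]_(n + 2)).
Context (f_imm : immersion f) (f_in_M : forall p, M (f p)).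
Context (f_nondeg : nondegenerate_immersion M f) (xi_darboux : darboux_field M f xi).
Context (W : set 'rV[R]_(n + 2)) (F : 'rV[R]_(n + 2) -> R^o).
Context (dMF : defining_function M W F) (p : N) (Wp : W (f p)).
Implicit Types (a : 'rV[R]_n) (v w : 'rV[R]_(n + 2)).

Definition plane_form a : 'cV[R]_(n + 2) :=
  n.+2%:R *: (a *m TN f p *m hess F (f p))^T -
  cubic_trace F (f p) (TN f p) (a *m TN f p) *: grad F (f p).

(** The common model for the two planes: the common kernel of the covectors [plane_form a], which
    express the equation with tau = 0. *)
Definition in_plane v := forall a, v *m plane_form a = 0.

Lemma mul_plane_form a v : v *m plane_form a =
  (n.+2%:R * (a *m TN f p *m hess F (f p) *m v^T) 0 0 -
   cubic_trace F (f p) (TN f p) (a *m TN f p) * (v *m grad F (f p)) 0 0)%:M.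
Proof.
rewrite mulmxBr -!scalemxAr [v *m _^T in LHS]mx11_scalar.
rewrite [v *m grad F (f p) in LHS]mx11_scalar !scale_scalar_mx -raddfB.
congr (_ * _ - _)%:M.
by rewrite -[in RHS](trmxK (a *m TN f p *m hess F (f p))) -trmx_mul [RHS]mxE.
Qed.

Lemma in_planeB k v w : in_plane v -> in_plane w -> in_plane (v - k *: w).
Proof. by move=> Pv Pw a; rewrite mulmxBl -scalemxAl Pv Pw scaler0 subr0. Qed.

Lemma section_normal_plane v : section_normal M f p v -> in_plane v.
Proof.
move=> sv a; rewrite mul_plane_form.
by rewrite (section_normal_relation a f_imm f_in_M f_nondeg xi_darboux dMF Wp sv) subrr raddf0.
Qed.

Lemma xi_plane : in_plane (xi p).
Proof.
move=> a; rewrite mul_plane_form (xi_grad f_in_M xi_darboux dMF Wp).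
have [oW sF _ _] := dMF.
have -> : a *m TN f p *m hess F (f p) *m (xi p)^T = 0.
  apply: trmx_inj; rewrite !trmx_mul trmxK (hess_sym oW sF Wp) !mulmxA.
  by rewrite (xi_hess f_imm f_in_M xi_darboux dMF Wp) mul0mx trmx0.
by rewrite !mxE !mulr0 subrr raddf0.
Qed.

Lemma plane_tangent_hess v : in_plane v -> v *m grad F (f p) = 0 ->
  v *m hess F (f p) *m (TN f p)^T = 0.
Proof.
move=> Pv vth; have [oW sF _ _] := dMF.
apply: trmx_inj; rewrite trmx_mul trmxK trmx_mul (hess_sym oW sF Wp) trmx0.
apply/matrixP => i j; rewrite (ord1 j) [RHS]mxE.
have := Pv (delta_mx 0 i); rewrite mul_plane_form vth [X in _ - _ * X]mxE mulr0 subr0.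
move/matrixP/(_ 0 0); rewrite [LHS]mxE [RHS]mxE eqxx mulr1n => /eqP.
rewrite mulf_eq0 pnatr_eq0/= => /eqP E.
by rewrite -[RHS]E -rowE -!row_mul [RHS]mxE mulmxA.
Qed.

Lemma plane_xi v : in_plane v -> v *m grad F (f p) = 0 -> (v <= xi p)%MS.
Proof.
move=> Pv vth.
exact (xi_line f_imm f_in_M f_nondeg xi_darboux dMF Wp vth (plane_tangent_hess Pv vth)).
Qed.

(** Some combination v - c w lies in TN and still satisfies the equations. Since dF vanishes on it,
    they make it Hessian-orthogonal to TN, so it is zero: the plane meets the hyperplane TN + w in
    the line of w. *)
Lemma plane_section v w : in_plane v -> in_plane w ->
  (v <= col_mx (TN f p) w)%MS -> exists c, v = c *: w.
Proof.
move=> Pv Pw /submxP[z vE]; move: vE; rewrite -[z]hsubmxK mul_row_col.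
set x := lsubmx z; rewrite [rsubmx z]mx11_scalar mul_scalar_mx; set c := rsubmx z 0 0 => vE.
exists c; have xE : x *m TN f p = v - c *: w by rewrite vE addrK.
have xth : x *m TN f p *m grad F (f p) = 0.
  by rewrite -mulmxA (TN_grad f_imm f_in_M dMF Wp) mulmx0.
have Px : in_plane (x *m TN f p) by rewrite xE; exact: in_planeB.
have := plane_tangent_hess Px xth; rewrite -!mulmxA [TN f p *m (_ *m _)]mulmxA => xh.
have uh := second_form_unit f_imm f_in_M f_nondeg dMF Wp.
have x0 : x = 0 by rewrite -[x](mulmxK uh) xh mul0mx.
by rewrite vE x0 mul0mx add0r.
Qed.

(** Subtracting the multiple of w with the same value under dF leaves a solution tangent to M, and
    such solutions are multiples of xi. *)
Lemma plane_span v w : in_plane v -> in_plane w -> w *m grad F (f p) != 0 ->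
  exists c s, v = c *: w + s *: xi p.
Proof.
move=> Pv Pw wth.
have w0 : (w *m grad F (f p)) 0 0 != 0.
  by apply: contraNneq wth => E; apply/eqP/matrixP => i j; rewrite !ord1 E mxE.
pose c := (v *m grad F (f p)) 0 0 / (w *m grad F (f p)) 0 0.
have dth : (v - c *: w) *m grad F (f p) = 0.
  rewrite mulmxBl -scalemxAl [w *m _]mx11_scalar [v *m _]mx11_scalar scale_scalar_mx.
  by rewrite divfK// subrr.
have /sub_rVP[s E] := plane_xi (in_planeB c Pv Pw) dth.
by exists c, s; rewrite -E addrC subrK.
Qed.

Lemma transon_plane_sub v : transon_plane M f p v -> in_plane v.
Proof.
move=> [k [C [sC /submxP[y ->]]]] a; rewrite -mulmxA.
suff -> : C *m plane_form a = 0 by rewrite mulmx0.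
apply/row_matrixP => i; rewrite row_mul row0.
exact: section_normal_plane (sC i) a.
Qed.

(** For each solution w' transversal to M, the Blaschke normal of the section by TN + w' is a
    nonzero multiple of w'. The two solutions w and w + xi give two independent normals, whose span
    contains w and xi. *)
Lemma plane_sub_transon v w : in_plane v -> in_plane w -> w *m grad F (f p) != 0 ->
  transon_plane M f p v.
Proof.
move=> Pv Pw wth.
have xith := xi_grad f_in_M xi_darboux dMF Wp.
have normal w' : in_plane w' -> w' *m grad F (f p) != 0 ->
    exists2 c, c != 0 & section_normal M f p (c *: w').
  move=> Pw' wth'.
  have [u [su uB uth]] := section_normal_exists f_imm f_in_M f_nondeg xi_darboux dMF Wp wth'.
  have [c uE] := plane_section (section_normal_plane su) Pw' uB.
  exists c; last by rewrite -uE.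
  by apply: contraNneq uth => c0; rewrite uE c0 scale0r mul0mx.
have Pwx : in_plane (w + xi p).
  by move=> a; rewrite mulmxDl Pw xi_plane addr0.
have wxth : (w + xi p) *m grad F (f p) != 0 by rewrite mulmxDl xith addr0.
have [c1 c10 s1] := normal w Pw wth.
have [c2 c20 s2] := normal _ Pwx wxth.
have [c [s ->]] := plane_span Pv Pw wth.
exists (1 + 1)%N, (col_mx (c1 *: w) (c2 *: (w + xi p))); split=> [i|].
  by case: (split_ordP i) => k ->; rewrite ?rowKu ?rowKd (ord1 k) row_id.
(* From c w + s xi = (c - s) w + s (w + xi), each coefficient being divided by the scale of the
   corresponding section normal. *)
apply/submxP; exists (row_mx ((c - s) / c1)%:M (s / c2)%:M).
rewrite mul_row_col !mul_scalar_mx !scalerA !divfK// scalerDr addrA -scalerDl.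
by rewrite subrK.
Qed.

(** The defect of eta in the equations is a multiple of tau with factor - 2 dF(eta), nonzero by
    transversality: this is what makes membership of eta equivalent to tau = 0. *)
Lemma affine_normal_plane_relation U E eta a S tau : open U -> U p ->
  local_frame f U E -> affine_normal_field M f xi U E eta ->
  flatD f xi p (a *m TN f p) = S *m TN f p + tau *: xi p ->
  eta p *m plane_form a = (- (2 * tau * (eta p *m grad F (f p)) 0 0))%:M.
Proof.
move=> oU Up fE nE Dxi; rewrite mul_plane_form.
rewrite (affine_normal_relation n_gt0 f_imm f_in_M f_nondeg xi_darboux dMF oU fE nE Up Wp Dxi).
by congr (_%:M); ring.
Qed.

Lemma xi_derivative a : exists S tau,
  flatD f xi p (a *m TN f p) = S *m TN f p + tau *: xi p.
Proof.
have xT : ~~ (xi p <= TN f p)%MS by have [_ /(_ p)[]] := xi_darboux.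
have dth := flatD_xi_grad f_in_M xi_darboux dMF Wp (submxMl a (TN f p)).
have /submxP[z ->] := tangent_span f_imm f_in_M dMF Wp xT
  (xi_grad f_in_M xi_darboux dMF Wp) dth.
exists (lsubmx z), (rsubmx z 0 0).
by rewrite -{1}[z]hsubmxK mul_row_col [rsubmx z in LHS]mx11_scalar mul_scalar_mx.
Qed.

Lemma affine_normal_exists : exists U E eta, [/\ open U, U p, local_frame f U E &
  affine_normal_field M f xi U E eta].
Proof.
have [oW sF MW nF] := dMF.
have [nu Dnu] := nF _ Wp (f_in_M p).
(* A single constant vector nu has to be transversal to the level sets over the whole domain, so W
   is reduced to the open set where dF(nu) is nonzero. *)
pose W' := W `&` [set x | (nu *m grad F x) 0 0 != 0].
have oW' : open W'.
  apply: (@open_smooth_neq0 _ _ W (fun x => (nu *m grad F x) 0 0 : R^o)) => //.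
  have := smooth_mulmx oW (smooth_cst nu) (smooth_grad oW sF).
  by move/(smooth_mxP oW) => /(_ 0 0).
have W'W : W' `<=` W by move=> x [].
have dMF' : defining_function M W' F.
  split=> //; first exact (smooth_subset W'W sF).
    apply/seteqP; split=> x.
      move=> [Mx W'x]; split=> //; have : (M `&` W) x by split=> //; exact: W'W.
      by rewrite MW => -[].
    move=> [W'x Fx]; split=> //; have : [set x | W x /\ F x = 0] x by split=> //; exact: W'W.
    by rewrite -MW => -[].
  by move=> x [Wx _]; exact: nF.
have nuth x : W' x -> nu *m grad F x != 0.
  by move=> [_]; apply: contraNneq => ->; rewrite mxE.
have W'p : W' (f p).
  split; first exact: Wp.
  by rewrite /mkset -(derive_gradE nu (smooth_diff sF Wp)).
have [E [eta [fE nE]]] := affine_normal_field_exists f_imm f_in_M f_nondeg xi_darboux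
  dMF' nuth p.
exists (dom p `&` f @^-1` W'), E, eta; split=> //; last by split; [exact: mem_dom|].
by apply: openI; [exact: dom_open|exact (preimage_open f_imm dMF')].
Qed.

End TransonPlane.

Theorem theorem6p6 (R : realType) (n : nat) (n_gt0 : (0 < n)%N)
    (M : set 'rV[R]_(n + 2)) (N : manifold R n) (f : N -> 'rV[R]_(n + 2))
    (xi : N -> 'rV[R]_(n + 2))
    (M_hypersurface : hypersurface M)
    (f_immersion : immersion f)
    (f_in_M : forall p : N, M (f p))
    (f_nondegenerate : nondegenerate_immersion M f)
    (xi_darboux : darboux_field M f xi) :
  (forall p : N, affine_normal_plane M f xi p = transon_plane M f p) <->
  parallel_field f xi.
Proof.
split=> [planes p X /submxP[a ->]|xi_parallel p];
  have [W [F [Wp dMF]]] := M_hypersurface (f p) (f_in_M p).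
  have [S [tau Dxi]] := xi_derivative f_immersion f_in_M xi_darboux dMF Wp a.
  (* Zero is the combination of an empty family of section normals. The assumed equality then places
     it in the affine normal plane, which produces an affine normal field at p. *)
  have : transon_plane M f p 0.
    by exists 0%N, 0; split=> [[]//|]; exact: sub0mx.
  rewrite -planes => -[U [E [eta [oU Up fE nE _]]]].
  have : affine_normal_plane M f xi p (eta p).
    exists U, E, eta; split=> //; apply/submxP; exists (row_mx 0 1%:M).
    by rewrite mul_row_col mul0mx mul1mx add0r.
  rewrite planes => teta.
  have := transon_plane_sub f_immersion f_in_M f_nondegenerate xi_darboux dMF Wp teta a.
  rewrite (affine_normal_plane_relation n_gt0 f_immersion f_in_M f_nondegenerate
    xi_darboux dMF Wp oU Up fE nE Dxi).
  have eth := affine_normal_transversal f_in_M dMF nE Up Wp.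
  move/matrixP/(_ 0 0); rewrite [LHS]mxE [RHS]mxE eqxx mulr1n => /eqP.
  rewrite oppr_eq0 !mulf_eq0 pnatr_eq0/= => /orP[/eqP t0|/eqP e0].
    by rewrite Dxi t0 scale0r addr0 submxMl.
  suff e1 : eta p *m grad F (f p) = 0 by rewrite e1 eqxx in eth.
  by apply/matrixP => i j; rewrite !ord1 e0 mxE.
(* The affine normal plane is a union over all local orientations and affine normal fields, so the
   equations are established for every such field and not only for a constructed one. *)
have eta_plane U E eta : open U -> U p -> local_frame f U E ->
    affine_normal_field M f xi U E eta -> in_plane f F p (eta p).
  move=> oU Up fE nE a.
  have /submxP[S DS] := xi_parallel p _ (submxMl a (TN f p)).
  have Dxi : flatD f xi p (a *m TN f p) = S *m TN f p + 0 *: xi p.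
    by rewrite scale0r addr0.
  rewrite (affine_normal_plane_relation n_gt0 f_immersion f_in_M f_nondegenerate
    xi_darboux dMF Wp oU Up fE nE Dxi).
  by rewrite mulr0 mul0r oppr0 raddf0.
have [U [E [eta [oU Up fE nE]]]] := affine_normal_exists f_immersion f_in_M f_nondegenerate
  xi_darboux dMF Wp.
have Pe := eta_plane U E eta oU Up fE nE.
have eth := affine_normal_transversal f_in_M dMF nE Up Wp.
apply/seteqP; split=> v.
  move=> [U' [E' [eta' [oU' U'p fE' nE' /submxP[z ->]]]]].
  apply: (plane_sub_transon f_immersion f_in_M f_nondegenerate xi_darboux dMF Wp _ Pe eth).
  move=> a; rewrite -mulmxA mul_col_mx.
  rewrite (xi_plane f_immersion f_in_M xi_darboux dMF Wp a).
  by rewrite (eta_plane _ _ _ oU' U'p fE' nE' a) col_mx0 mulmx0.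
move=> /(transon_plane_sub f_immersion f_in_M f_nondegenerate xi_darboux dMF Wp) Pv.
have [c [s ->]] := plane_span f_immersion f_in_M f_nondegenerate xi_darboux dMF Wp Pv Pe eth.
exists U, E, eta; split=> //; apply/submxP; exists (row_mx s%:M c%:M).
by rewrite mul_row_col !mul_scalar_mx addrC.
Qed.
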